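(* Let $A,N_1,\dots,N_q\in\mathbb R^{n\times n}$, $B\in\mathbb R^{n\times m}$, $C\in\mathbb R^{p\times n}$. The strict inequality $$A^\top P^{-1}+P^{-1}A+\sum_{i,j=1}^q N_i^\top P^{-1}N_jk_{ij}-C^\top C+P^{-1}BB^\top P^{-1}<0$$ possesses a solution $P=P_+>0$ if and only if $(A^\top,C^\top,N_i^\top)$ is stabilizable.
   Context: $W=(W_1,\dots,W_q)^\top$ is an $\mathbb R^q$-valued mean-zero Wiener process with covariance matrix $K=(k_{ij})$, i.e. $\mathbb E[W(t)W(t)^\top]=Kt$, adapted to a right-continuous complete filtration $(\mathcal F_t)_{t\ge0}$ on a probability space, with increments $W(t+h)-W(t)$ independent of $\mathcal F_t$. $L^2$ is the set of adapted processes $v$ with $\mathbb E\int_0^\infty\|v(s)\|_2^2ds<\infty$. A triple $(\mathsf A,\mathsf B,\mathsf N_i)$ with $\mathsf A,\mathsf N_1,\dots,\mathsf N_q\in\mathbb R^{n\times n}$, $\mathsf B\in\mathbb R^{n\times \ell}$ is stabilizable if for every $x_0\in\mathbb R^n$ there exists $u\in L^2$ ($\mathbb R^\ell$-valued) such that the solution of $dx(t)=[\mathsf Ax(t)+\mathsf Bu(t)]dt+\sum_{i=1}^q\mathsf N_ix(t)dW_i(t)$, $x(0)=x_0$, lies in $L^2$. Inequalities between symmetric matrices refer to the definiteness (Loewner) order. *)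

(* Defs.v *)
From HB Require Import structures.
From mathcomp Require Import all_boot all_order all_algebra.
From mathcomp Require Import all_classical all_reals all_analysis.

Set Implicit Arguments.
Unset Strict Implicit.
Unset Printing Implicit Defensive.
Import Order.TTheory GRing.Theory Num.Theory.
Import numFieldNormedType.Exports.
Local Open Scope classical_set_scope.
Local Open Scope ring_scope.

Section Loewner.
Context {R : realType} {n : nat}.
Implicit Types M : 'M[R]_n.

Definition posdefmx M :=
  M^T = M /\ forall v : 'cV[R]_n, v != 0 -> 0 < (v^T *m M *m v) 0 0.

Definition negdefmx M := posdefmx (- M).

End Loewner.

Definition sqnorm2 {R : realType} {n : nat} (v : 'cV[R]_n) : R :=
  \sum_(i < n) v i 0 ^+ 2.

(* The centred normal law with variance [s2]. The degenerate case is separate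
   because [normal_prob m 0] is the uniform law on [0, 1], not a point mass. *)
Definition centred_normal {R : realType} (s2 : R) (B : set R) : \bar R :=
  if s2 == 0 then \d_(0 : measurableTypeR R) B else normal_prob 0 (Num.sqrt s2) B.

Section Stochastic.
Context {R : realType} {d : measure_display} {T : measurableType d}.
Variable P : probability T R.

(* Processes and filtrations are indexed by the whole of [R], but only the
   times [t >= 0] are meaningful. *)

Record right_continuous_complete_filtration (F : R -> set (set T)) : Prop := {
  filtration_sigma : forall t : R, 0 <= t -> sigma_algebra setT (F t) ;
  filtration_measurable : forall t : R, 0 <= t -> F t `<=` measurable ;
  filtration_mono : forall s t : R, 0 <= s -> s <= t -> F s `<=` F t ;
  filtration_right : forall t : R, 0 <= t ->
    \bigcap_(s in [set s | t < s]) F s = F t ;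
  filtration_complete : forall t : R, 0 <= t -> forall E, P.-negligible E -> F t E
}.

Variable F : R -> set (set T).

Definition measurable_at (t : R) (X : T -> R) :=
  forall Y : set R, measurable Y -> F t (X @^-1` Y).

Record wiener_process {q : nat} (K : 'M[R]_q) (W : R -> T -> 'cV[R]_q)
    : Prop := {
  wiener_adapted : forall t : R, 0 <= t -> forall i,
    measurable_at t (fun w => W t w i 0) ;
  wiener0 : {ae P, forall w, W 0 w = 0} ;
  wiener_continuous : {ae P, forall w,
    forall i, {within `[0, +oo[, continuous (fun t : R => W t w i 0)}} ;
  wiener_independent : forall t h : R, 0 <= t -> 0 <= h ->
    forall (E : set T) (Y : set (q.-tuple R)), F t E -> measurable Y ->
    let dW := fun w => [tuple (W (t + h) w - W t w) i 0 | i < q] in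
    P (E `&` dW @^-1` Y) = (P E * P (dW @^-1` Y))%E ;
  wiener_gaussian : forall t h : R, 0 <= t -> 0 <= h ->
    forall (c : 'cV[R]_q) (Y : set R), measurable Y ->
    P [set w | Y ((c^T *m (W (t + h) w - W t w)) 0 0)]
      = centred_normal (h * (c^T *m K *m c) 0 0) Y ;
  wiener_mean : forall t : R, 0 <= t -> forall i,
    ('E_P[fun w => W t w i 0%R] = 0)%E ;
  wiener_covariance : forall t : R, 0 <= t -> forall i j,
    ('E_P[fun w => (W t w i 0 * W t w j 0)%R] = (K i j * t)%:E)%E
}.

(* Adapted (and jointly measurable) processes that are square integrable over
   the set of times [D]. *)
Record square_integrable_on (D : set R) {n : nat} (v : R -> T -> 'cV[R]_n)
    : Prop := {
  sqint_adapted : forall t, D t -> forall i,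
    measurable_at t (fun w => v t w i 0) ;
  sqint_measurable : forall i, measurable_fun (D `*` [set: T])
    (fun z : R * T => v z.1 z.2 i 0) ;
  sqint_finite :
    (\int[P]_w \int[lebesgue_measure]_(s in D) (sqnorm2 (v s w))%:E < +oo)%E
}.

Definition L2 {n : nat} (v : R -> T -> 'cV[R]_n) :=
  square_integrable_on `[0, +oo[ v.

(* The step process equal to [coef k] on ]node k, node k.+1] for
   [k < steps]. *)
Record step_process := StepProcess {
  steps : nat ;
  node : nat -> R ;
  coef : nat -> T -> R
}.

Definition step_value (S : step_process) (s : R) (w : T) : R :=
  \sum_(k < steps S) coef S k w * \1_(`]node S k, node S k.+1]) s.

Definition step_integral (b : R -> T -> R) (S : step_process) (w : T) : R :=
  \sum_(k < steps S) coef S k w * (b (node S k.+1) w - b (node S k) w).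

Record adapted_step_process (t : R) (S : step_process) : Prop := {
  step_start : node S 0 = 0 ;
  step_end : node S (steps S) = t ;
  step_mono : forall k, (k < steps S)%N -> node S k <= node S k.+1 ;
  step_adapted : forall k, (k < steps S)%N ->
    measurable_at (node S k) (coef S k) ;
  step_sqint : forall k, (k < steps S)%N ->
    (\int[P]_w ((coef S k w) ^+ 2)%:E < +oo)%E
}.

(* [I] is (a version of) the Ito integral of [v] against [b] over [0, t]: the
   mean square limit of the integrals of adapted step processes that converge
   to [v] in L^2(dt x dP). Meant for [v] adapted, jointly measurable and square
   integrable over [0, t], for which [I] exists and is unique up to null
   sets when [b] is a Wiener process. *)
Definition is_ito_integral (b v : R -> T -> R) (t : R) (I : T -> R) :=
  measurable_fun [set: T] I /\
  exists S : nat -> step_process,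
    [/\ forall m, adapted_step_process t (S m),
        (fun m => \int[P]_w \int[lebesgue_measure]_(s in `[0%R, t])
           ((v s w - step_value (S m) s w) ^+ 2)%:E)%E @ \oo --> (0 : \bar R) &
        (fun m => \int[P]_w ((I w - step_integral b (S m) w) ^+ 2)%:E)%E
           @ \oo --> (0 : \bar R)].

(* The Ito equation dx = (A x + B u) dt + \sum_i N_i x dW_i, x(0) = x0, in
   integrated form; the identity holds almost surely at each time [t]. Meant for
   [u] square integrable on bounded intervals, so that the drift is almost surely
   integrable. Solutions are determined up to modification, which does not
   affect membership in [L2]. *)
Definition is_solution {q n l : nat} (W : R -> T -> 'cV[R]_q)
    (A : 'M[R]_n) (B : 'M[R]_(n, l)) (N : 'I_q -> 'M[R]_n) (x0 : 'cV[R]_n)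
    (u : R -> T -> 'cV[R]_l) (x : R -> T -> 'cV[R]_n) :=
  (forall t : R, 0 <= t -> square_integrable_on `[0, t] x) /\
  forall t : R, 0 <= t -> exists J : 'I_q -> T -> 'cV[R]_n,
    (forall i r, is_ito_integral (fun s w => W s w i 0)
       (fun s w => (N i *m x s w) r 0) t (fun w => J i w r 0)) /\
    {ae P, forall w, x t w = x0
       + \col_r \int[lebesgue_measure]_(s in `[0, t])
           (A *m x s w + B *m u s w) r 0
       + \sum_(i < q) J i w}.

Definition stabilizable {q n l : nat} (W : R -> T -> 'cV[R]_q)
    (A : 'M[R]_n) (B : 'M[R]_(n, l)) (N : 'I_q -> 'M[R]_n) :=
  forall x0 : 'cV[R]_n, exists u : R -> T -> 'cV[R]_l, L2 u /\
    exists x : R -> T -> 'cV[R]_n, is_solution W A B N x0 u x /\ L2 x.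

End Stochastic.

(* Main.v *)
(* If the triple is stabilizable, let x_k, u_k start at the k-th basis vector and
   stop at a time t_k where E|x_k|^2 is small (it exists because x_k is in L2).
   For X = \sum_k E \int x_k x_k^T and Y = \sum_k E \int x_k u_k^T the product rule
   gives L(X) + Y C + (Y C)^T = - 1 + \sum_k E x_k(t_k) x_k(t_k)^T <= - 1/2, where
   L(X) = A^T X + X A + \sum_ij k_ij N_i^T X N_j. Then P^-1 = e (X + eta) works for
   small eta and then small e: the term - C^T C absorbs e (Y C + (Y C)^T) up to
   O(e^2), which is also the size of P^-1 B B^T P^-1.

   Conversely, the feedback u = - C P x / 2 turns the inequality into a strict
   Lyapunov inequality for P^-1 and the closed loop. It bounds the second moment
   matrix of the Euler scheme of step h at stage k by c (1 - delta h)^k P^-1. The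
   schemes on dyadic grids differ by O(h) in mean square, so they converge
   almost surely, and the limit is a solution that decays exponentially in mean
   square. *)

Require Import Defs.
From HB Require Import structures.
From mathcomp Require Import all_boot all_order all_algebra.
From mathcomp Require Import all_classical all_reals all_analysis.
From mathcomp Require Import measurable_realfun lebesgue_integral.
From mathcomp Require Import zify ring lra.

Set Implicit Arguments.
Unset Strict Implicit.
Unset Printing Implicit Defensive.
Import Order.TTheory GRing.Theory Num.Theory.
Import numFieldNormedType.Exports.
Local Open Scope classical_set_scope.
Local Open Scope ring_scope.

(** * Square integrable functions *)

(** The triple is transposed, so the generator of the second moments of the system is [lyap] itself,
    the operator applied to P^-1 in the inequality. Both directions can thus be read off second
    moments, without passing to an adjoint equation. Ito integrals are given as mean square limits
    of step sums, and solutions up to a null set at each time, so the argument works with the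
    expectation of Ito's formula and not with paths. Each process is split into a drift primitive
    and a martingale: drift against drift is integration by parts on paths, drift against martingale
    is the martingale tested on adapted variables, martingale against martingale is the isometry.
    Stopping each start at a time of its own is harmless because [lyap] is linear: the contributions
    of the starts still add up to the identity. A solution must be adapted and jointly measurable.
    The differences of dyadic levels decay geometrically in mean square, so at each time the whole
    sequence converges almost surely, and a pointwise limsup settles measurability. *)

Section L2.
Context d (T : measurableType d) (R : realType).
Variable mu : {measure set T -> \bar R}.
Implicit Types X Y Z : T -> R.

Lemma fun_ringE : (forall a X z, (a *: X) z = a * X z) *
  (forall X Y z, (X + Y) z = X z + Y z) * (forall X z, (- X) z = - X z) *
  (forall z, (0 : T -> R) z = 0).
Proof. by []. Qed.

Definition L1fun X := mu.-integrable [set: T] (EFin \o X).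
Definition sqi X := measurable_fun [set: T] X /\ L1fun (X \* X).
(** [Rintegral] takes the junk value 0 when the extended integral is not finite, so the bilinear
    laws below carry [sqi] hypotheses. Functions are not identified almost everywhere; that is left
    to [ip_ae] and [ip_eq0]. *)
Definition ip X Y : R := \int[mu]_z (X z * Y z).

Lemma L1fun_le X Y : measurable_fun [set: T] X -> (forall z, `|X z| <= `|Y z|) ->
  L1fun Y -> L1fun X.
Proof.
move=> mX XY; apply: le_integrable => //; first exact/measurable_EFinP.
by move=> z _ /=; rewrite lee_fin.
Qed.

Lemma L1funD X Y : L1fun X -> L1fun Y -> L1fun (X + Y).
Proof.
move=> iX iY; have := integrableD measurableT iX iY.
by apply: eq_integrable => // z _ /=; rewrite EFinD.
Qed.

Lemma L1funZ a X : L1fun X -> L1fun (a *: X).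
Proof.
move=> iX; have := integrableZl measurableT a iX.
by apply: eq_integrable => // z _ /=; rewrite EFinM.
Qed.

Lemma L1fun0 : L1fun 0.
Proof. exact: integrable0. Qed.

Lemma L1fun_sum I (r : seq I) (Q : pred I) (X : I -> T -> R) :
  (forall i, Q i -> L1fun (X i)) -> L1fun (\sum_(i <- r | Q i) X i).
Proof. by move=> iX; elim/big_ind: _ => //; [exact: L1fun0 | exact: L1funD]. Qed.

Lemma L1fun_meas X : L1fun X -> measurable_fun [set: T] X.
Proof. by move=> /measurable_int/measurable_EFinP. Qed.

Lemma L1fun_ltoo X : measurable_fun [set: T] X -> (forall z, 0 <= X z) ->
  (\int[mu]_z (X z)%:E < +oo)%E <-> L1fun X.
Proof.
move=> mX X0; have E : (\int[mu]_z (X z)%:E = \int[mu]_z `|(X z)%:E|)%E.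
  by apply: eq_integral => z _; rewrite gee0_abs// lee_fin.
rewrite E; split=> [Xoo|/integrableP[]//].
by apply/integrableP; split=> //; exact/measurable_EFinP.
Qed.

Lemma sqiP X : measurable_fun [set: T] X ->
  (\int[mu]_z ((X z) ^+ 2)%:E < +oo)%E <-> sqi X.
Proof.
move=> mX; have mXX : measurable_fun [set: T] (X \* X) by exact: measurable_funM.
rewrite -[X in (X < _)%E]/(\int[mu]_z ((X \* X) z)%:E)%E L1fun_ltoo//.
  by split=> // -[].
by move=> z; rewrite /= -expr2 sqr_ge0.
Qed.

Lemma sqi_meas X : sqi X -> measurable_fun [set: T] X. Proof. by case. Qed.
Hint Resolve sqi_meas : core.

(** The squares of X + Y and X - Y give |X Y| <= X^2 + Y^2. *)
Lemma sqiM X Y : sqi X -> sqi Y -> L1fun (X \* Y).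
Proof.
move=> [mX iX] [mY iY].
apply: (@L1fun_le _ (X \* X + Y \* Y)); last exact: L1funD.
  exact: measurable_funM.
move=> z /=; rewrite [(_ + _) z]/(_ + _ : R) /= (@ger0_norm _ (_ + _)); last first.
  by rewrite addr_ge0// -expr2 sqr_ge0.
rewrite ler_norml; have := sqr_ge0 (X z + Y z); have := sqr_ge0 (X z - Y z).
by have := sqr_ge0 (X z); have := sqr_ge0 (Y z); nra.
Qed.

Lemma sqi0 : sqi 0.
Proof.
split; first exact: measurable_cst.
by rewrite (_ : _ \* _ = 0) ?L1fun0//; apply/funext => z; rewrite /= mul0r.
Qed.

Lemma sqiZ a X : sqi X -> sqi (a *: X).
Proof.
move=> [mX iX]; split; first exact: measurable_funM.
rewrite (_ : _ \* _ = (a * a) *: (X \* X)) ?L1funZ//.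
by apply/funext => z; rewrite /= !fun_ringE /=; ring.
Qed.

Lemma sqiD X Y : sqi X -> sqi Y -> sqi (X + Y).
Proof.
move=> sX sY; split; first exact: measurable_funD (sqi_meas sX) (sqi_meas sY).
rewrite (_ : _ \* _ = (X \* X + Y \* Y) + 2%:R *: (X \* Y)).
  by apply: L1funD; [case: sX sY => _ ? [_ ?]; exact: L1funD | exact/L1funZ/sqiM].
by apply/funext => z; rewrite /= !fun_ringE /=; ring.
Qed.

Lemma sqiN X : sqi X -> sqi (- X).
Proof. by move=> sX; rewrite -scaleN1r; exact: sqiZ. Qed.

Lemma sqiB X Y : sqi X -> sqi Y -> sqi (X - Y).
Proof. by move=> ? ?; apply: sqiD => //; exact: sqiN. Qed.

Lemma sqi_sum I (r : seq I) (Q : pred I) (X : I -> T -> R) :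
  (forall i, Q i -> sqi (X i)) -> sqi (\sum_(i <- r | Q i) X i).
Proof. by move=> iX; elim/big_ind: _ => //; [exact: sqi0 | exact: sqiD]. Qed.

Lemma Rint_sum I (r : seq I) (Q : pred I) (X : I -> T -> R) :
  (forall i, Q i -> L1fun (X i)) ->
  \int[mu]_z (\sum_(i <- r | Q i) X i) z = \sum_(i <- r | Q i) \int[mu]_z X i z.
Proof.
move=> iX; elim: r => [|i r IH]; first by rewrite !big_nil /Rintegral integral0.
rewrite !big_cons; case: ifP => Qi //; rewrite -IH.
have := RintegralD measurableT (iX _ Qi) (L1fun_sum r iX).
by [].
Qed.

Lemma ipC X Y : ip X Y = ip Y X.
Proof. by apply: eq_Rintegral => z _; rewrite mulrC. Qed.

Lemma ipDl X Y Z : sqi X -> sqi Y -> sqi Z -> ip (X + Y) Z = ip X Z + ip Y Z.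
Proof.
move=> sX sY sZ; have := RintegralD measurableT (sqiM sX sZ) (sqiM sY sZ).
by rewrite /ip => <-; apply: eq_Rintegral => z _; rewrite -mulrDl.
Qed.

Lemma ipZl a X Z : sqi X -> sqi Z -> ip (a *: X) Z = a * ip X Z.
Proof.
move=> sX sZ; have := RintegralZl a measurableT (sqiM sX sZ).
by rewrite /ip => <-; apply: eq_Rintegral => z _; rewrite mulrA.
Qed.

Lemma ip0l Z : ip 0 Z = 0.
Proof.
rewrite /ip (_ : (fun z => _) = cst 0) ?/Rintegral ?integral0//.
by apply/funext => z; rewrite mul0r.
Qed.

Lemma ipNl X Z : sqi X -> sqi Z -> ip (- X) Z = - ip X Z.
Proof. by move=> sX sZ; rewrite -scaleN1r ipZl// mulN1r. Qed.

Lemma ipBl X Y Z : sqi X -> sqi Y -> sqi Z -> ip (X - Y) Z = ip X Z - ip Y Z.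
Proof. by move=> sX sY sZ; rewrite ipDl ?ipNl//; exact: sqiN. Qed.

Lemma ipDr X Y Z : sqi X -> sqi Y -> sqi Z -> ip Z (X + Y) = ip Z X + ip Z Y.
Proof. by move=> *; rewrite ipC ipDl// ![ip _ Z]ipC. Qed.

Lemma ipZr a X Z : sqi X -> sqi Z -> ip Z (a *: X) = a * ip Z X.
Proof. by move=> *; rewrite ipC ipZl// ![ip _ Z]ipC. Qed.

Lemma ipNr X Z : sqi X -> sqi Z -> ip Z (- X) = - ip Z X.
Proof. by move=> *; rewrite ipC ipNl// ![ip _ Z]ipC. Qed.

Lemma ipBr X Y Z : sqi X -> sqi Y -> sqi Z -> ip Z (X - Y) = ip Z X - ip Z Y.
Proof. by move=> *; rewrite ipC ipBl// ![ip _ Z]ipC. Qed.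

Lemma ip_suml I (r : seq I) (Q : pred I) (X : I -> T -> R) Z :
  (forall i, Q i -> sqi (X i)) -> sqi Z ->
  ip (\sum_(i <- r | Q i) X i) Z = \sum_(i <- r | Q i) ip (X i) Z.
Proof.
move=> sX sZ; elim: r => [|i r IH]; first by rewrite !big_nil ip0l.
rewrite !big_cons; case: ifP => Qi //.
by rewrite ipDl ?IH//; [exact: sX | exact: sqi_sum].
Qed.

Lemma ip_sumr I (r : seq I) (Q : pred I) (X : I -> T -> R) Z :
  (forall i, Q i -> sqi (X i)) -> sqi Z ->
  ip Z (\sum_(i <- r | Q i) X i) = \sum_(i <- r | Q i) ip Z (X i).
Proof. by move=> *; rewrite ipC ip_suml//; apply: eq_bigr => i _; rewrite ipC. Qed.

Lemma ip_ge0 X : 0 <= ip X X.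
Proof. by apply: Rintegral_ge0 => z _; rewrite -expr2 sqr_ge0. Qed.

Lemma ipE X Y : sqi X -> sqi Y -> (ip X Y)%:E = (\int[mu]_z (X z * Y z)%:E)%E.
Proof. by move=> sX sY; rewrite fineK//; exact: integrable_fin_num (sqiM sX sY). Qed.

Lemma ip_normE X : sqi X -> (ip X X)%:E = (\int[mu]_z ((X z) ^+ 2)%:E)%E.
Proof. by move=> sX; rewrite ipE. Qed.

(** Young's inequality, from the square of c X - Y divided by c. *)
Lemma ip_AM X Y c : 0 < c -> sqi X -> sqi Y ->
  2 * ip X Y <= c * ip X X + c^-1 * ip Y Y.
Proof.
move=> c0 sX sY; have := ip_ge0 (c *: X - Y).
have sZ : sqi (c *: X) by exact: sqiZ.
rewrite ipBl ?ipBr ?ipZl ?ipZr//; [|exact: sqiB..].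
rewrite (ipC Y X) => H; rewrite -(ler_pM2l c0) !mulrDr mulVKf ?gt_eqF//.
by move: H; lra.
Qed.

Lemma ip_CS X Y : sqi X -> sqi Y -> ip X Y ^+ 2 <= ip X X * ip Y Y.
Proof.
move=> sX sY; have [Y0|] := eqVneq (ip Y Y) 0; last first.
  rewrite neq_lt ltNge ip_ge0/= => Y0.
  have sZ : sqi (ip X Y *: Y) by exact: sqiZ.
  have sW : sqi (ip Y Y *: X) by exact: sqiZ.
  have := ip_ge0 (ip Y Y *: X - ip X Y *: Y).
  rewrite ipBl ?ipBr//; [|exact: sqiB..].
  rewrite !(ipZl, ipZr)// (ipC Y X) => H.
  by rewrite -(ler_pM2l Y0); nra.
rewrite Y0 mulr0; suff -> : ip X Y = 0 by rewrite expr0n.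
(* With [Y] of norm 0, [ip_AM] reads 2 <W, Y> <= c <W, W> for every c > 0; a [c] of order e gives
   <W, Y> <= 0, which is then used for X and - X. *)
have small W : sqi W -> ip W Y <= 0.
  move=> sW; apply/ler_addgt0Pr => e e0; rewrite add0r.
  have den0 : 0 < ip W W + 1 by rewrite ltr_wpDl// ip_ge0.
  have := ip_AM (divr_gt0 e0 den0) sW sY; rewrite Y0 mulr0 addr0.
  have : e / (ip W W + 1) * ip W W <= e.
    by rewrite mulrAC ler_pdivrMr// ler_pM2l// lerDl.
  have : 0 <= e / (ip W W + 1) * ip W W by rewrite mulr_ge0 ?ip_ge0// ltW// divr_gt0.
  lra.
apply/eqP; rewrite eq_le small//= -oppr_le0 -ipNl// small//; exact: sqiN.
Qed.

Lemma ip_normD X Y : sqi X -> sqi Y ->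
  ip (X + Y) (X + Y) <= 2 * ip X X + 2 * ip Y Y.
Proof.
move=> sX sY; have := ip_ge0 (X - Y); rewrite !(ipDl, ipDr, ipNl, ipNr)//; try by do ?[exact: sqiD | exact: sqiN | exact: sqiB].
by rewrite (ipC Y X); lra.
Qed.

Lemma ip_ae X Y Z : sqi X -> sqi Y -> sqi Z -> {ae mu, forall z, X z = Y z} ->
  ip X Z = ip Y Z.
Proof.
move=> sX sY sZ XY; congr fine; apply: ae_eq_integral => //.
- exact/measurable_EFinP/(measurable_funM (sqi_meas sX) (sqi_meas sZ)).
- exact/measurable_EFinP/(measurable_funM (sqi_meas sY) (sqi_meas sZ)).
- by apply: filterS XY => z -> _.
Qed.

Lemma ip_eq0 X : sqi X -> ip X X = 0 -> {ae mu, forall z, X z = 0}.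
Proof.
move=> sX X0; have : (\int[mu]_z ((X z) ^+ 2)%:E = 0)%E by rewrite -ip_normE// X0.
have E : (\int[mu]_z `|((X z) ^+ 2)%:E| = \int[mu]_z ((X z) ^+ 2)%:E)%E.
  by apply: eq_integral => z _; rewrite gee0_abs// lee_fin sqr_ge0.
rewrite -E => H.
have : ae_eq mu [set: T] (fun z => ((X z) ^+ 2)%:E) (cst 0%E).
  apply/(ae_eq_integral_abs _ measurableT) => //; apply/measurable_EFinP.
  exact: (measurable_funM (sqi_meas sX) (sqi_meas sX)).
by apply: filterS => z /(_ I) [] /eqP; rewrite sqrf_eq0 => /eqP.
Qed.

Lemma ip_cvg (X Y : nat -> T -> R) X' Y' : sqi X' -> sqi Y' ->
  (forall m, sqi (X m)) -> (forall m, sqi (Y m)) ->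
  (fun m => ip (X m - X') (X m - X')) @ \oo --> (0 : R) ->
  (fun m => ip (Y m - Y') (Y m - Y')) @ \oo --> (0 : R) ->
  (fun m => ip (X m) (Y m)) @ \oo --> ip X' Y'.
Proof.
move=> sX' sY' sX sY cX cY; apply/cvgrPdist_le => e e0.
(* Write X m = X' + A and Y m = Y' + B. Once |A|^2 and |B|^2 are below both c and c^2, [ip_AM] with
   weight c bounds the cross terms by c (|Y'|^2 + 1) / 2 and c (|X'|^2 + 1) / 2, and with weight 1
   the last term by c; this [c] makes the total at most e. *)
pose c := e / (2 + ip X' X' + ip Y' Y').
have den0 : 0 < 2 + ip X' X' + ip Y' Y' by have := ip_ge0 X'; have := ip_ge0 Y'; lra.
have c0 : 0 < c by rewrite divr_gt0.
have cD : c * 2 + c * ip X' X' + c * ip Y' Y' = e.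
  by rewrite -!mulrDr /c divfK// gt_eqF.
pose k := Num.min c (c * c).
have k0 : 0 < k by rewrite lt_min c0 mulr_gt0.
move/cvgrPdist_le : cX => /(_ _ k0) cX; move/cvgrPdist_le : cY => /(_ _ k0) cY.
near=> m.
have small (u : R) : 0 <= u -> `|0 - u| <= k -> u <= c /\ u <= c * c.
  by move=> u0; rewrite sub0r normrN ger0_norm// le_min => /andP[].
have [x1 x2] : ip (X m - X') (X m - X') <= c /\ ip (X m - X') (X m - X') <= c * c.
  by apply: small; [exact: ip_ge0 | near: m].
have [y1 y2] : ip (Y m - Y') (Y m - Y') <= c /\ ip (Y m - Y') (Y m - Y') <= c * c.
  by apply: small; [exact: ip_ge0 | near: m].
have sA : sqi (X m - X') by exact: sqiB.
have sB : sqi (Y m - Y') by exact: sqiB.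
have E : ip (X m) (Y m) = ip X' Y' + ip (X m - X') Y' + ip X' (Y m - Y') + ip (X m - X') (Y m - Y').
  rewrite !(ipBl, ipBr)//; lra.
rewrite E; set A := X m - X' in x1 x2 sA *; set B := Y m - Y' in y1 y2 sB *.
have sNA := sqiN sA; have sNB := sqiN sB.
have cV : 0 < c^-1 by rewrite invr_gt0.
have a1 := ip_AM c0 sY' sA; have a2 := ip_AM c0 sY' sNA.
have b1 := ip_AM c0 sX' sB; have b2 := ip_AM c0 sX' sNB.
have g1 := ip_AM ltr01 sA sB; have g2 := ip_AM ltr01 sA sNB.
rewrite !(ipNl, ipNr)// !opprK in a2 b2 g2.
rewrite (ipC A Y').
have cA : c^-1 * ip A A <= c by rewrite ler_pdivrMl.
have cB : c^-1 * ip B B <= c by rewrite ler_pdivrMl.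
rewrite invr1 in g1 g2.
have p1 : 0 <= c * ip X' X' by rewrite mulr_ge0 ?ip_ge0// ltW.
have p2 : 0 <= c * ip Y' Y' by rewrite mulr_ge0 ?ip_ge0// ltW.
by rewrite ler_norml; apply/andP; split; lra.
Unshelve.
all: by end_near.
Qed.

End L2.

(** * Almost sure limits under geometric convergence in mean square *)

Section rapid.
Context {R : realType}.

(* Meaningful only for convergent sequences; unlike [lim] it is measurable in a
   parameter without any convergence hypothesis. *)
Definition rlim (u : nat -> R) : R := fine (limn_esup (EFin \o u)).

Lemma rlimE (u : nat -> R) l : u @ \oo --> l -> rlim u = l.
Proof.
move=> ul; have ul' : (EFin \o u) @ \oo --> l%:E by apply/fine_cvgP; split; [exact: nearW|].
rewrite /rlim is_cvg_limn_esupE; last by apply/cvg_ex; exists l%:E.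
by rewrite (cvg_lim _ ul').
Qed.

Lemma measurable_rlim d (T : measurableType d) (f : nat -> T -> R) :
  (forall m, measurable_fun [set: T] (f m)) ->
  measurable_fun [set: T] (fun z => rlim (f ^~ z)).
Proof.
move=> mf; apply: measurableT_comp => //.
by apply: measurable_fun_limn_esup => m; exact/measurable_EFinP.
Qed.

(** Cauchy-Schwarz for a telescoping sum with weights (3/2)^j: the factor 3 is the sum of the
    (2/3)^j. The induction splits off one increment by (D + E)^2 <= 3 D^2 + (3/2) E^2. *)
Lemma rapid_tail (f : nat -> R) n m :
  (f (m + n)%N - f m) ^+ 2 <=
  3 * (2/3) ^+ m * \sum_(0 <= j < n) (3/2) ^+ (m + j)%N * (f (m + j).+1 - f (m + j)%N) ^+ 2.
Proof.
elim: n m => [|n IH] m; first by rewrite addn0 big_geq// mulr0 subrr expr0n.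
rewrite big_nat_recl// addn0.
under eq_bigr do rewrite addnS -addSn.
move/(_ m.+1): IH; rewrite addSnnS;  set S := \sum_(0 <= _ < n) _; set D := f m.+1 - f m => IH.
have -> : f (m + n.+1)%N - f m = D + (f (m + n.+1)%N - f m.+1) by rewrite /D; ring.
set E := f (m + n.+1)%N - f m.+1 in IH *.
have H : (D + E) ^+ 2 <= 3 * D ^+ 2 + 3/2 * E ^+ 2.
  have : 0 <= (2 * D - E) ^+ 2 by exact: sqr_ge0.
  by nra.
apply: (le_trans H); rewrite mulrDr.
have -> : 3 * (2 / 3) ^+ m * ((3 / 2) ^+ m * D ^+ 2) = 3 * D ^+ 2.
  have -> : 3 * (2 / 3) ^+ m * ((3 / 2) ^+ m * D ^+ 2) = 3 * ((2/3) * (3/2)) ^+ m * D ^+ 2.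
    by rewrite [in RHS]exprMn; ring.
  by rewrite (_ : 2 / 3 * (3 / 2) = 1) ?expr1n ?mulr1//; field.
rewrite lerD2l; move: IH; rewrite (exprS (2 / 3)).
have -> : 3 * (2 / 3 * (2 / 3) ^+ m) * S = 2/3 * (3 * (2 / 3) ^+ m * S) by ring.
by move=> IH; lra.
Qed.

(** The increments are absolutely summable: 2 |D| <= p D^2 + 1/p with p = (3/2)^j, and the inverses
    1/p sum to at most 3. *)
Lemma rapid_cvg (f : nat -> R) (w : R) :
  (forall n, \sum_(0 <= j < n) (3/2) ^+ j * (f j.+1 - f j) ^+ 2 <= w) ->
  cvgn f.
Proof.
move=> Hw; have -> : f = (fun n => f 0%N + series (telescope f) n).
  by apply/funext => n; rewrite -eq_sum_telescope.
apply: is_cvgD; first exact: is_cvg_cst.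
apply: normed_cvg; apply: nondecreasing_is_cvgn.
  by apply: nondecreasing_series => *; exact: normr_ge0.
exists (w + 3) => _ [n _ <-]; rewrite /= seriesEnat /=.
have G : \sum_(0 <= j < n) (2/3 : R) ^+ j <= 3 * (1 - (2/3) ^+ n).
  elim: n => [|n IH]; first by rewrite big_geq// expr0 subrr mulr0.
  by rewrite big_nat_recr//= exprS; move: IH; set S := \sum_(0 <= _ < n) _; lra.
apply: (@le_trans _ _ (\sum_(0 <= j < n) ((3/2) ^+ j * (f j.+1 - f j) ^+ 2 + (2/3) ^+ j))).
  apply: ler_sum => j _; rewrite /telescope /=.
  set D := f j.+1 - f j.
  have p0 : 0 < (3/2 : R) ^+ j by rewrite exprn_gt0//; lra.
  have q0 : 0 < (2/3 : R) ^+ j by rewrite exprn_gt0//; lra.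
  have pq : (3/2 : R) ^+ j * (2/3) ^+ j = 1.
    by rewrite -exprMn (_ : 3 / 2 * (2 / 3) = 1) ?expr1n//; field.
  have := normr_ge0 D; rewrite -(real_normK (num_real D)); set N := `|D| => N0.
  set p := (3/2 : R) ^+ j in p0 pq *; set q := (2/3 : R) ^+ j in q0 pq *.
  have : 0 <= p * (N - q) ^+ 2 by rewrite mulr_ge0 ?sqr_ge0// ltW.
  have -> : p * (N - q) ^+ 2 = p * N ^+ 2 - 2 * N * (p * q) + q * (p * q) by ring.
  by rewrite pq mulr1 mulr1; lra.
rewrite big_split /=; apply: lerD; first exact: Hw.
apply: (le_trans G); have : 0 <= (2/3 : R) ^+ n by rewrite exprn_ge0//; lra.
lra.
Qed.

Context d (T : measurableType d) (mu : {measure set T -> \bar R}).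

Section core.
Variables (f : nat -> T -> R) (C : R).
Hypothesis sf : forall m, sqi mu (f m).
Hypothesis fC : forall m, ip mu (f m.+1 - f m) (f m.+1 - f m) <= C * (2^-1) ^+ m.

(* The weights (3/2)^j grow slower than the 2^j gained in mean square, and their
   inverses are summable, so Cauchy-Schwarz controls the pointwise tails. *)
Let D j z := (3/2) ^+ j * (f j.+1 z - f j z) ^+ 2.
Let W z := (\sum_(j <oo) (D j z)%:E)%E.

Let D0 j z : 0 <= D j z.
Proof. by rewrite mulr_ge0 ?sqr_ge0// exprn_ge0//; lra. Qed.

Let mD j : measurable_fun [set: T] (D j).
Proof.
apply: measurable_funM; first exact: measurable_cst.
apply: measurable_funX; apply: measurable_funB; exact: (sqi_meas (sf _)).
Qed.

Let W_ge z : (0 <= W z)%E.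
Proof. by apply: nneseries_ge0 => n _ _; rewrite lee_fin. Qed.

Let C0 : 0 <= C.
Proof. by have := fC 0; rewrite expr0 mulr1; apply: le_trans; exact: ip_ge0. Qed.

Let mW : measurable_fun [set: T] W.
Proof.
apply: ge0_emeasurable_sum => [k x _ _|k _]; first by rewrite lee_fin.
exact/measurable_EFinP.
Qed.

(** The weight (3/2)^j against the decay 2^-j leaves (3/4)^j, whose sum is 4. *)
Let intW : (\int[mu]_z W z <= (4 * C)%:E)%E.
Proof.
rewrite integral_nneseries//; last 2 first.
- by move=> n; exact/measurable_EFinP.
- by move=> n x _; rewrite lee_fin.
have I j : (\int[mu]_z (D j z)%:E <= (C * (3/4) ^+ j)%:E)%E.
  have -> : (\int[mu]_z (D j z)%:E =
      \int[mu]_z (((3/2) ^+ j)%:E * (((f j.+1 - f j) z) ^+ 2)%:E))%E by [].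
  rewrite ge0_integralZl_EFin; last 4 first.
  - by [].
  - by move=> x _; rewrite lee_fin sqr_ge0.
  - by apply/measurable_EFinP/measurable_funX/sqi_meas/sqiB.
  - by rewrite exprn_ge0//; lra.
  rewrite -ip_normE; last exact: sqiB.
  rewrite -EFinM lee_fin.
  have -> : C * (3/4) ^+ j = (3/2) ^+ j * (C * (2^-1) ^+ j).
    rewrite (_ : 3/4 = 3/2 * 2^-1 :> R) ?exprMn; first by ring.
    by field.
  by rewrite ler_pM2l// exprn_gt0//; lra.
have cv : cvgn (fun n => \sum_(0 <= j < n) \int[mu]_z (D j z)%:E)%E.
  by apply: is_cvg_nneseries => n _ _; apply: integral_ge0 => x _; rewrite lee_fin.
apply: lime_le => //; apply: nearW => n.
apply: (@le_trans _ _ (\sum_(0 <= j < n) (C * (3/4) ^+ j)%:E)%E).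
  by apply: lee_sum => j _; exact: I.
rewrite sumEFin lee_fin -mulr_sumr mulrC.
apply: ler_wpM2r => //.
suff : \sum_(0 <= j < n) (3/4 : R) ^+ j = 4 * (1 - (3/4) ^+ n).
  move=> ->; have : 0 <= (3/4 : R) ^+ n by apply: exprn_ge0; lra.
  by lra.
elim: n => [|n IH]; first by rewrite big_geq// expr0 subrr mulr0.
by rewrite big_nat_recr//= IH exprS; lra.
Qed.

Let W_fin : {ae mu, forall z, W z \is a fin_num}.
Proof.
have iW : mu.-integrable [set: T] W.
  apply/integrableP; split=> //.
  under eq_integral do rewrite gee0_abs//.
  by apply: le_lt_trans intW _; rewrite ltry.
by apply: filterS (integrable_ae measurableT iW) => z; apply.
Qed.

Let W_ge_sum z n : W z \is a fin_num -> \sum_(0 <= j < n) D j z <= fine (W z).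
Proof.
move=> Wz; rewrite -lee_fin fineK// -sumEFin.
by apply: nneseries_lim_ge => // k _; rewrite lee_fin.
Qed.

Lemma rapid_ae_cvg : {ae mu, forall z, cvgn (f ^~ z)}.
Proof.
apply: filterS W_fin => z Wz; apply: (@rapid_cvg _ (fine (W z))) => n.
exact: W_ge_sum.
Qed.

(** Where [W] is finite, [rapid_tail] bounds (f n - f 0)^2 by 3 [W] uniformly in n, so the bound
    passes to the limit before it is integrated; 12 is 3 times the 4 of [intW]. *)
Lemma rapid_core (g : T -> R) : measurable_fun [set: T] g ->
  {ae mu, forall z, f ^~ z @ \oo --> g z} ->
  sqi mu (g - f 0) /\ ip mu (g - f 0) (g - f 0) <= 12 * C.
Proof.
move=> mg fg.
have mgf : measurable_fun [set: T] (g - f 0).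
  exact: measurable_funB mg (sqi_meas (sf 0)).
have bnd : (\int[mu]_z ((g - f 0) z ^+ 2)%:E <= (12 * C)%:E)%E.
  apply: (@le_trans _ _ (\int[mu]_z (3%:E * W z))%E); last first.
    rewrite ge0_integralZl_EFin//.
    apply: (@le_trans _ _ (3%:E * (4 * C)%:E)%E); last by rewrite -EFinM lee_fin; lra.
    by apply: lee_wpmul2l => //; exact: intW.
  apply: ae_ge0_le_integral => //.
  - by move=> z _; rewrite lee_fin sqr_ge0.
  - by apply/measurable_EFinP/measurable_funX.
  - by move=> z _; rewrite mule_ge0// lee_fin.
  - exact: measurable_funeM.
  apply: filterS2 W_fin fg => z Wz fz _.
  rewrite -(fineK Wz) -EFinM lee_fin.
  have c1 : (fun n => (f n z - f 0 z) ^+ 2) @ \oo --> (g z - f 0 z) ^+ 2.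
    have c0 : (fun n => f n z - f 0 z) @ \oo --> g z - f 0 z.
      by apply: cvgB => //; exact: cvg_cst.
    by rewrite expr2; under eq_fun do rewrite expr2; exact: cvgM.
  rewrite [leLHS](_ : _ = (g z - f 0 z) ^+ 2)// -(cvg_lim _ c1)//.
  apply: limr_le; first by apply/cvg_ex; exists ((g z - f 0 z) ^+ 2).
  apply: nearW => n.
  have := rapid_tail (f ^~ z) n 0; rewrite add0n expr0 mulr1 => /le_trans; apply.
  by rewrite ler_wpM2l//; exact: (W_ge_sum n Wz).
have sg : sqi mu (g - f 0).
  by apply/sqiP => //; apply: le_lt_trans bnd _; rewrite ltry.
by split=> //; rewrite -lee_fin ip_normE.
Qed.
End core.

Lemma rapid_limit (f : nat -> T -> R) (C : R) :
  (forall m, sqi mu (f m)) ->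
  (forall m, ip mu (f m.+1 - f m) (f m.+1 - f m) <= C * (2^-1) ^+ m) ->
  let g := fun z => rlim (f ^~ z) in
  [/\ sqi mu g, {ae mu, forall z, f ^~ z @ \oo --> g z} &
    forall m, ip mu (g - f m) (g - f m) <= 12 * C * (2^-1) ^+ m].
Proof.
move=> sf fC g; have mg : measurable_fun [set: T] g.
  by apply: measurable_rlim => m; exact: (sqi_meas (sf m)).
have fg : {ae mu, forall z, f ^~ z @ \oo --> g z}.
  apply: filterS (rapid_ae_cvg sf fC) => z /cvg_ex[l fl].
  by rewrite /g (rlimE fl).
(* The rate at [m] is [rapid_core] for the sequence started at [m], whose constant is C 2^-m. *)
have H m : sqi mu (g - f m) /\ ip mu (g - f m) (g - f m) <= 12 * (C * (2^-1) ^+ m).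
  have := @rapid_core (fun n => f (n + m)%N) (C * (2^-1) ^+ m).
  rewrite add0n; apply => //.
  - by move=> n; rewrite addSn -mulrA -exprD addnC fC.
  - by apply: filterS fg => z; rewrite -(cvg_shiftn m).
split=> //; last by move=> m; rewrite -mulrA; case: (H m).
have -> : g = (g - f 0) + f 0 by rewrite subrK.
by apply: sqiD => //; case: (H 0).
Qed.

End rapid.

(** * Increments of the Wiener process *)

Section independence.
Context d (T : measurableType d) (R : realType) (P : probability T R).

(** The joint law of (U, V) agrees on rectangles with the product of the marginal laws, hence equals
    it; integrability and factorisation are then Fubini for the function x y. *)
Lemma indep_expectation (U V : T -> R) :
  (forall A B : set R, measurable A -> measurable B ->
     P (U @^-1` A `&` V @^-1` B) = (P (U @^-1` A) * P (V @^-1` B))%E) ->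
  L1fun P U -> L1fun P V ->
  L1fun P (U \* V) /\
  \int[P]_w (U w * V w) = \int[P]_w U w * \int[P]_w V w.
Proof.
move=> UV iU iV; have mU := L1fun_meas iU; have mV := L1fun_meas iV.
have mUV : measurable_fun [set: T] (fun w => (U w, V w)) by exact: measurable_fun_pair.
pose X : {mfun T >-> R} := mfun_Sub (mem_set mU).
pose Y : {mfun T >-> R} := mfun_Sub (mem_set mV).
pose Z : {mfun T >-> (R * R)%type} := mfun_Sub (mem_set mUV).
have law A : measurable A ->
    (distribution P X \x distribution P Y)%E A = distribution P Z A.
  by apply: product_measure_unique => B C mB mC; rewrite -UV.
have mfst : measurable_fun [set: R * R] (fst : R * R -> R) by exact: measurable_fst.
have msnd : measurable_fun [set: R * R] (snd : R * R -> R) by exact: measurable_snd.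
pose f (z : R * R) := (z.1 * z.2)%:E.
have mf : measurable_fun [set: R * R] f.
  by apply/measurable_EFinP; exact: measurable_funM.
have iX : (distribution P X).-integrable [set: R] (EFin : R -> \bar R).
  apply/integrableP; split; first exact/measurable_EFinP.
  rewrite ge0_integral_distribution//; last exact: measurableT_comp.
  by move/integrableP : iU => [].
have iY : (distribution P Y).-integrable [set: R] (EFin : R -> \bar R).
  apply/integrableP; split; first exact/measurable_EFinP.
  rewrite ge0_integral_distribution//; last exact: measurableT_comp.
  by move/integrableP : iV => [].
have mabs : measurable_fun [set: R] (fun y : R => `|y%:E|)%E.
  by apply: measurableT_comp => //; exact/measurable_EFinP.
have E1 (x : R) : (\int[distribution P Y]_y `|f (x, y)| =
    `|x|%:E * \int[distribution P Y]_y `|y%:E|)%E.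
  rewrite -ge0_integralZl_EFin//.
  by apply: eq_integral => y _; rewrite /f /= normrM EFinM.
have Yfin : (\int[distribution P Y]_y `|y%:E|)%E \is a fin_num.
  by rewrite ge0_fin_numE ?integral_ge0//; case/integrableP : iY.
have ipr : (distribution P X \x distribution P Y)%E.-integrable [set: R * R] f.
  apply/integrable12ltyP => //.
  rewrite (eq_integral (fun x : R => `|x|%:E * \int[distribution P Y]_y `|y%:E|)%E);
    last by move=> x _; exact: E1.
  rewrite -(fineK Yfin).
  rewrite ge0_integralZr//; last by rewrite lee_fin fine_ge0// integral_ge0.
  by rewrite lte_mul_pinfty ?integral_ge0//; [rewrite ge0_fin_numE ?integral_ge0//|rewrite ltry]; case/integrableP : iX.
have iUV : L1fun P (U \* V).
  rewrite /L1fun; apply/integrableP; split; first exact/measurable_EFinP/measurable_funM.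
  have -> : (\int[P]_w `|(EFin \o (U \* V)%R) w| = \int[P]_w ((abse \o f) \o Z) w)%E by [].
  rewrite -(@ge0_integral_distribution _ _ _ _ _ P Z (abse \o f)); last 2 first.
  - exact: measurableT_comp.
  - by move=> y; exact: abse_ge0.
  rewrite (eq_measure_integral (distribution P X \x distribution P Y)%E); last first.
    by move=> A mA _; exact/esym/law.
  by case/integrableP : ipr.
split=> //.
rewrite /Rintegral.
have -> : (\int[P]_w (U w * V w)%:E = \int[P]_w (f \o Z) w)%E by [].
rewrite -integral_distribution//.
rewrite (eq_measure_integral (distribution P X \x distribution P Y)%E); last first.
  by move=> A mA _; exact/esym/law.
rewrite -integral12_prod_meas1//.
have -> : (\int[P]_w (U w)%:E = \int[distribution P X]_x x%:E)%E.
  by rewrite integral_distribution//; exact/measurable_EFinP.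
have -> : (\int[P]_w (V w)%:E = \int[distribution P Y]_x x%:E)%E.
  by rewrite integral_distribution//; exact/measurable_EFinP.
rewrite -fineM; [|exact: integrable_fin_num iX|exact: integrable_fin_num iY].
congr fine; rewrite -(fineK (integrable_fin_num measurableT iY)).
rewrite -integralZr//; apply: eq_integral => x _.
rewrite (fineK (integrable_fin_num measurableT iY)) -integralZl//.
Qed.
End independence.

Section wiener.
Context (R : realType) d (T : measurableType d) (P : probability T R).
Context (F : R -> set (set T)) (q : nat) (K : 'M[R]_q) (W : R -> T -> 'cV[R]_q).
Hypothesis hF : right_continuous_complete_filtration P F.
Hypothesis hW : wiener_process P F K W.

(** [F t] is the sigma-algebra it generates, so [measurable_at] becomes ordinary measurability on
    the space equipped with [F t] and inherits its closure properties. *)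
Lemma measurable_atP t (X : T -> R) : 0 <= t ->
  measurable_at F t X <-> @measurable_fun _ _ (g_sigma_algebraType (F t)) R setT X.
Proof.
move=> t0; have E : <<s F t >> = F t by apply: sigma_algebra_id; exact: (filtration_sigma hF).
split=> [mX _ B mB|mX B mB].
  by rewrite setTI; apply: sub_sigma_algebra; exact: mX.
by have := mX measurableT B mB; rewrite setTI /measurable /= E.
Qed.

Definition ad t (X : T -> R) := measurable_at F t X /\ sqi P X.

Lemma measurable_at_le s t X : 0 <= s -> s <= t -> measurable_at F s X -> measurable_at F t X.
Proof. by move=> s0 st mX B mB; apply: (filtration_mono hF s0 st); exact: mX. Qed.

Lemma measurable_at_meas t X : 0 <= t -> measurable_at F t X -> measurable_fun [set: T] X.
Proof.
by move=> t0 mX _ B mB; rewrite setTI; apply: (filtration_measurable hF t0); exact: mX.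
Qed.

Lemma measurable_at_cst t c : 0 <= t -> measurable_at F t (fun=> c).
Proof. by move=> t0; apply/measurable_atP. Qed.

Lemma measurable_atD t X Y : 0 <= t -> measurable_at F t X -> measurable_at F t Y ->
  measurable_at F t (X + Y).
Proof. by move=> t0 /measurable_atP mX /measurable_atP mY; apply/measurable_atP => //; apply: measurable_funD; [exact: mX|exact: mY]. Qed.

Lemma measurable_atM t X Y : 0 <= t -> measurable_at F t X -> measurable_at F t Y ->
  measurable_at F t (X \* Y).
Proof. by move=> t0 /measurable_atP mX /measurable_atP mY; apply/measurable_atP => //; apply: measurable_funM; [exact: mX|exact: mY]. Qed.

Lemma ad_sqi t X : ad t X -> sqi P X. Proof. by case. Qed.

Lemma ad_le s t X : 0 <= s -> s <= t -> ad s X -> ad t X.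
Proof. by move=> s0 st [mX sX]; split=> //; exact: measurable_at_le st mX. Qed.

Lemma adD t X Y : 0 <= t -> ad t X -> ad t Y -> ad t (X + Y).
Proof. by move=> t0 [mX sX] [mY sY]; split; [exact: measurable_atD|exact: sqiD]. Qed.

Lemma sqi_cst c : sqi P (fun=> c).
Proof.
split; first exact: measurable_cst.
exact: (finite_measure_integrable_cst P (c * c)).
Qed.

Lemma ad_cst t c : 0 <= t -> ad t (fun=> c).
Proof. by move=> t0; split; [exact: measurable_at_cst|exact: sqi_cst]. Qed.

Lemma adZ t c X : 0 <= t -> ad t X -> ad t (c *: X).
Proof.
move=> t0 [mX sX]; split; last exact: sqiZ.
exact: (measurable_atM t0 (measurable_at_cst c t0) mX).
Qed.

Lemma adB t X Y : 0 <= t -> ad t X -> ad t Y -> ad t (X - Y).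
Proof. by move=> t0 aX aY; rewrite -scaleN1r; apply: adD => //; exact: adZ. Qed.

Lemma ad_sum t I (r : seq I) (Q : pred I) (X : I -> T -> R) : 0 <= t ->
  (forall i, Q i -> ad t (X i)) -> ad t (\sum_(i <- r | Q i) X i).
Proof.
by move=> t0 aX; elim/big_ind: _ => //; [exact: ad_cst|move=> *; exact: adD].
Qed.

Definition Wcoord i t : T -> R := fun w => W t w i 0.
Definition dW i a b : T -> R := fun w => W b w i 0 - W a w i 0.

Lemma W_L2 i t : 0 <= t -> ad t (Wcoord i t).
Proof.
move=> t0; split; first exact: (wiener_adapted hW).
have mW : measurable_fun [set: T] (Wcoord i t).
  by apply: (measurable_at_meas t0); exact: (wiener_adapted hW).
(* For i = j the covariance identity has a real right-hand side, which forces the second moment to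
   be finite. *)
apply/sqiP => //; have := wiener_covariance hW t0 i i.
by rewrite unlock => E; rewrite [ltLHS](_ : _ = (K i i * t)%:E) ?ltry.
Qed.

Lemma W_cov i j t : 0 <= t -> ip P (Wcoord i t) (Wcoord j t) = K i j * t.
Proof.
by move=> t0; have := wiener_covariance hW t0 i j; rewrite unlock /ip /Rintegral => ->.
Qed.

Lemma W_mean i t : 0 <= t -> \int[P]_w Wcoord i t w = 0.
Proof.
by move=> t0; have := wiener_mean hW t0 i; rewrite unlock /Rintegral => ->.
Qed.

Lemma sqi_L1 X : sqi P X -> L1fun P X.
Proof.
move=> sX; have := sqiM (sqi_cst 1) sX; congr (L1fun P _).
by apply/funext => w /=; rewrite mul1r.
Qed.

Lemma dW_sqi i a b : 0 <= a -> a <= b -> sqi P (dW i a b).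
Proof.
move=> a0 ab; apply: (@sqiB _ _ _ _ (Wcoord i b) (Wcoord i a)); apply: ad_sqi; apply: W_L2 => //.
exact: le_trans ab.
Qed.

Lemma dW_ad i a b : 0 <= a -> a <= b -> ad b (dW i a b).
Proof.
move=> a0 ab; have b0 := le_trans a0 ab.
apply: (@adB _ (Wcoord i b) (Wcoord i a)) => //; first exact: W_L2.
by apply: ad_le ab _ => //; exact: W_L2.
Qed.

Definition dWtuple a b (w : T) : q.-tuple R := [tuple dW i a b w | i < q].

(** [phi] takes the whole increment vector, so that products of two coordinates are covered as well
    as single ones. *)
Lemma wiener_indep_expectation a b (U : T -> R) (phi : q.-tuple R -> R) :
  0 <= a -> a <= b -> measurable_at F a U -> measurable_fun [set: q.-tuple R] phi ->
  L1fun P U -> L1fun P (phi \o dWtuple a b) ->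
  L1fun P (U \* (phi \o dWtuple a b)) /\
  \int[P]_w (U w * phi (dWtuple a b w)) =
    \int[P]_w U w * \int[P]_w phi (dWtuple a b w).
Proof.
move=> a0 ab mU mphi iU iV; apply: (indep_expectation _ iU iV) => A B mA mB.
have ba0 : 0 <= b - a by rewrite subr_ge0.
have := wiener_independent hW a0 ba0 (mU A mA) (Y := phi @^-1` B).
have -> : a + (b - a) = b by rewrite addrC subrK.
have -> : (fun w => [tuple (W b w - W a w) i 0 | i < q]) = dWtuple a b.
  by apply/funext => w; apply: eq_from_tnth => i; rewrite !tnth_mktuple !mxE.
by apply; rewrite -[X in measurable X]setTI; exact: mphi.
Qed.

Lemma tnth_dWtuple i a b : (fun x : q.-tuple R => tnth x i) \o dWtuple a b = dW i a b.
Proof. by apply/funext => w /=; rewrite tnth_mktuple. Qed.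

Lemma dW_indep i a b U : 0 <= a -> a <= b -> measurable_at F a U -> L1fun P U ->
  \int[P]_w (U w * dW i a b w) = 0.
Proof.
move=> a0 ab mU iU; have b0 := le_trans a0 ab.
have [||_ E] := @wiener_indep_expectation a b U (fun x => tnth x i) a0 ab mU _ iU.
- exact: measurable_tnth.
- by rewrite tnth_dWtuple; exact/sqi_L1/dW_sqi.
have E1 w : tnth (dWtuple a b w) i = dW i a b w by rewrite tnth_mktuple.
have -> : \int[P]_w (U w * dW i a b w) = \int[P]_w (U w * tnth (dWtuple a b w) i).
  by apply: eq_Rintegral => w _; rewrite E1.
rewrite E; have -> : \int[P]_w tnth (dWtuple a b w) i = 0; last by rewrite mulr0.
transitivity (\int[P]_w (Wcoord i b w - Wcoord i a w)).
  by apply: eq_Rintegral => w _; rewrite E1.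
rewrite RintegralB//; last 2 first.
- exact/sqi_L1/ad_sqi/W_L2.
- exact/sqi_L1/ad_sqi/W_L2.
by rewrite !W_mean// subrr.
Qed.

Lemma dW_prod_indep i j a b U : 0 <= a -> a <= b -> measurable_at F a U -> L1fun P U ->
  L1fun P (U \* (dW i a b \* dW j a b)) /\
  \int[P]_w (U w * (dW i a b w * dW j a b w)) = (\int[P]_w U w) * (K i j * (b - a)).
Proof.
move=> a0 ab mU iU; have b0 := le_trans a0 ab.
pose phi (x : q.-tuple R) := tnth x i * tnth x j.
have E1 : phi \o dWtuple a b = dW i a b \* dW j a b.
  by apply/funext => w; rewrite /phi /= !tnth_mktuple.
have mphi : measurable_fun [set: q.-tuple R] phi.
  by apply: measurable_funM; exact: measurable_tnth.
have iphi : L1fun P (phi \o dWtuple a b).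
  by rewrite E1; apply: sqiM; exact: dW_sqi.
have [] := wiener_indep_expectation a0 ab mU mphi iU iphi.
rewrite E1 => H1 H2; split=> //.
have -> : (\int[P]_w U w) * (K i j * (b - a)) =
    (\int[P]_w U w) * \int[P]_w phi (dWtuple a b w); last first.
  rewrite -H2; apply: eq_Rintegral => w _; congr (_ * _).
  by rewrite /phi !tnth_mktuple.
congr (_ * _).
transitivity (ip P (dW i a b) (dW j a b)); last first.
  by apply: eq_Rintegral => w _; rewrite /phi !tnth_mktuple.
have sia := ad_sqi (W_L2 i a0); have sja := ad_sqi (W_L2 j a0).
have sib := ad_sqi (W_L2 i b0); have sjb := ad_sqi (W_L2 j b0).
have sdi := dW_sqi i a0 ab; have sdj := dW_sqi j a0 ab.
(* Both factors of the covariance at [b] are expanded as W(a) plus an increment; with the cross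
   terms zero, the increments have covariance K_ij b - K_ij a. *)
have o1 : ip P (Wcoord i a) (dW j a b) = 0.
  by apply: dW_indep => //; [case: (W_L2 i a0)|exact: sqi_L1].
have o2 : ip P (Wcoord j a) (dW i a b) = 0.
  by apply: dW_indep => //; [case: (W_L2 j a0)|exact: sqi_L1].
have Ei : Wcoord i b = Wcoord i a + dW i a b by apply/funext => w; rewrite !fun_ringE /dW /Wcoord addrC subrK.
have Ej : Wcoord j b = Wcoord j a + dW j a b by apply/funext => w; rewrite !fun_ringE /dW /Wcoord addrC subrK.
have := W_cov i j b0; rewrite Ei Ej (ipDl sia sdi (sqiD sja sdj)) (ipDr sja sdj sia) (ipDr sja sdj sdi) W_cov//.
by rewrite o1 [ip P (dW i a b) _]ipC o2; lra.
Qed.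

(** A product of two square integrable functions is in general merely integrable; here X^2 is
    independent of dW^2, and [dW_prod_indep] with i = j makes their product integrable. *)
Lemma ad_mul_dW i a b X : 0 <= a -> a <= b -> ad a X -> ad b (X \* dW i a b).
Proof.
move=> a0 ab [mX sX]; have b0 := le_trans a0 ab.
have mXd : measurable_at F b (X \* dW i a b).
  apply: measurable_atM => //; first exact: measurable_at_le mX.
  by case: (dW_ad i a0 ab).
split=> //; split; first exact: measurable_at_meas mXd.
have [] := dW_prod_indep i i a0 ab (measurable_atM a0 mX mX) sX.2.
by move=> + _; congr (L1fun P _); apply/funext => w /=; ring.
Qed.

Lemma ip_dW_future i X Y a b : 0 <= a -> a <= b -> ad a X -> ad a Y ->
  ip P X (Y \* dW i a b) = 0.
Proof.
move=> a0 ab [mX sX] [mY sY]; rewrite -[RHS](dW_indep i a0 ab (measurable_atM a0 mX mY)).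
  by apply: eq_Rintegral => w _ /=; rewrite mulrA.
exact: sqiM.
Qed.

Lemma ip_dW_same i j X Y a b : 0 <= a -> a <= b -> ad a X -> ad a Y ->
  ip P (X \* dW i a b) (Y \* dW j a b) = K i j * ip P X Y * (b - a).
Proof.
move=> a0 ab [mX sX] [mY sY].
have [_ E] := dW_prod_indep i j a0 ab (measurable_atM a0 mX mY) (sqiM sX sY).
rewrite mulrAC mulrC -E.
by apply: eq_Rintegral => w _ /=; ring.
Qed.

Lemma covariance_sym i j : K i j = K j i.
Proof.
by have := W_cov i j ler01; have := W_cov j i ler01; rewrite !mulr1 ipC => -> ->.
Qed.

Lemma dW_split i a b c : dW i a c = dW i a b + dW i b c.
Proof. by apply/funext => w; rewrite !fun_ringE /dW; ring. Qed.

Lemma mul_funDr (X Y Z : T -> R) : X \* (Y + Z) = X \* Y + X \* Z.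
Proof. by apply/funext => w /=; rewrite !fun_ringE /= mulrDr. Qed.

(** The intervals are cut at each other's endpoints. Pieces on disjoint intervals are orthogonal,
    since the earlier product is measurable when the later increment starts; the common piece is
    [ip_dW_same]. Step processes on unrelated grids can thus be paired without a common
    refinement. *)
Let ip_overlap_le i j X Y a b c e : 0 <= a -> a <= b -> a <= c -> c <= e ->
  ad a X -> ad c Y ->
  ip P (X \* dW i a b) (Y \* dW j c e) =
    K i j * ip P X Y * Num.max 0 (Num.min b e - Num.max a c).
Proof.
move=> a0 ab ac ce aX aY; have c0 := le_trans a0 ac.
have disj i' j' X' Y' a' b' c' e' : 0 <= a' -> a' <= b' -> b' <= c' -> c' <= e' ->
    ad a' X' -> ad c' Y' -> ip P (X' \* dW i' a' b') (Y' \* dW j' c' e') = 0.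
  move=> a'0 ab' bc' ce' aX' aY'; have b'0 := le_trans a'0 ab'.
  apply: ip_dW_future => //; first exact: le_trans bc'.
  by apply: ad_le bc' _ => //; exact: ad_mul_dW.
rewrite (max_r ac); have [bc|/ltW cb] := leP b c.
  by rewrite disj// max_l ?mulr0// subr_le0 ge_min bc.
have aXc : ad c X by exact: ad_le ac aX.
rewrite (dW_split i a c b) mul_funDr ipDl; last 3 first.
- by apply: ad_sqi; exact: ad_mul_dW.
- by apply: ad_sqi; apply: (@ad_mul_dW _ c b).
- by apply: ad_sqi; exact: ad_mul_dW.
rewrite disj// add0r.
have [be|/ltW eb] := leP b e.
  have b0 := le_trans c0 cb.
  rewrite (dW_split j c b e) mul_funDr ipDr; last 3 first.
  - by apply: ad_sqi; apply: (@ad_mul_dW _ c b).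
  - by apply: ad_sqi; apply: (@ad_mul_dW _ b e) => //; exact: ad_le cb aY.
  - by apply: ad_sqi; apply: (@ad_mul_dW _ c b).
  rewrite [X in _ + X]disj//; last exact: ad_le cb aY.
  by rewrite addr0 ip_dW_same// max_r// subr_ge0.
have e0 := le_trans c0 ce.
rewrite (dW_split i c e b) mul_funDr ipDl; last 3 first.
- by apply: ad_sqi; apply: (@ad_mul_dW _ c e).
- by apply: ad_sqi; apply: (@ad_mul_dW _ e b) => //; exact: ad_le ce aXc.
- by apply: ad_sqi; apply: (@ad_mul_dW _ c e).
rewrite [X in _ + X]ipC [X in _ + X]disj//; last exact: ad_le ce aXc.
by rewrite addr0 ip_dW_same// max_r// subr_ge0.
Qed.

Lemma ip_overlap i j X Y a b c e : 0 <= a -> a <= b -> 0 <= c -> c <= e ->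
  ad a X -> ad c Y ->
  ip P (X \* dW i a b) (Y \* dW j c e) =
    K i j * ip P X Y * Num.max 0 (Num.min b e - Num.max a c).
Proof.
move=> a0 ab c0 ce aX aY; have /orP[ac|ca] := le_total a c; first exact: ip_overlap_le.
by rewrite ipC ip_overlap_le// covariance_sym ipC minC (maxC c).
Qed.

End wiener.

(** * Step integrals and Ito integrals *)

Section tensor.
Context d1 d2 (T1 : measurableType d1) (T2 : measurableType d2) (R : realType).
Context (m1 : {sigma_finite_measure set T1 -> \bar R})
  (m2 : {sigma_finite_measure set T2 -> \bar R}).

Definition tensor (f : T1 -> R) (g : T2 -> R) : T1 * T2 -> R := fun z => f z.1 * g z.2.

Lemma measurable_tensor f g : measurable_fun [set: T1] f -> measurable_fun [set: T2] g ->
  measurable_fun [set: T1 * T2] (tensor f g).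
Proof. by move=> mf mg; apply: measurable_funM; exact: measurableT_comp. Qed.

Lemma tensor_L1 f g : L1fun m1 f -> L1fun m2 g ->
  L1fun (m1 \x m2)%E (tensor f g) /\
  \int[(m1 \x m2)%E]_z tensor f g z = (\int[m1]_x f x) * (\int[m2]_y g y).
Proof.
move=> if_ ig; have mf := L1fun_meas if_; have mg := L1fun_meas ig.
have mfg := measurable_tensor mf mg.
have nf : (\int[m1]_x `|(f x)%:E| < +oo)%E by case/integrableP : if_.
have ng : (\int[m2]_x `|(g x)%:E| < +oo)%E by case/integrableP : ig.
have gfin : (\int[m2]_y `|(g y)%:E|)%E \is a fin_num.
  by rewrite ge0_fin_numE ?integral_ge0.
have ipr : L1fun (m1 \x m2)%E (tensor f g).
  apply/integrable12ltyP; first exact/measurable_EFinP.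
  rewrite (eq_integral (fun x => `|(f x)%:E| * \int[m2]_y `|(g y)%:E|)%E).
    rewrite -(fineK gfin) ge0_integralZr//.
    - by rewrite lte_mul_pinfty ?ltry// ?integral_ge0// ge0_fin_numE ?integral_ge0.
    - exact/measurableT_comp/measurable_EFinP.
    - by rewrite lee_fin fine_ge0// integral_ge0.
  move=> x _; rewrite -ge0_integralZl_EFin//; last exact/measurableT_comp/measurable_EFinP.
  by apply: eq_integral => y _; rewrite /tensor /= normrM EFinM.
split=> //; rewrite /Rintegral -integral12_prod_meas1//.
rewrite -fineM; [|exact: integrable_fin_num if_|exact: integrable_fin_num ig].
congr fine; rewrite -(fineK (integrable_fin_num measurableT ig)).
rewrite -integralZr//; apply: eq_integral => x _.
by rewrite (fineK (integrable_fin_num measurableT ig)) -integralZl.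
Qed.

Lemma sqi_tensor f g : sqi m1 f -> sqi m2 g -> sqi (m1 \x m2)%E (tensor f g).
Proof.
move=> [mf sf] [mg sg]; split; first exact: measurable_tensor.
have [+ _] := tensor_L1 sf sg; congr (L1fun _ _).
by apply/funext => z; rewrite /tensor /=; ring.
Qed.

Lemma ip_tensor f f' g g' : sqi m1 f -> sqi m1 f' -> sqi m2 g -> sqi m2 g' ->
  ip (m1 \x m2)%E (tensor f g) (tensor f' g') = ip m1 f f' * ip m2 g g'.
Proof.
move=> sf sf' sg sg'; have [_ <-] := tensor_L1 (sqiM sf sf') (sqiM sg sg').
by apply: eq_Rintegral => z _; rewrite /tensor /=; ring.
Qed.
End tensor.

Section cvg2.
Context d (T : measurableType d) (R : realType) (mu : {measure set T -> \bar R}).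

Definition cvg2 (X : nat -> T -> R) (L : T -> R) :=
  (fun m => ip mu (X m - L) (X m - L)) @ \oo --> (0 : R).

Lemma cvg0_le (u v : nat -> R) (c : R) : (forall m, 0 <= u m <= c * v m) ->
  v @ \oo --> (0 : R) -> u @ \oo --> (0 : R).
Proof.
move=> uv v0; apply: (@squeeze_cvgr _ _ _ _ (fun=> 0) (fun m => c * v m)).
- exact: nearW.
- exact: cvg_cst.
- by rewrite -[X in _ --> X](mulr0 c); apply: cvgM => //; exact: cvg_cst.
Qed.

Lemma cvg2_dist (X Y : nat -> T -> R) L : sqi mu L ->
  (forall m, sqi mu (X m)) -> (forall m, sqi mu (Y m)) ->
  (fun m => ip mu (X m - Y m) (X m - Y m)) @ \oo --> (0 : R) -> cvg2 Y L -> cvg2 X L.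
Proof.
move=> sL sX sY XY YL.
apply: (@cvg0_le _ (fun m => ip mu (X m - Y m) (X m - Y m) + ip mu (Y m - L) (Y m - L)) 2).
  move=> m; rewrite ip_ge0/= mulrDr.
  have -> : X m - L = (X m - Y m) + (Y m - L) by rewrite addrA subrK.
  by apply: ip_normD; exact: sqiB.
by rewrite -[X in _ --> X](addr0 0); exact: cvgD.
Qed.

Lemma cvg2_common (X Y : nat -> T -> R) L : sqi mu L ->
  (forall m, sqi mu (X m)) -> (forall m, sqi mu (Y m)) ->
  cvg2 X L -> cvg2 Y L -> (fun m => ip mu (X m - Y m) (X m - Y m)) @ \oo --> (0 : R).
Proof.
move=> sL sX sY XL YL.
apply: (@cvg0_le _ (fun m => ip mu (X m - L) (X m - L) + ip mu (Y m - L) (Y m - L)) 2).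
  move=> m; rewrite ip_ge0/= mulrDr.
  have -> : X m - Y m = (X m - L) + (L - Y m) by rewrite addrA subrK.
  have -> : ip mu (Y m - L) (Y m - L) = ip mu (L - Y m) (L - Y m).
    by rewrite -(opprB L) ipNl ?ipNr ?opprK//; do ?apply: sqiN; exact: sqiB.
  by apply: ip_normD; exact: sqiB.
by rewrite -[X in _ --> X](addr0 0); exact: cvgD.
Qed.
End cvg2.

Section steps.
Context (R : realType) d (T : measurableType d) (P : probability T R).
Context (F : R -> set (set T)) (q : nat) (K : 'M[R]_q) (W : R -> T -> 'cV[R]_q).
Hypothesis hF : right_continuous_complete_filtration P F.
Hypothesis hW : wiener_process P F K W.
Local Notation leb := (@lebesgue_measure R).
(** All integrands live in L^2 of this one measure: a process on [0, t] is extended by zero in time,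
    so that different horizons can be compared. *)
Definition nu := (leb \x P)%E.

Lemma sqi_indic_itv (a b : R) : sqi leb (\1_(`]a, b] : set R)).
Proof.
split; first exact: measurable_indic.
rewrite (_ : _ \* _ = \1_(`]a, b] : set R)).
  exact: (integrable_indic_itv a b false false).
by apply/funext => x; rewrite /= indicE; case: (_ \in _); rewrite ?mulr1 ?mulr0.
Qed.

Lemma ip_indic_itv (a b c e : R) :
  ip leb (\1_(`]a, b] : set R)) (\1_(`]c, e] : set R)) = Num.max 0 (Num.min b e - Num.max a c).
Proof.
rewrite /ip /Rintegral.
have -> : (\int[leb]_z (\1_(`]a, b] : set R) z * \1_(`]c, e] : set R) z)%:E =
    \int[leb]_z (\1_(`]Num.max a c, Num.min b e] : set R) z)%:E)%E.
  apply: eq_integral => z _; congr EFin; rewrite !indicE -natrM mulnb.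
  congr ((nat_of_bool _)%:R); apply/idP/idP; rewrite !inE /= !in_itv /= gt_max le_min.
    by move=> /andP[]; rewrite !inE/= !in_itv/= => /andP[-> ->] /andP[-> ->].
  by move=> /andP[/andP[? ?] /andP[? ?]]; apply/andP; split; rewrite inE/= in_itv/=; apply/andP.
rewrite integral_indic//= setIT lebesgue_measure_itv/= lte_fin.
set u := Num.max a c; set v := Num.min b e.
case: ifPn => [lt|]; first by rewrite -EFinB/= max_r// subr_ge0 ltW.
by rewrite -leNgt => le; rewrite max_l// subr_le0.
Qed.

Lemma mem_oc (a b x : R) : (x \in `]a, b]%classic) = (a < x <= b).
Proof. by apply/idP/idP; rewrite inE /= in_itv. Qed.

Definition elementary (xi : T -> R) a b : R * T -> R := tensor \1_(`]a, b] : set R) xi.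
Definition stepfun (S : step_process) : R * T -> R := fun z => step_value S z.1 z.2.
Definition stepint i (S : step_process) : T -> R := step_integral (fun s w => W s w i 0) S.

Lemma stepfunE S :
  stepfun S = \sum_(k < steps S) elementary (coef S k) (node S k) (node S k.+1).
Proof.
apply/funext => z; rewrite fct_sumE; apply: eq_bigr => k _.
by rewrite /elementary /tensor mulrC.
Qed.

Lemma stepintE i S :
  stepint i S = \sum_(k < steps S) (coef S k \* dW W i (node S k) (node S k.+1)).
Proof. by apply/funext => z; rewrite fct_sumE. Qed.

Section adapted.
Variables (t : R) (S : @step_process R d T).
Hypothesis aS : adapted_step_process P F t S.

Lemma node_ge0 k : (k <= steps S)%N -> 0 <= node S k.
Proof.
elim: k => [|k IH] kS; first by rewrite (step_start aS).
by apply: le_trans (step_mono aS kS); apply: IH; exact: ltnW.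
Qed.

Lemma node_le_end k : (k <= steps S)%N -> node S k <= t.
Proof.
rewrite -(step_end aS) => kS; suff H j : (k + j <= steps S)%N -> node S k <= node S (k + j)%N.
  by have := H (steps S - k)%N; rewrite subnKC// => /(_ (leqnn _)).
elim: j => [|j IH] H; first by rewrite addn0.
rewrite addnS in H *; apply: le_trans (step_mono aS H).
by apply: IH; exact: ltnW.
Qed.

Lemma end_ge0 : 0 <= t.
Proof. by rewrite -(step_end aS); exact: node_ge0. Qed.

Lemma coef_ad k : (k < steps S)%N -> ad P F (node S k) (coef S k).
Proof.
move=> kS; have mc := step_adapted aS kS; split=> //.
apply/sqiP; last exact: (step_sqint aS).
by apply: (measurable_at_meas hF _ mc); apply: node_ge0; exact: ltnW.
Qed.

Lemma sqi_elementary xi (a b : R) : sqi P xi -> sqi nu (elementary xi a b).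
Proof. by move=> sx; apply: sqi_tensor => //; exact: sqi_indic_itv. Qed.

Lemma sqi_stepfun : sqi nu (stepfun S).
Proof.
rewrite stepfunE; apply: sqi_sum => k _; apply: sqi_elementary.
by apply: ad_sqi; exact: coef_ad.
Qed.

Lemma ad_term i k : (k < steps S)%N ->
  ad P F (node S k.+1) (coef S k \* dW W i (node S k) (node S k.+1)).
Proof.
move=> kS; apply: (ad_mul_dW hF hW) => //; first by apply: node_ge0; exact: ltnW.
  exact: (step_mono aS).
exact: coef_ad.
Qed.

Lemma ad_stepint i : ad P F t (stepint i S).
Proof.
rewrite stepintE; apply: (ad_sum hF) => [|k _]; first exact: end_ge0.
apply: (ad_le hF) (ad_term i (ltn_ord k)); first exact: node_ge0.
exact: node_le_end.
Qed.

Lemma sqi_stepint i : sqi P (stepint i S). Proof. exact: ad_sqi (ad_stepint i). Qed.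

Lemma stepfun_out s w : ~~ (0 <= s <= t) -> stepfun S (s, w) = 0.
Proof.
move=> st; rewrite /stepfun /step_value big1// => k _ /=.
rewrite indicE; case: (boolP (_ \in _)); last by rewrite mulr0.
rewrite inE /= in_itv/= => /andP[ks sk]; exfalso; move/negP: st; apply; apply/andP; split.
  by apply: le_trans (ltW ks); apply: node_ge0; exact: ltnW.
by apply: (le_trans sk); exact: node_le_end.
Qed.
End adapted.

(** Both sides expand over pairs of intervals, and [ip_overlap] and [ip_indic_itv] produce the same
    overlap length. Grids and horizons are free because unrelated approximating sequences are
    compared later. *)
Lemma step_isometry i j t t' S S' :
  adapted_step_process P F t S -> adapted_step_process P F t' S' ->
  ip P (stepint i S) (stepint j S') = K i j * ip nu (stepfun S) (stepfun S').
Proof.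
move=> aS aS'; rewrite !stepfunE !stepintE.
have h1 k : sqi nu (elementary (coef S (k : 'I_(steps S))) (node S k) (node S k.+1)).
  by apply: sqi_elementary; apply: ad_sqi; exact: (coef_ad aS).
have h2 k : sqi nu (elementary (coef S' (k : 'I_(steps S'))) (node S' k) (node S' k.+1)).
  by apply: sqi_elementary; apply: ad_sqi; exact: (coef_ad aS').
have g1 (k : 'I_(steps S)) := ad_sqi (ad_term aS i (ltn_ord k)).
have g2 (k : 'I_(steps S')) := ad_sqi (ad_term aS' j (ltn_ord k)).
rewrite ip_suml//; last exact: sqi_sum.
rewrite ip_suml//; last exact: sqi_sum.
rewrite mulr_sumr; apply: eq_bigr => k _.
rewrite ip_sumr// ip_sumr// mulr_sumr; apply: eq_bigr => l _.
have ck := coef_ad aS (ltn_ord k); have cl := coef_ad aS' (ltn_ord l).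
rewrite (ip_overlap hF hW)//.
- rewrite ip_tensor; [|exact: sqi_indic_itv|exact: sqi_indic_itv|exact: ad_sqi ck|exact: ad_sqi cl].
  by rewrite ip_indic_itv; ring.
- by apply: (node_ge0 aS); exact: ltnW.
- exact: (step_mono aS).
- by apply: (node_ge0 aS'); exact: ltnW.
- exact: (step_mono aS').
Qed.

Lemma step_isometry_dist i t t' S S' :
  adapted_step_process P F t S -> adapted_step_process P F t' S' ->
  ip P (stepint i S - stepint i S') (stepint i S - stepint i S') =
    K i i * ip nu (stepfun S - stepfun S') (stepfun S - stepfun S').
Proof.
move=> aS aS'; have sS := sqi_stepfun aS; have sS' := sqi_stepfun aS'.
have sI := sqi_stepint aS i; have sI' := sqi_stepint aS' i.
have dist d0 (T0 : measurableType d0) (mu : {measure set T0 -> \bar R}) (X Y : T0 -> R) :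
    sqi mu X -> sqi mu Y -> ip mu (X - Y) (X - Y) = ip mu X X - 2 * ip mu X Y + ip mu Y Y.
  move=> sX sY; rewrite (ipBl sX sY (sqiB sX sY)) (ipBr sX sY sX) (ipBr sX sY sY) (ipC mu Y X).
  by ring.
rewrite !dist// (step_isometry i i aS aS) (step_isometry i i aS aS') (step_isometry i i aS' aS').
by ring.
Qed.

(** A coefficient whose node exceeds [s] need not be measurable at the capped node [s], so it is
    replaced by 0; for increasing nodes its capped interval is empty anyway. *)
Definition trunc s (S : @step_process R d T) : step_process :=
  StepProcess (steps S) (fun k => Num.min (node S k) s)
    (fun k w => if node S k <= s then coef S k w else 0).

Section trunc.
Variables (s t : R) (S : @step_process R d T).
Hypothesis aS : adapted_step_process P F t S.
Hypothesis s0 : 0 <= s.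
Hypothesis st : s <= t.

Lemma trunc_adapted : adapted_step_process P F s (trunc s S).
Proof.
split=> /=.
- by rewrite (step_start aS) min_l.
- by rewrite (step_end aS) min_r.
- by move=> k kS; rewrite le_min2//; exact: (step_mono aS).
- move=> k kS; case: (leP (node S k) s) => [ks|sk]; first exact: (step_adapted aS).
  exact: (measurable_at_cst hF).
- move=> k kS; case: (leP (node S k) s) => [ks|sk]; first exact: (step_sqint aS).
  by under eq_integral do rewrite expr0n; rewrite integral0.
Qed.

Lemma stepfun_trunc z : stepfun (trunc s S) z = stepfun S z * (z.1 <= s)%R%:R.
Proof.
rewrite /stepfun /step_value mulr_suml; apply: eq_bigr => k _ /=; rewrite !indicE.
rewrite !mem_oc /=.
rewrite gt_min le_min; case: (leP z.1 s) => zs; last by rewrite andbF !andbF !mulr0.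
rewrite orbF andbT mulr1; case: (ltP (node S k) z.1) => //= kz; last by rewrite !mulr0.
by rewrite (le_trans (ltW kz) zs).
Qed.

(** The martingale property in weak form: increments after [s] are orthogonal to L^2(F_s), and an
    interval that contains [s] is split there. *)
Lemma stepint_trunc i Z : ad P F s Z -> ip P (stepint i S) Z = ip P (stepint i (trunc s S)) Z.
Proof.
move=> aZ; have sZ := ad_sqi aZ.
rewrite !stepintE ip_suml//; last by move=> k _; exact: ad_sqi (ad_term aS i (ltn_ord k)).
rewrite ip_suml//; last first.
  by move=> k _; exact: ad_sqi (ad_term trunc_adapted i (ltn_ord k)).
apply: eq_bigr => k _ /=.
have k0 : 0 <= node S k by apply: (node_ge0 aS); exact: ltnW.
have pred_ceil := step_mono aS (ltn_ord k).
have ck := coef_ad aS (ltn_ord k).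
have [ks|/ltW sk] := leP (node S k) s; last first.
  rewrite ipC (ip_dW_future hF hW)//; last exact: (ad_le hF) aZ.
  by rewrite (_ : _ \* _ = 0) ?ip0l//; apply/funext => w; rewrite /= mul0r.
have [ks'|/ltW sk'] := leP (node S k.+1) s; first by congr ip; apply/funext => w.
rewrite (dW_split W i _ s) mul_funDr ipDl//.
- rewrite [X in _ + X]ipC [X in _ + X](ip_dW_future hF hW)//; last exact: (ad_le hF) ck.
  by rewrite addr0.
- by apply: ad_sqi; exact: (ad_mul_dW hF hW).
- by apply: ad_sqi; apply: (ad_mul_dW hF hW _ s0 sk'); exact: (ad_le hF) ck.
Qed.
End trunc.
End steps.

(** * Isometry and martingale property of Ito integrals *)

Section ito.
Context (R : realType) d (T : measurableType d) (P : probability T R).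
Context (F : R -> set (set T)) (q : nat) (K : 'M[R]_q) (W : R -> T -> 'cV[R]_q).
Hypothesis hF : right_continuous_complete_filtration P F.
Hypothesis hW : wiener_process P F K W.
Local Notation leb := (@lebesgue_measure R).
Local Notation nu := (nu P).
Local Notation ito i v t I := (is_ito_integral P F (fun s w => W s w i 0) v t I).

Lemma mem_cc (a b x : R) : (x \in `[a, b]%classic) = (a <= x <= b).
Proof. by apply/idP/idP; rewrite inE /= in_itv. Qed.

Definition tcut t (v : R -> T -> R) : R * T -> R := fun z => v z.1 z.2 * \1_(`[0, t] : set R) z.1.

Lemma iterated_sq (t : R) (g : R * T -> R) : measurable_fun [set: R * T] g ->
  (forall s w, ~~ (0 <= s <= t) -> g (s, w) = 0) ->
  (\int[nu]_z ((g z) ^+ 2)%:E = \int[P]_w \int[leb]_(s in `[0%R, t]) ((g (s, w)) ^+ 2)%:E)%E.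
Proof.
move=> mg g0; rewrite fubini_tonelli2.
- apply: eq_integral => w _; rewrite /fubini_G [RHS]integral_mkcond; apply: eq_integral => s _ /=.
  rewrite patchE; case: (boolP (s \in _)) => // sN; rewrite g0 ?expr0n//.
  by apply: contra sN => H; rewrite inE /= in_itv/=.
- by apply/measurable_EFinP; exact: measurable_funX.
- by move=> z; rewrite lee_fin sqr_ge0.
Qed.

Lemma cut_sub_step t v S s w : adapted_step_process P F t S -> 0 <= s <= t ->
  (tcut t v - stepfun S) (s, w) = v s w - step_value S s w.
Proof.
move=> aS st; rewrite !fun_ringE /tcut/= indicE mem_set ?mulr1//.
Qed.

Lemma cut_out t v s w : ~~ (0 <= s <= t) -> tcut t v (s, w) = 0.
Proof.
move=> st; rewrite /tcut /= indicE memNset ?mulr0// => /=; rewrite in_itv/= => H.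
by rewrite H in st.
Qed.

Lemma cvge_sq d' (T' : measurableType d') (mu : {measure set T' -> \bar R})
    (X : nat -> T' -> R) :
  (forall m, sqi mu (X m)) ->
  (fun m => \int[mu]_z ((X m z) ^+ 2)%:E)%E @ \oo --> (0 : \bar R) <->
  (fun m => ip mu (X m) (X m)) @ \oo --> (0 : R).
Proof.
move=> sX; have -> : (fun m => \int[mu]_z ((X m z) ^+ 2)%:E)%E =
    (EFin \o (fun m => ip mu (X m) (X m))).
  by apply/funext => m; rewrite -ip_normE.
by split=> [/fine_cvgP[]//|H]; apply/fine_cvgP; split=> //; exact: nearW.
Qed.

Lemma ito_cvg i v t I : ito i v t I -> sqi nu (tcut t v) ->
  sqi P I /\ exists S : nat -> step_process,
   [/\ forall m, adapted_step_process P F t (S m),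
       cvg2 nu (fun m => stepfun (S m)) (tcut t v) &
       cvg2 P (fun m => stepint W i (S m)) I].
Proof.
move=> [mI [S [aS vS IS]]] sv.
have sS m := sqi_stepfun hF (aS m).
have sSI m := sqi_stepint hF hW (aS m) i.
have sI : sqi P I.
  (* Square integrability of [I] has to be extracted: extended reals that tend to 0 are eventually
     finite, so [I] is at finite distance from some step integral. *)
  have /fine_cvgP[finI _] : (fun m => \int[P]_w ((I w - stepint W i (S m) w) ^+ 2)%:E)%E @ \oo --> 0%:E := IS.
  have [m _ /(_ m (leqnn _)) Im] := finI.
  have sd : sqi P (I - stepint W i (S m)).
    apply/sqiP; first exact: measurable_funB mI (sqi_meas (sSI m)).
    by move: Im; rewrite fin_numElt => /andP[].
  have -> : I = (I - stepint W i (S m)) + stepint W i (S m) by rewrite subrK.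
  exact: sqiD.
split=> //; exists S; split=> //.
  have E : (fun m => ip nu (stepfun (S m) - tcut t v) (stepfun (S m) - tcut t v)) =
      (fun m => ip nu (tcut t v - stepfun (S m)) (tcut t v - stepfun (S m))).
    apply/funext => m; rewrite -(opprB (tcut t v)) ipNl ?ipNr ?opprK//;
      do ?apply: sqiN; exact: sqiB.
  rewrite /cvg2 E; 
    apply: (@cvge_sq _ _ nu _ (fun m => sqiB sv (sS m))).1.
  rewrite (_ : (fun m => _) = (fun m => \int[P]_w \int[leb]_(s in `[0%R, t])
           ((v s w - step_value (S m) s w) ^+ 2)%:E)%E)//.
  apply/funext => m; rewrite (@iterated_sq t).
  - apply: eq_integral => w _; apply: eq_integral => s; rewrite inE/= in_itv/= => st.
    by rewrite cut_sub_step.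
  - exact: (sqi_meas (sqiB sv (sS m))).
  - move=> s w st; rewrite !fun_ringE cut_out// (stepfun_out (aS m))// subr0//.
have E : (fun m => ip P (stepint W i (S m) - I) (stepint W i (S m) - I)) =
    (fun m => ip P (I - stepint W i (S m)) (I - stepint W i (S m))).
  apply/funext => m; rewrite -(opprB I) ipNl ?ipNr ?opprK//; do ?apply: sqiN; exact: sqiB.
rewrite /cvg2 E; 
exact: (@cvge_sq _ _ P _ (fun m => sqiB sI (sSI m))).1.
Qed.

Lemma ito_isometry i j v v' t I I' : ito i v t I -> ito j v' t I' ->
  sqi nu (tcut t v) -> sqi nu (tcut t v') ->
  ip P I I' = K i j * ip nu (tcut t v) (tcut t v').
Proof.
move=> iI iI' sv sv'.
have [sI [S [aS vS IS]]] := ito_cvg iI sv.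
have [sI' [S' [aS' vS' IS']]] := ito_cvg iI' sv'.
have sS m := sqi_stepfun hF (aS m).
have sS' m := sqi_stepfun hF (aS' m).
have sSI m := sqi_stepint hF hW (aS m) i.
have sSI' m := sqi_stepint hF hW (aS' m) j.
have c1 := ip_cvg sI sI' sSI sSI' IS IS'.
have c2 := ip_cvg sv sv' sS sS' vS vS'.
have c3 : (fun m => ip P (stepint W i (S m)) (stepint W j (S' m))) @ \oo -->
    K i j * ip nu (tcut t v) (tcut t v').
  under eq_fun do rewrite (step_isometry hF hW i j (aS _) (aS' _)).
  by apply: cvgM => //; exact: cvg_cst.
by rewrite -(cvg_lim _ c1)// (cvg_lim _ c3).
Qed.

(** Truncating at [s] a sequence that approximates [v] on [0, t] gives one that approximates [v] on
    [0, s]. By the isometry its integrals share the limit [I'], while [stepint_trunc] says that [Z]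
    does not see the truncation. *)
Lemma ito_martingale i v s t I I' Z : 0 <= s -> s <= t ->
  ito i v t I -> ito i v s I' -> sqi nu (tcut t v) -> ad P F s Z ->
  ip P I Z = ip P I' Z.
Proof.
move=> s0 st iI iI' sv aZ; have sZ := ad_sqi aZ.
have cutE z : tcut s v z = tcut t v z * (z.1 <= s)%R%:R.
  case: z => r w; rewrite /tcut /= -mulrA !indicE -natrM mulnb.
  congr (_ * (nat_of_bool _)%:R); rewrite !mem_cc.
  by case: (leP r s) => rs; rewrite ?andbF// !andbT (le_trans rs st) andbT.
have mle : measurable_fun [set: R * T] (fun z : R * T => (z.1 <= s)%R%:R : R).
  have -> : (fun z : R * T => (z.1 <= s)%R%:R : R) = \1_(`]-oo, s] : set R) \o fst.
    by apply/funext => z; rewrite /= indicE; congr ((nat_of_bool _)%:R); apply/idP/idP; rewrite inE/= in_itv.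
  by apply: measurableT_comp => //; exact: measurable_indic.
have sq_le g g' : sqi nu g' -> (forall z, g z = g' z * (z.1 <= s)%R%:R) ->
    sqi nu g /\ ip nu g g <= ip nu g' g'.
  move=> sg' E; have mg : measurable_fun [set: R * T] g.
    have -> : g = (g' \* (fun z : R * T => (z.1 <= s)%R%:R)) by apply/funext => z; rewrite E.
    by apply: measurable_funM => //; exact: sqi_meas sg'.
  have pw z : g z * g z <= g' z * g' z.
    by rewrite E; case: (z.1 <= s)%R; rewrite ?mulr1// !mulr0 -expr2 sqr_ge0.
  have sg : sqi nu g.
    split=> //; apply: L1fun_le sg'.2; first exact: measurable_funM.
    by move=> z /=; rewrite !ger0_norm// -expr2 sqr_ge0.
  by split=> //; apply: le_Rintegral => //; [exact: sqiM|exact: sqiM].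
have sv' : sqi nu (tcut s v) by have [] := sq_le _ _ sv cutE.
have [sI [S [aS vS IS]]] := ito_cvg iI sv.
have [sI' [S' [aS' vS' IS']]] := ito_cvg iI' sv'.
have aTr m := trunc_adapted hF (aS m) s0 st.
have sS m := sqi_stepfun hF (aS m).
have sS' m := sqi_stepfun hF (aS' m).
have sTr m := sqi_stepfun hF (aTr m).
have sSI m := sqi_stepint hF hW (aS m) i.
have sSI' m := sqi_stepint hF hW (aS' m) i.
have sTI m := sqi_stepint hF hW (aTr m) i.
have vTr : cvg2 nu (fun m => stepfun (trunc s (S m))) (tcut s v).
  apply: (@cvg0_le _ _ _ 1 _ vS) => m; rewrite ip_ge0/= mul1r.
  have [] // := sq_le (stepfun (trunc s (S m)) - tcut s v) (stepfun (S m) - tcut t v).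
    exact: sqiB.
  by move=> z; rewrite !fun_ringE stepfun_trunc cutE -mulrBl.
have Tr' := cvg2_common sv' sTr sS' vTr vS'.
have cTI : cvg2 P (fun m => stepint W i (trunc s (S m))) I'.
  apply: (cvg2_dist sI' sTI sSI' _ IS').
  apply: (@cvg0_le _ _ _ (K i i) _ Tr') => m; rewrite ip_ge0/=.
  by rewrite (step_isometry_dist hF hW i (aTr m) (aS' m)).
have sZc (m : nat) := sZ.
have ZZ : cvg2 P (fun=> Z) Z.
  by rewrite /cvg2 subrr ip0l; exact: cvg_cst.
have c1 := ip_cvg sI sZ sSI sZc IS ZZ.
have c2 := ip_cvg sI' sZ sTI sZc cTI ZZ.
rewrite -(cvg_lim _ c1)// -(cvg_lim _ c2)//.
by congr (lim (_ @ \oo)); apply/funext => m; apply: (stepint_trunc hF hW (aS m)).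
Qed.

End ito.

(** * The product rule in mean *)

Section Rfubini.
Context d1 d2 (T1 : measurableType d1) (T2 : measurableType d2) (R : realType).
Context (m1 : {sigma_finite_measure set T1 -> \bar R})
  (m2 : {sigma_finite_measure set T2 -> \bar R}).

Lemma ae_eq_Rint d (T : measurableType d) (mu : {measure set T -> \bar R}) (X Y : T -> R) :
  measurable_fun [set: T] X -> measurable_fun [set: T] Y ->
  {ae mu, forall w, X w = Y w} -> \int[mu]_w X w = \int[mu]_w Y w.
Proof.
move=> mX mY XY; congr fine; apply: ae_eq_integral => //; try exact/measurable_EFinP.
by apply: filterS XY => w -> _.
Qed.

(** Tonelli handles the positive and the negative part, which settles an arbitrary measurable
    [G]. *)
Lemma measurable_partial1 (G : T1 * T2 -> R) : measurable_fun [set: T1 * T2] G ->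
  measurable_fun [set: T2] (fun y => \int[m1]_x G (x, y)).
Proof.
move=> mG; have mEG : measurable_fun [set: T1 * T2] (EFin \o G) by exact/measurable_EFinP.
apply: measurableT_comp => //.
have -> : (fun y => \int[m1]_x (G (x, y))%:E)%E =
    (fun y => \int[m1]_x ((EFin \o G)^\+ (x, y)) - \int[m1]_x ((EFin \o G)^\- (x, y)))%E.
  by apply/funext => y; rewrite [LHS]integralE; congr (_ - _)%E; apply: eq_integral => x _; rewrite ?funeposE ?funenegE.
apply: emeasurable_funB.
- apply: (@measurable_fun_fubini_tonelli_G _ _ _ _ _ m1 (EFin \o G)^\+%E) => //.
  exact: measurable_funepos.
- apply: (@measurable_fun_fubini_tonelli_G _ _ _ _ _ m1 (EFin \o G)^\-%E) => //.
  exact: measurable_funeneg.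
Qed.

Lemma measurable_partial2 (G : T1 * T2 -> R) : measurable_fun [set: T1 * T2] G ->
  measurable_fun [set: T1] (fun x => \int[m2]_y G (x, y)).
Proof.
move=> mG; have mEG : measurable_fun [set: T1 * T2] (EFin \o G) by exact/measurable_EFinP.
apply: measurableT_comp => //.
have -> : (fun x => \int[m2]_y (G (x, y))%:E)%E =
    (fun x => \int[m2]_y ((EFin \o G)^\+ (x, y)) - \int[m2]_y ((EFin \o G)^\- (x, y)))%E.
  by apply/funext => y; rewrite [LHS]integralE; congr (_ - _)%E; apply: eq_integral => x _; rewrite ?funeposE ?funenegE.
apply: emeasurable_funB.
- apply: (@measurable_fun_fubini_tonelli_F _ _ _ _ _ m2 (EFin \o G)^\+%E) => //.
  exact: measurable_funepos.
- apply: (@measurable_fun_fubini_tonelli_F _ _ _ _ _ m2 (EFin \o G)^\-%E) => //.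
  exact: measurable_funeneg.
Qed.

(** [fine] sends an infinite inner integral to 0, so real and extended iterated integrals are
    compared on the integrable slices, which are almost all of them. *)
Lemma Rfubini1 (h : T1 * T2 -> R) : L1fun (m1 \x m2)%E h ->
  [/\ {ae m1, forall x, L1fun m2 (fun y => h (x, y))},
      L1fun m1 (fun x => \int[m2]_y h (x, y)) &
      \int[(m1 \x m2)%E]_z h z = \int[m1]_x \int[m2]_y h (x, y)].
Proof.
move=> ih; have mh := L1fun_meas ih.
have ae1 := ae_integrable1 ih.
have iF := integrable_fubini_F ih.
have E : {ae m1, forall x, (\int[m2]_y h (x, y))%:E = fubini_F m2 (EFin \o h) x}.
  by apply: filterS ae1 => x ix; rewrite fineK//; exact: integrable_fin_num ix.
have mp := measurable_partial2 mh.
have i1 : L1fun m1 (fun x => \int[m2]_y h (x, y)).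
  apply/integrableP; split; first exact/measurable_EFinP.
  rewrite (@ae_eq_integral _ _ _ m1 setT (abse \o fubini_F m2 (EFin \o h)))//.
  - by case/integrableP : iF.
  - by apply/measurableT_comp => //; exact/measurable_EFinP.
  - by apply/measurableT_comp => //; exact: measurable_int iF.
  - by apply: filterS E => x Ex _ /=; rewrite -Ex.
split=> //; rewrite /Rintegral -integral12_prod_meas1//; congr fine.
apply: ae_eq_integral => //.
- exact: measurable_int iF.
- exact/measurable_EFinP.
- by apply: filterS E => x <-.
Qed.

Lemma Rfubini2 (h : T1 * T2 -> R) : L1fun (m1 \x m2)%E h ->
  [/\ {ae m2, forall y, L1fun m1 (fun x => h (x, y))},
      L1fun m2 (fun y => \int[m1]_x h (x, y)) &
      \int[(m1 \x m2)%E]_z h z = \int[m2]_y \int[m1]_x h (x, y)].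
Proof.
move=> ih; have mh := L1fun_meas ih.
have ae1 := ae_integrable2 ih.
have mF := measurable_fubini_G ih.
have E : {ae m2, forall y, (\int[m1]_x h (x, y))%:E = fubini_G m1 (EFin \o h) y}.
  by apply: filterS ae1 => x ix; rewrite fineK//; exact: integrable_fin_num ix.
have mp := measurable_partial1 mh.
have i1 : L1fun m2 (fun y => \int[m1]_x h (x, y)).
  apply/integrableP; split; first exact/measurable_EFinP.
  apply: (@le_lt_trans _ _ (\int[m2]_y \int[m1]_x `|(h (x, y))%:E|)%E); last first.
    have mEh : measurable_fun [set: T1 * T2] (EFin \o h) by exact/measurable_EFinP.
    by have [+ _] := @integrable21ltyP _ _ _ _ _ m1 m2 _ mEh; apply.
  apply: ae_ge0_le_integral => //.
  - by apply/measurableT_comp => //; exact/measurable_EFinP.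
  - by move=> y _; exact: integral_ge0.
  - apply: (@measurable_fun_fubini_tonelli_G _ _ _ _ _ m1 (abse \o (EFin \o h))).
      by apply/measurableT_comp => //; exact/measurable_EFinP.
    by move=> z; exact: abse_ge0.
  apply: filterS ae1 => y iy _; have := le_normr_Rintegral measurableT iy.
  rewrite -lee_fin => /le_trans; apply.
  by rewrite /Rintegral fineK//; exact: (integrable_fin_num measurableT (integrable_norm iy)).
split=> //; rewrite /Rintegral -integral21_prod_meas1//; congr fine.
apply: ae_eq_integral => //.
- exact/measurable_EFinP.
- by apply: filterS E => x <-.
Qed.
End Rfubini.

Section ibp.
Context (R : realType).
Local Notation leb := (@lebesgue_measure R).

Lemma measurable_le_set : measurable_fun [set: R * R] (fun z : R * R => (z.1 <= z.2)%R%:R : R).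
Proof.
have -> : (fun z : R * R => (z.1 <= z.2)%R%:R : R) =
    (\1_(`[0, +oo[ : set R)) \o (fun z : R * R => z.2 - z.1).
  by apply/funext => z; rewrite /= indicE; congr ((nat_of_bool _)%:R); apply/idP/idP; rewrite inE/= in_itv/= andbT subr_ge0.
apply: measurableT_comp; first exact: measurable_indic.
by apply: measurable_funB; [exact: measurable_snd|exact: measurable_fst].
Qed.

(** Integration by parts for two primitives: the plane is cut along the diagonal, and Fubini is
    applied to the halves r <= s and s < r. *)
Lemma primitive_product (f g : R -> R) : L1fun leb f -> L1fun leb g ->
  (\int[leb]_r f r) * (\int[leb]_s g s) =
  (\int[leb]_s ((\int[leb]_r ((r <= s)%R%:R * f r)) * g s)) +
  (\int[leb]_r ((\int[leb]_s ((s <= r)%R%:R * g s)) * f r)).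
Proof.
move=> if_ ig; have [ifg <-] := @tensor_L1 _ _ _ _ _ leb leb _ _ if_ ig.
have mfg := L1fun_meas ifg.
have mle := measurable_le_set.
have mlt : measurable_fun [set: R * R] (fun z : R * R => (z.2 < z.1)%R%:R : R).
  have -> : (fun z : R * R => (z.2 < z.1)%R%:R : R) = (fun z => 1 - (z.1 <= z.2)%R%:R).
    by apply/funext => z; rewrite ltNge; case: (_ <= _)%R; rewrite ?subrr ?subr0.
  by apply: measurable_funB.
have b1 (b : bool) : `|b%:R : R| <= 1 by case: b; rewrite ?normr1 ?normr0.
have i1 : L1fun (leb \x leb)%E (fun z : R * R => (z.1 <= z.2)%R%:R * (f z.1 * g z.2)).
  apply: (L1fun_le _ _ ifg); first exact: measurable_funM.
  by move=> z; rewrite normrM ler_piMl.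
have i2 : L1fun (leb \x leb)%E (fun z : R * R => (z.2 < z.1)%R%:R * (f z.1 * g z.2)).
  apply: (L1fun_le _ _ ifg); first exact: measurable_funM.
  by move=> z; rewrite normrM ler_piMl.
have -> : \int[(leb \x leb)%E]_z tensor f g z =
    \int[(leb \x leb)%E]_z ((z.1 <= z.2)%R%:R * (f z.1 * g z.2)) +
    \int[(leb \x leb)%E]_z ((z.2 < z.1)%R%:R * (f z.1 * g z.2)).
  rewrite -RintegralD//; apply: eq_Rintegral => z _.
  by rewrite /tensor ltNge; case: (_ <= _)%R; rewrite ?mul1r ?mul0r ?addr0 ?add0r.
have [_ _ ->] := Rfubini2 i1; have [_ _ ->] := Rfubini1 i2.
have cutL1 (h : R -> R) (k : R -> R) : L1fun leb h -> measurable_fun [set: R] k ->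
    (forall r, `|k r| <= 1) -> L1fun leb (fun r => k r * h r).
  move=> ih mk k1; apply: (L1fun_le _ _ ih).
    by apply: measurable_funM => //; exact: L1fun_meas ih.
  by move=> r; rewrite normrM ler_piMl.
have mi1 (s : R) : measurable_fun [set: R] (fun r : R => (r <= s)%R%:R : R).
  have -> : (fun r : R => (r <= s)%R%:R : R) = \1_(`]-oo, s] : set R).
    by apply/funext => z; rewrite /= indicE; congr ((nat_of_bool _)%:R); apply/idP/idP; rewrite inE/= in_itv.
  exact: measurable_indic.
have mi2 (s : R) : measurable_fun [set: R] (fun r : R => (r < s)%R%:R : R).
  have -> : (fun r : R => (r < s)%R%:R : R) = \1_(`]-oo, s[ : set R).
    by apply/funext => z; rewrite /= indicE; congr ((nat_of_bool _)%:R); apply/idP/idP; rewrite inE/= in_itv.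
  exact: measurable_indic.
congr (_ + _).
  apply: eq_Rintegral => s _; rewrite mulrC -RintegralZl//; last exact: cutL1.
  by apply: eq_Rintegral => r _ /=; ring.
apply: eq_Rintegral => r _ /=; rewrite mulrC -RintegralZl//; last exact: cutL1.
apply: ae_eq_Rint.
- have -> : (fun w : R => (w < r)%R%:R * (f r * g w)) = (fun w => f r * ((w < r)%R%:R * g w)).
    by apply/funext => w; ring.
  by apply: measurable_funM => //; apply/L1fun_meas/cutL1.
- by apply: measurable_funM => //; apply/L1fun_meas/cutL1.
(* The half s < r appears as s <= r in the statement; for fixed r they differ at the single point s
   = r. *)
exists [set r]; split => //; first exact: lebesgue_measure_set1.
move=> s /= H; apply: contrapT => sr; apply: H.
rewrite lt_neqAle; have -> /= : s != r by apply/eqP.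
by ring.
Qed.
End ibp.

Section prim.
Context (R : realType) d (T : measurableType d) (P : probability T R).
Local Notation leb := (@lebesgue_measure R).
Local Notation nu := (nu P).
Implicit Types f g : R -> T -> R.

Definition prim f (s : R) : T -> R := fun w => \int[leb]_(r in `[0, s]) f r w.

Lemma sqi_slice (h : R * T -> R) : sqi nu h ->
  {ae P, forall w, sqi leb (fun r => h (r, w))}.
Proof.
move=> [mh ih]; have [H _ _] := Rfubini2 ih.
apply: filterS H => w iw; split=> //.
by apply: measurableT_comp mh _; exact: pair2_measurable.
Qed.

Lemma sqi_indic_cc (a b : R) : sqi leb (\1_(`[a, b] : set R)).
Proof.
split; first exact: measurable_indic.
rewrite (_ : _ \* _ = \1_(`[a, b] : set R)).
  exact: (integrable_indic_itv a b true false).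
by apply/funext => x; rewrite /= indicE; case: (_ \in _); rewrite ?mulr1 ?mulr0.
Qed.

Lemma ip_indic_cc (s : R) : 0 <= s -> ip leb \1_(`[0, s] : set R) \1_(`[0, s] : set R) = s.
Proof.
move=> s0; rewrite /ip /Rintegral.
have -> : (\int[leb]_z (\1_(`[0%R, s] : set R) z * \1_(`[0%R, s] : set R) z)%:E =
    \int[leb]_z (\1_(`[0%R, s] : set R) z)%:E)%E.
  by apply: eq_integral => z _; rewrite indicE -natrM mulnb andbb.
rewrite integral_indic//= setIT lebesgue_measure_itv/= lte_fin.
by case: ltP => [_|s0']; rewrite -?EFinB/= ?subr0//; apply/eqP; rewrite eq_le s0 s0'.
Qed.

(** As an inner product with an indicator the primitive is open to Cauchy-Schwarz; the cut is at the
    horizon [t], the same for all [s]. *)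
Lemma primE t f s w : 0 <= s <= t ->
  prim f s w = ip leb \1_(`[0, s] : set R) (fun r => tcut t f (r, w)).
Proof.
move=> /andP[s0 st]; rewrite /prim Rintegral_mkcond; apply: eq_Rintegral => r _.
rewrite patchE mem_cc /tcut !indicE !mem_cc /=.
case: ifP; last by rewrite mul0r.
by move=> /andP[r0 rs]; rewrite r0 (le_trans rs st) mul1r mulr1.
Qed.

Section fixed.
Variables (t : R) (f : R -> T -> R).
Hypothesis t0 : 0 <= t.
Hypothesis sf : sqi nu (tcut t f).

(** With the constraint r <= s put into the integrand, this is a partial integral of a function
    jointly measurable in (r, s, w). *)
Lemma measurable_cut_prim : measurable_fun [set: R * T] (tcut t (prim f)).
Proof.
have -> : tcut t (prim f) = fun z : R * T =>
    (\int[leb]_r ((r <= z.1)%R%:R * tcut t f (r, z.2))) * \1_(`[0, t] : set R) z.1.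
  apply/funext => -[s w]; rewrite {1}/tcut /= indicE mem_cc.
  case: (boolP (0 <= s <= t)) => st; rewrite ?mulr0// !mulr1 (@primE t)//.
  apply: eq_Rintegral => r _; rewrite indicE mem_cc; case: (leP 0 r) => r0 //=.
  by rewrite cut_out ?mulr0//= leNgt r0.
apply: measurable_funM; last by apply: measurableT_comp => //; exact: measurable_indic.
pose G (z : R * (R * T)) := (z.1 <= z.2.1)%R%:R * tcut t f (z.1, z.2.2).
apply: (@measurable_partial1 _ _ _ _ _ leb G) => //.
have m21 : measurable_fun [set: R * (R * T)] (fun z : R * (R * T) => (z.1, z.2.1)).
  by apply: measurable_fun_pair => //; exact: measurableT_comp.
have m22 : measurable_fun [set: R * (R * T)] (fun z : R * (R * T) => (z.1, z.2.2)).
  by apply: measurable_fun_pair => //; exact: measurableT_comp.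
exact: measurable_funM (measurableT_comp (@measurable_le_set R) m21)
  (measurableT_comp (sqi_meas sf) m22).
Qed.

Definition energy (w : T) : R := ip leb (fun r => tcut t f (r, w)) (fun r => tcut t f (r, w)).

Lemma L1_energy : L1fun P energy.
Proof. by case: (sf) => _ ih; have [_ + _] := Rfubini2 ih. Qed.

(** Cauchy-Schwarz on [0, s] against the constant 1. The exceptional null set depends on the slice
    of [f] alone, hence serves all [s] at once. *)
Lemma prim_bound : {ae P, forall w, forall s, 0 <= s <= t -> prim f s w ^+ 2 <= t * energy w}.
Proof.
apply: filterS (sqi_slice sf) => w sw s /andP[s0 st].
rewrite (@primE t) ?s0//; apply: le_trans (ip_CS (sqi_indic_cc 0 s) sw) _.
by rewrite ip_indic_cc// ler_wpM2r// ip_ge0.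
Qed.

Lemma measurable_prim s : 0 <= s <= t -> measurable_fun [set: T] (prim f s).
Proof.
move=> st; have -> : prim f s = (tcut t (prim f)) \o (fun w => (s, w)).
  by apply/funext => w; rewrite /tcut /= indicE mem_cc st mulr1.
apply: (measurableT_comp measurable_cut_prim); exact: pair1_measurable.
Qed.

Lemma sqi_prim s : 0 <= s <= t -> sqi P (prim f s).
Proof.
move=> st; have mp := measurable_prim st; split=> //.
apply/L1fun_ltoo.
- exact: measurable_funM.
- by move=> z /=; rewrite -expr2 sqr_ge0.
have e0 w : 0 <= energy w by exact: ip_ge0.
have := (L1fun_ltoo P (L1fun_meas (L1funZ t L1_energy)) _).2 (L1funZ t L1_energy).
move=> /(_ (fun w => mulr_ge0 t0 (e0 w))); apply: le_lt_trans.
apply: ae_ge0_le_integral => //.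
- by move=> z _; rewrite lee_fin /= -expr2 sqr_ge0.
- by apply/measurable_EFinP; exact: measurable_funM.
- by move=> z _; rewrite lee_fin mulr_ge0.
- by apply/measurable_EFinP/L1fun_meas/L1funZ/L1_energy.
by apply: filterS prim_bound => w H _; rewrite lee_fin /= -expr2; exact: H.
Qed.

Lemma sqi_cut_prim : sqi nu (tcut t (prim f)).
Proof.
apply/sqiP; first exact: measurable_cut_prim.
rewrite (@iterated_sq _ _ _ _ t); last 2 first.
- exact: measurable_cut_prim.
- by move=> s w st; rewrite cut_out.
have e0 w : 0 <= energy w by exact: ip_ge0.
have := (L1fun_ltoo P (L1fun_meas (L1funZ (t * t) L1_energy)) _).2 (L1funZ (t * t) L1_energy).
move=> /(_ (fun w => mulr_ge0 (mulr_ge0 t0 t0) (e0 w))); apply: le_lt_trans.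
apply: ae_ge0_le_integral => //.
- by move=> z _; apply: integral_ge0 => s _; rewrite lee_fin sqr_ge0.
- under eq_fun do rewrite integral_mkcond.
  pose H (z : R * T) := (((fun s : R => (tcut t (prim f) (s, z.2) ^+ 2)%:E) \_ `[0, t]) z.1).
  apply: (@measurable_fun_fubini_tonelli_G _ _ _ _ _ leb H).
    have -> : H = EFin \o (fun z => tcut t (prim f) z ^+ 2).
      apply/funext => -[s w]; rewrite /H patchE mem_cc /=; case: ifPn => // st.
      by rewrite cut_out// expr0n.
    have mq : measurable_fun [set: R * T] (fun z => tcut t (prim f) z ^+ 2).
      by apply: measurable_funX; exact: measurable_cut_prim.
    exact/measurable_EFinP.
  by move=> z; rewrite /H patchE; case: ifP => // _; rewrite lee_fin sqr_ge0.
- by move=> z _; rewrite lee_fin mulr_ge0// mulr_ge0.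
- by apply/measurable_EFinP/L1fun_meas/L1funZ/L1_energy.
apply: filterS prim_bound => w H _.
apply: (@le_trans _ _ (\int[leb]_(s in `[0%R, t]) cst (t * energy w)%:E s)%E).
  apply: ge0_le_integral => //.
  - by move=> s _; rewrite lee_fin sqr_ge0.
  - apply/measurable_EFinP/measurable_funX.
    apply: measurable_funTS; apply: (measurableT_comp measurable_cut_prim).
    exact: pair2_measurable.
  - move=> s; rewrite /= in_itv/= => st; rewrite lee_fin /tcut /= indicE mem_cc st mulr1.
    exact: H.
rewrite integral_cst//= lebesgue_measure_itv/= lte_fin.
case: ltP => [_|tle0].
  by rewrite -EFinB -EFinM lee_fin subr0 mulrC mulrA.
by rewrite mule0 lee_fin; apply: mulr_ge0 => //; exact: mulr_ge0.
Qed.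

Lemma ip_prim Z : sqi P Z ->
  ip P Z (prim f t) = ip nu (tensor \1_(`[0, t] : set R) Z) (tcut t f).
Proof.
move=> sZ; have sT := sqi_tensor (sqi_indic_cc 0 t) sZ.
have iT := sqiM sT sf; have [_ _] := Rfubini2 iT; rewrite /ip => ->.
have tt : 0 <= t <= t by rewrite t0 lexx.
apply: ae_eq_Rint.
- apply: measurable_funM; first exact: sqi_meas sZ.
  exact: measurable_prim.
- by apply: measurable_partial1; exact: L1fun_meas iT.
apply: filterS (sqi_slice sf) => w sw.
rewrite (@primE t)// -RintegralZl//; last exact: sqiM (sqi_indic_cc 0 t) sw.
by apply: eq_Rintegral => r _; rewrite /tensor /=; ring.
Qed.
End fixed.

(** [primitive_product] on almost every path, integrated over the paths. *)
Lemma ip_prim_prim t f g : 0 <= t -> sqi nu (tcut t f) -> sqi nu (tcut t g) ->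
  ip P (prim f t) (prim g t) =
    ip nu (tcut t (prim f)) (tcut t g) + ip nu (tcut t (prim g)) (tcut t f).
Proof.
move=> t0 sf sg; have tt : 0 <= t <= t by rewrite t0 lexx.
have i1 := sqiM (sqi_cut_prim t0 sf) sg; have i2 := sqiM (sqi_cut_prim t0 sg) sf.
have [_ j1 e1] := Rfubini2 i1; have [_ j2 e2] := Rfubini2 i2.
have -> : ip nu (tcut t (prim f)) (tcut t g) =
  \int[P]_w \int[leb]_s (tcut t (prim f) (s, w) * tcut t g (s, w)) by exact: e1.
have -> : ip nu (tcut t (prim g)) (tcut t f) =
  \int[P]_w \int[leb]_s (tcut t (prim g) (s, w) * tcut t f (s, w)) by exact: e2.
rewrite -(RintegralD measurableT j1 j2).
apply: ae_eq_Rint.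
- by apply: measurable_funM; exact: (measurable_prim (t := t)).
- exact: measurable_funD (L1fun_meas j1) (L1fun_meas j2).
apply: filterS2 (sqi_slice sf) (sqi_slice sg) => w sfw sgw.
have L1c h : sqi leb (fun r => tcut t h (r, w)) -> L1fun leb (fun r => tcut t h (r, w)).
  move=> sh; have := sqiM (sqi_indic_cc 0 t) sh; congr (L1fun _ _).
  apply/funext => r; rewrite /= /tcut /= indicE; case: (_ \in _); rewrite ?mulr0// !mulr1 mul1r//.
have primT h : prim h t w = \int[leb]_r tcut t h (r, w).
  rewrite (@primE t)//; apply: eq_Rintegral => r _; rewrite /tcut /= indicE.
  by case: (_ \in _); rewrite ?mulr0// !mulr1 mul1r.
have primS h s : 0 <= s <= t -> \int[leb]_r ((r <= s)%R%:R * tcut t h (r, w)) = prim h s w.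
  move=> st; rewrite (@primE t)//; apply: eq_Rintegral => r _; rewrite indicE mem_cc.
  case: (leP 0 r) => r0 //=.
  by rewrite cut_out ?mulr0//= leNgt r0.
rewrite !primT (primitive_product (L1c _ sfw) (L1c _ sgw)).
have H h k : \int[leb]_s ((\int[leb]_r ((r <= s)%R%:R * tcut t h (r, w))) * tcut t k (s, w)) =
    \int[leb]_s (tcut t (prim h) (s, w) * tcut t k (s, w)).
  apply: eq_Rintegral => s _; case: (boolP (0 <= s <= t)) => st; last by rewrite !(cut_out _ _ st) !mulr0.
  by rewrite primS// {2}/tcut /= indicE mem_cc st mulr1.
by rewrite !H.
Qed.
End prim.

Section product_rule.
Context (R : realType) d (T : measurableType d) (P : probability T R).
Context (F : R -> set (set T)) (q : nat) (K : 'M[R]_q) (W : R -> T -> 'cV[R]_q).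
Hypothesis hF : right_continuous_complete_filtration P F.
Hypothesis hW : wiener_process P F K W.
Local Notation leb := (@lebesgue_measure R).
Local Notation nu := (nu P).
Local Notation ito i v t I := (is_ito_integral P F (fun s w => W s w i 0) v t I).

(** One coordinate of a solution with abstract coefficients, dx = f dt + \sum_i g_i dW_i.
    Adaptedness of [f] is what lets [ip_mart_prim] test a martingale against the drift. *)
Record ito_process (t x0 : R) (f : R -> T -> R) (g : 'I_q -> R -> T -> R) (x : R -> T -> R)
    : Prop := ItoProcess {
  itop_x : sqi nu (tcut t x) ;
  itop_f : sqi nu (tcut t f) ;
  itop_g : forall i, sqi nu (tcut t (g i)) ;
  itop_fad : forall s, 0 <= s <= t -> measurable_at F s (f s) ;
  itop_xm : forall s, 0 <= s <= t -> measurable_fun [set: T] (x s) ;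
  itop_eq : forall s, 0 <= s <= t -> exists J : 'I_q -> T -> R,
    (forall i, ito i (g i) s (J i)) /\
    {ae P, forall w, x s w = x0 + prim f s w + \sum_i J i w} }.

Lemma sqi_le d' (T' : measurableType d') (mu : {measure set T' -> \bar R}) (g h : T' -> R) :
  measurable_fun [set: T'] g -> sqi mu h -> (forall z, `|g z| <= `|h z|) -> sqi mu g.
Proof.
move=> mg sh gh; split=> //; apply: L1fun_le sh.2; first exact: measurable_funM.
by move=> z /=; rewrite !normrM ler_pM.
Qed.

Lemma sqi_tcut_le s t (v : R -> T -> R) : 0 <= s <= t -> sqi nu (tcut t v) -> sqi nu (tcut s v).
Proof.
move=> /andP[s0 st] sv.
have E z : tcut s v z = tcut t v z * \1_(`[0, s] : set R) z.1.
  rewrite /tcut -mulrA !indicE !mem_cc -natrM mulnb; congr (_ * (nat_of_bool _)%:R).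
  case: (boolP (0 <= z.1 <= s)); last by rewrite andbF.
  by move=> /andP[z0 zs]; rewrite z0 (le_trans zs st).
have m1 : measurable_fun [set: R * T] (fun z : R * T => (\1_(`[0, s] : set R) z.1 : R)).
  by apply: measurableT_comp => //; exact: measurable_indic.
apply: (sqi_le _ sv) => [|z]; last first.
  by rewrite E normrM ler_piMr// indicE; case: (_ \in _); rewrite ?normr1 ?normr0.
by rewrite (_ : tcut s v = tcut t v \* (fun z => \1_(`[0, s] : set R) z.1));
  [exact: measurable_funM (sqi_meas sv) m1 | apply/funext => z; rewrite E].
Qed.

(** By the isometry, since [0, 0] is a null set. With [ito_martingale] from time 0 it shows that Ito
    integrals have mean zero. *)
Lemma ito0 i v I : ito i v 0 I -> sqi nu (tcut 0 v) -> ip P I I = 0.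
Proof.
move=> iI sv; rewrite (ito_isometry hF hW iI iI sv sv).
suff -> : ip nu (tcut 0 v) (tcut 0 v) = 0 by rewrite mulr0.
have [_ _] := Rfubini2 (sqiM sv sv); rewrite /ip => ->.
have zero d' (T' : measurableType d') (mu : {measure set T' -> \bar R}) :
    \int[mu]_s (cst 0 s : R) = 0 by rewrite /Rintegral integral0.
rewrite -[RHS](zero _ _ P); apply: eq_Rintegral => w _.
rewrite -[RHS](zero _ _ leb); apply: ae_eq_Rint => //.
  apply: (measurableT_comp (L1fun_meas (sqiM sv sv))).
  exact: pair2_measurable.
exists [set 0]; split => //; first exact: lebesgue_measure_set1.
move=> s /= H; apply: contrapT => s0; apply: H.
rewrite cut_out ?mul0r//; apply/negP => /andP[? ?]; apply: s0.
by apply/eqP; rewrite eq_le; apply/andP.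
Qed.

Section one.
Variables (t x0 : R) (f : R -> T -> R) (g : 'I_q -> R -> T -> R) (x : R -> T -> R).
Hypothesis t0 : 0 <= t.
Hypothesis X : ito_process t x0 f g x.

(** Almost surely x0 plus the stochastic integrals; as a difference it makes x = martingale +
    primitive an identity of functions. *)
Definition mart s : T -> R := x s - prim f s.

Lemma sqi_ito_process s : 0 <= s <= t -> sqi P (x s) /\ sqi P (mart s).
Proof.
move=> st; have [J [iJ xE]] := itop_eq X st.
have sJ i : sqi P (J i) by have [] := ito_cvg hF hW (iJ i) (sqi_tcut_le st (itop_g X i)).
have sp := sqi_prim t0 (itop_f X) st.
have sR : sqi P ((fun=> x0) + prim f s + \sum_i J i).
  by apply: sqiD; [apply: sqiD => //; exact: sqi_cst|exact: sqi_sum].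
have sx : sqi P (x s).
  split; first exact: (itop_xm X).
  apply/L1fun_ltoo; first by apply: measurable_funM; exact: (itop_xm X).
    by move=> z /=; rewrite -expr2 sqr_ge0.
  rewrite (@ae_eq_integral _ _ _ P setT (fun w => (((fun=> x0) + prim f s + \sum_i J i) w ^+ 2)%:E))//.
  - by apply/sqiP => //; exact: sqi_meas sR.
  - by apply/measurable_EFinP/measurable_funM; exact: (itop_xm X).
  - by apply/measurable_EFinP/measurable_funX; exact: sqi_meas sR.
  - apply: filterS xE => w xw _ /=; congr EFin; rewrite xw !fun_ringE fct_sumE expr2//.
by split=> //; exact: sqiB.
Qed.

Lemma mart_tower s Z : 0 <= s <= t -> ad P F s Z -> ip P (mart t) Z = ip P (mart s) Z.
Proof.
move=> st aZ; have /andP[s0 st'] := st; have tt : 0 <= t <= t by rewrite t0 lexx.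
have sZ := ad_sqi aZ.
have key r : 0 <= r <= t -> forall J, (forall i, ito i (g i) r (J i)) ->
   {ae P, forall w, x r w = x0 + prim f r w + \sum_i J i w} ->
   ip P (mart r) Z = ip P (fun=> x0) Z + \sum_i ip P (J i) Z.
  move=> rt J iJ xE.
  have sJ i : sqi P (J i) by have [] := ito_cvg hF hW (iJ i) (sqi_tcut_le rt (itop_g X i)).
  have sS : sqi P (\sum_i J i) by exact: sqi_sum.
  have [_ sm] := sqi_ito_process rt.
  rewrite -ip_suml// -ipDl//; last exact: sqi_cst.
  apply: ip_ae => //; first by apply: sqiD => //; exact: sqi_cst.
  apply: filterS xE => w xw; rewrite /mart !fun_ringE fct_sumE xw; ring.
have [J [iJ xE]] := itop_eq X tt; have [J' [iJ' xE']] := itop_eq X st.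
rewrite (key t tt J iJ xE) (key s st J' iJ' xE'); congr (_ + _).
apply: eq_bigr => i _; exact: (ito_martingale hF hW s0 st' (iJ i) (iJ' i) (itop_g X i)).
Qed.

Lemma sqi_cut_mart : sqi nu (tcut t mart).
Proof.
have -> : tcut t mart = tcut t x - tcut t (prim f).
  by apply/funext => z; rewrite !fun_ringE /tcut /mart !fun_ringE mulrBl.
by apply: sqiB; [exact: itop_x X|exact: sqi_cut_prim t0 (itop_f X)].
Qed.
End one.

(** Fubini turns the left side into the time integral of E[M(t) f'(s)]. For almost every s in [0, t]
    the variable f'(s) is in L^2(F_s), so M(t) may be replaced by M(s). *)
Lemma ip_mart_prim t x0 f g x y0 f' g' y : 0 <= t ->
  ito_process t x0 f g x -> ito_process t y0 f' g' y ->
  ip P (mart f x t) (prim f' t) = ip nu (tcut t (mart f x)) (tcut t f').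
Proof.
move=> t0 X Y; have tt : 0 <= t <= t by rewrite t0 lexx.
have sf' := itop_f Y; have [_ sM] := sqi_ito_process t0 X tt.
rewrite ip_prim//.
have sT := sqi_tensor (sqi_indic_cc 0 t) sM.
have sC := sqi_cut_mart t0 X.
have [a1 i1 e1] := Rfubini1 (sqiM sT sf'); have [_ i2 e2] := Rfubini1 (sqiM sC sf').
have [a3 _ _] := Rfubini1 (sqiM sf' sf').
rewrite [LHS]e1 [RHS]e2; apply: ae_eq_Rint; [exact: L1fun_meas i1|exact: L1fun_meas i2|].
apply: filterS a3 => s is'.
case: (boolP (0 <= s <= t)) => st; last by apply: eq_Rintegral => w _ /=; rewrite !(cut_out _ _ st) !mulr0.
have fE w : tcut t f' (s, w) = f' s w by rewrite /tcut /= indicE mem_cc st mulr1.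
have af : ad P F s (f' s).
  have mf := itop_fad Y st; split=> //; split.
    by apply: (measurable_at_meas hF _ mf); case/andP : st.
  move: is'; congr (L1fun _ _); apply/funext => w /=; by rewrite fE.
transitivity (ip P (mart f x t) (f' s)).
  by apply: eq_Rintegral => w _; rewrite /tensor /= fE indicE mem_cc st mul1r.
rewrite (mart_tower t0 X st af).
by apply: eq_Rintegral => w _; rewrite /= fE /tcut /= indicE mem_cc st mulr1.
Qed.

(** The isometry gives the double sum; constants are orthogonal to stochastic integrals, which have
    mean zero. *)
Lemma ip_mart_mart t x0 f g x y0 f' g' y : 0 <= t ->
  ito_process t x0 f g x -> ito_process t y0 f' g' y ->
  ip P (mart f x t) (mart f' y t) =
    x0 * y0 + \sum_i \sum_j K i j * ip nu (tcut t (g i)) (tcut t (g' j)).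
Proof.
move=> t0 X Y; have tt : 0 <= t <= t by rewrite t0 lexx.
have z0 : (0 : R) <= 0 <= t by rewrite lexx.
have mean0 v i I c : ito i v t I -> sqi nu (tcut t v) -> (exists I0, ito i v 0 I0) ->
    ip P I (fun=> c) = 0.
  move=> iI sv [I0 iI0].
  rewrite (ito_martingale hF hW (lexx 0) t0 iI iI0 sv); last exact: (ad_cst hF).
  have sI0 : sqi P I0 by have [] := ito_cvg hF hW iI0 (sqi_tcut_le z0 sv).
  have sc := sqi_cst P c.
  have := ip_CS sI0 sc; rewrite (ito0 iI0 (sqi_tcut_le z0 sv)) mul0r => H.
  by apply/eqP; rewrite -sqrf_eq0 eq_le H sqr_ge0.
have decomp x0' f0 g0 xx : ito_process t x0' f0 g0 xx -> exists J, [/\ forall i, ito i (g0 i) t (J i),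
    forall i, sqi P (J i), forall i c, ip P (J i) (fun=> c) = 0 &
    {ae P, forall w, mart f0 xx t w = ((fun=> x0') + \sum_i J i) w}].
  move=> Z; have [J [iJ xE]] := itop_eq Z tt; have [J0 [iJ0 _]] := itop_eq Z z0.
  exists J; split=> //.
  - by move=> i; have [] := ito_cvg hF hW (iJ i) (itop_g Z i).
  - by move=> i c; apply: (mean0 _ _ _ _ (iJ i) (itop_g Z i)); exists (J0 i).
  - by apply: filterS xE => w xw; rewrite /mart !fun_ringE fct_sumE xw; ring.
have [J [iJ sJ mJ xE]] := decomp _ _ _ _ X.
have [J' [iJ' sJ' mJ' yE]] := decomp _ _ _ _ Y.
have [_ sM] := sqi_ito_process t0 X tt; have [_ sM'] := sqi_ito_process t0 Y tt.
have sS : sqi P (\sum_i J i) by exact: sqi_sum.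
have sS' : sqi P (\sum_i J' i) by exact: sqi_sum.
have c1 := sqi_cst P x0; have c2 := sqi_cst P y0.
rewrite (ip_ae sM (sqiD c1 sS) sM' xE) ipC (ip_ae sM' (sqiD c2 sS') (sqiD c1 sS) yE) ipC.
rewrite (ipDl c1 sS (sqiD c2 sS')) (ipDr c2 sS' c1) (ipDr c2 sS' sS).
have -> : ip P (fun=> x0) (fun=> y0) = x0 * y0.
  rewrite /ip (_ : (fun z => _) = cst (x0 * y0))//.
  by rewrite Rintegral_cst//= probability_setT mulr1.
have -> : ip P (fun=> x0) (\sum_i J' i) = 0.
  by rewrite ipC ip_suml// big1.
have -> : ip P (\sum_i J i) (fun=> y0) = 0 by rewrite ip_suml// big1.
rewrite addr0 add0r; congr (_ + _); rewrite ip_suml//; apply: eq_bigr => i _.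
rewrite ip_sumr//; apply: eq_bigr => j _.
exact: (ito_isometry hF hW (iJ i) (iJ' j) (itop_g X i) (itop_g Y j)).
Qed.

(** Both processes are expanded into martingale and primitive. The mixed terms and the two halves of
    [ip_prim_prim] regroup, because martingale plus primitive is the process again. *)
Lemma product_rule t x0 f g x y0 f' g' y : 0 <= t ->
  ito_process t x0 f g x -> ito_process t y0 f' g' y ->
  ip P (x t) (y t) = x0 * y0 + ip nu (tcut t x) (tcut t f') + ip nu (tcut t f) (tcut t y)
    + \sum_i \sum_j K i j * ip nu (tcut t (g i)) (tcut t (g' j)).
Proof.
move=> t0 X Y; have tt : 0 <= t <= t by rewrite t0 lexx.
have [sx sM] := sqi_ito_process t0 X tt; have [sy sM'] := sqi_ito_process t0 Y tt.
have sf := itop_f X; have sf' := itop_f Y.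
have sp := sqi_prim t0 sf tt; have sp' := sqi_prim t0 sf' tt.
have -> : x t = mart f x t + prim f t by rewrite /mart subrK.
have -> : y t = mart f' y t + prim f' t by rewrite /mart subrK.
rewrite (ipDl sM sp (sqiD sM' sp')) (ipDr sM' sp' sM) (ipDr sM' sp' sp).
rewrite (ip_mart_mart t0 X Y) (ip_mart_prim t0 X Y) [ip P (prim f t) (mart f' y t)]ipC (ip_mart_prim t0 Y X).
rewrite ip_prim_prim//.
have sm := sqi_cut_mart t0 X; have sm' := sqi_cut_mart t0 Y.
have sq := sqi_cut_prim t0 sf; have sq' := sqi_cut_prim t0 sf'.
have tE h z : tcut t z = tcut t (mart h z) + tcut t (prim h).
  by apply/funext => v; rewrite !fun_ringE /tcut /mart !fun_ringE; ring.
rewrite [in RHS](tE f x) [in RHS](tE f' y).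
rewrite [ip nu (tcut t f) _]ipC (ipDl sm sq sf') (ipDl sm' sq' sf).
ring.
Qed.
End product_rule.

(** * Quadratic forms and the Lyapunov operator *)

Section quadratic.
Context (R : realType).

Definition qf n (M : 'M[R]_n) (v : 'cV[R]_n) : R := (v^T *m M *m v) 0 0.

Section n.
Variable n : nat.
Implicit Types (M : 'M[R]_n) (v : 'cV[R]_n).

Lemma qfE M v : qf M v = \sum_i \sum_j M i j * (v i 0 * v j 0).
Proof.
rewrite /qf mxE exchange_big /=; apply: eq_bigr => j _.
rewrite mxE mulr_suml; apply: eq_bigr => i _; rewrite !mxE; ring.
Qed.

Lemma qfD M M' v : qf (M + M') v = qf M v + qf M' v.
Proof. by rewrite /qf mulmxDr mulmxDl mxE. Qed.

Lemma qfN M v : qf (- M) v = - qf M v.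
Proof. by rewrite /qf mulmxN mulNmx mxE. Qed.

Lemma qfB M M' v : qf (M - M') v = qf M v - qf M' v.
Proof. by rewrite qfD qfN. Qed.

Lemma qfZ c M v : qf (c *: M) v = c * qf M v.
Proof. by rewrite /qf -scalemxAr -scalemxAl mxE. Qed.

Lemma qf0 v : qf 0 v = 0.
Proof. by rewrite /qf mulmx0 mul0mx mxE. Qed.

Lemma qf_sum I (r : seq I) (Q : pred I) (M : I -> 'M[R]_n) v :
  qf (\sum_(i <- r | Q i) M i) v = \sum_(i <- r | Q i) qf (M i) v.
Proof. by apply: (big_morph (fun M => qf M v)) => [? ?|]; rewrite ?qfD ?qf0. Qed.

Lemma qfT M v : qf M^T v = qf M v.
Proof.
by rewrite !qfE exchange_big; apply: eq_bigr => i _; apply: eq_bigr => j _;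
  rewrite mxE [v j 0 * _]mulrC.
Qed.

Lemma sqnorm2E v : sqnorm2 v = (v^T *m v) 0 0.
Proof. by rewrite mxE; apply: eq_bigr => i _; rewrite mxE expr2. Qed.

Lemma qf1 v : qf 1%:M v = sqnorm2 v.
Proof. by rewrite /qf mulmx1 sqnorm2E. Qed.

Lemma sqnorm2_ge0 v : 0 <= sqnorm2 v.
Proof. by apply: sumr_ge0 => i _; exact: sqr_ge0. Qed.

Lemma sqnorm2_gt0 v : v != 0 -> 0 < sqnorm2 v.
Proof.
move=> v0; rewrite lt_neqAle sqnorm2_ge0 andbT eq_sym; apply: contra v0 => /eqP H.
apply/eqP/matrixP => i j; rewrite ord1 mxE.
have : v i 0 ^+ 2 = 0 by apply: (psumr_eq0P _ H) => // k _; exact: sqr_ge0.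
by move/eqP; rewrite sqrf_eq0 => /eqP.
Qed.

Lemma qf_bound M : exists2 c : R, 0 <= c & forall v, `|qf M v| <= c * sqnorm2 v.
Proof.
exists (\sum_i \sum_j `|M i j|).
  by apply: sumr_ge0 => i _; apply: sumr_ge0 => j _.
move=> v; rewrite qfE mulr_suml; apply: (le_trans (ler_norm_sum _ _ _)).
apply: ler_sum => i _; rewrite mulr_suml; apply: (le_trans (ler_norm_sum _ _ _)).
apply: ler_sum => j _; rewrite normrM; apply: ler_wpM2l => //.
have le1 k : v k 0 ^+ 2 <= sqnorm2 v.
  by rewrite /sqnorm2 (bigD1 k)//= lerDl; apply: sumr_ge0 => l _; exact: sqr_ge0.
have := le1 i; have := le1 j; rewrite ler_norml.
have := sqr_ge0 (v i 0 + v j 0); have := sqr_ge0 (v i 0 - v j 0).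
by rewrite !sqrrD sqrrN => *; apply/andP; split; lra.
Qed.

End n.

Lemma qf_mul n k (L : 'M[R]_(k, n)) (M : 'M[R]_k) (v : 'cV[R]_n) : qf (L^T *m M *m L) v = qf M (L *m v).
Proof. by rewrite /qf trmx_mul !mulmxA. Qed.

Lemma qf_gram n k (L : 'M[R]_(k, n)) (v : 'cV[R]_n) : qf (L^T *m L) v = sqnorm2 (L *m v).
Proof. by have := qf_mul L 1%:M v; rewrite mulmx1 qf1. Qed.

Section posdef.
Variable n : nat.
Implicit Types (M : 'M[R]_n) (v : 'cV[R]_n).

Lemma posdef_unit M : posdefmx M -> M \in unitmx.
Proof.
move=> [MT Mp]; rewrite -row_free_unit -kermx_eq0; apply/eqP/row_matrixP => i.
rewrite row0; apply/eqP; apply: contraT => k0.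
have /Mp : (row i (kermx M))^T != 0 by rewrite -(inj_eq trmx_inj) trmxK trmx0.
rewrite trmxK; have -> : row i (kermx M) *m M = 0.
  by apply/sub_kermxP; exact: row_sub.
by rewrite mul0mx mxE ltxx.
Qed.

Lemma posdef_inv M : posdefmx M -> posdefmx (invmx M).
Proof.
move=> pM; have uM := posdef_unit pM; case: pM => MT Mp; split.
  by rewrite trmx_inv MT.
move=> v v0; have w0 : invmx M *m v != 0.
  by apply: contra v0 => /eqP E; rewrite -[v]mul1mx -(mulmxV uM) -mulmxA E mulmx0.
have := Mp _ w0; rewrite trmx_mul trmx_inv MT.
by rewrite -(mulmxA _ _ M) mulVmx// mulmx1 mulmxA.
Qed.

Lemma qf_ge0 M v : posdefmx M -> 0 <= qf M v.
Proof.
move=> [_ Mp]; have [->|v0] := eqVneq v 0; first by rewrite /qf mulmx0 mxE.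
exact/ltW/Mp.
Qed.

Lemma qf_line M v w (c : R) : M^T = M ->
  qf M (v + c *: w) = qf M v + 2 * c * (v^T *m M *m w) 0 0 + c ^+ 2 * qf M w.
Proof.
move=> MT; rewrite /qf [(v + _)^T]linearD /= [(c *: w)^T]linearZ /= !(mulmxDl, mulmxDr).
rewrite -!scalemxAl -!scalemxAr.
have -> : w^T *m M *m v = v^T *m M *m w.
  apply/matrixP => i j; rewrite !ord1 -[in LHS](trmxK (w^T *m M *m v)) [LHS]mxE.
  by rewrite !trmx_mul trmxK MT mulmxA.
move: (v^T *m M *m v) (v^T *m M *m w) (w^T *m M *m w) => a b e.
by rewrite !mxE; ring.
Qed.

(** A spectral gap without eigenvalues: with w = M^-1 v, the form at v - d w is qf M v - 2 d |v|^2 +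
    d^2 qf (M^-1) v >= 0, and the last term is at most d |v|^2 once 1/d exceeds a bound of M^-1. *)
Lemma posdef_lower M : posdefmx M ->
  exists2 delta : R, 0 < delta & forall v, delta * sqnorm2 v <= qf M v.
Proof.
move=> pM; have uM := posdef_unit pM; have [MT Mp] := pM.
have [c c0 cb] := qf_bound (invmx M).
have c1 : 0 < c + 1 by rewrite ltr_wpDl.
exists (c + 1)^-1; first by rewrite invr_gt0.
move=> v; set w := invmx M *m v.
have Mw : M *m w = v by rewrite mulmxA mulmxV// mul1mx.
have qw : qf M w = qf (invmx M) v.
  rewrite /qf /w trmx_mul trmx_inv MT -(mulmxA _ _ M) mulVmx// mulmx1 mulmxA//.
have := qf_ge0 (v + - (c + 1)^-1 *: w) pM; rewrite (qf_line _ _ _ MT).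
have -> : (v^T *m M *m w) 0 0 = sqnorm2 v by rewrite -mulmxA Mw sqnorm2E.
have : qf (invmx M) v <= (c + 1) * sqnorm2 v.
  have := cb v; rewrite ler_norml => /andP[_ H]; apply: (le_trans H).
  by rewrite ler_wpM2r ?sqnorm2_ge0// lerDl.
rewrite qw sqrrN; set d := (c + 1)^-1 => H1 H2.
have d0 : 0 < d by rewrite invr_gt0.
have H3 : d ^+ 2 * qf (invmx M) v <= d * sqnorm2 v.
  rewrite expr2 -mulrA ler_pM2l// -(ler_pM2l c1) mulrA mulfV ?mul1r// gt_eqF//.
lra.
Qed.
End posdef.

(** * From second moments to the Riccati inequality *)

Section riccati.
Variables (n m p q : nat) (K : 'M[R]_q) (A : 'M[R]_n) (N : 'I_q -> 'M[R]_n)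
  (B : 'M[R]_(n, m)) (C : 'M[R]_(p, n)).
Hypothesis Ksym : forall i j, K i j = K j i.

(** Also the generator of second moments: along dx = A^T x dt + \sum_i N_i^T x dW_i the matrix E x
    x^T has derivative [lyap] (E x x^T). *)
Definition lyap (X : 'M[R]_n) : 'M[R]_n :=
  A^T *m X + X *m A + \sum_(i < q) \sum_(j < q) K i j *: ((N i)^T *m X *m N j).

Lemma lyapD X Y : lyap (X + Y) = lyap X + lyap Y.
Proof.
rewrite /lyap mulmxDr mulmxDl.
have -> : \sum_(i < q) \sum_(j < q) K i j *: ((N i)^T *m (X + Y) *m N j) =
  \sum_(i < q) \sum_(j < q) K i j *: ((N i)^T *m X *m N j) +
  \sum_(i < q) \sum_(j < q) K i j *: ((N i)^T *m Y *m N j).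
  rewrite -big_split /=; apply: eq_bigr => i _; rewrite -big_split /=; apply: eq_bigr => j _.
  by rewrite mulmxDr mulmxDl scalerDr.
have gen (V : zmodType) (a b c e f g : V) : a + b + (c + e) + (f + g) = a + c + f + (b + e + g).
  rewrite [a + b + _]addrACA.
  exact: addrACA.
exact: gen.
Qed.

Lemma lyapZ c X : lyap (c *: X) = c *: lyap X.
Proof.
rewrite /lyap !scalerDr -!scalemxAr -!scalemxAl; congr (_ + _).
rewrite scaler_sumr; apply: eq_bigr => i _; rewrite scaler_sumr; apply: eq_bigr => j _.
by rewrite -scalemxAr -scalemxAl !scalerA mulrC.
Qed.

Lemma lyap0 : lyap 0 = 0.
Proof. by have := lyapZ 0 0; rewrite !scale0r. Qed.

Lemma lyap_tr X : X^T = X -> (lyap X)^T = lyap X.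
Proof.
move=> XT; rewrite /lyap !linearD /= !trmx_mul trmxK XT [_ *m A + _]addrC; congr (_ + _).
rewrite linear_sum /= [RHS]exchange_big; apply: eq_bigr => i _.
rewrite linear_sum; apply: eq_bigr => j _ /=.
by rewrite linearZ /= !trmx_mul trmxK XT mulmxA Ksym.
Qed.

Lemma riccati_of_moment (X : 'M[R]_n) (Y : 'M[R]_(n, p)) :
  X^T = X -> (forall v, 0 <= qf X v) ->
  (forall v, qf (1%:M + lyap X + Y *m C + (Y *m C)^T) v <= 2^-1 * sqnorm2 v) ->
  exists P : 'M[R]_n, posdefmx P /\
     negdefmx (A^T *m invmx P + invmx P *m A
       + \sum_(i < q) \sum_(j < q) K i j *: ((N i)^T *m invmx P *m N j)
       - C^T *m C
       + invmx P *m B *m B^T *m invmx P).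
Proof.
move=> XT X0 H.
have [c1 c10 b1] := qf_bound (lyap 1%:M).
have [c2 c20 b2] := qf_bound (Y *m Y^T).
(* Adding eta makes the candidate definite; the change in [lyap] costs at most |v|^2 / 4. *)
pose eta := (4 * (c1 + 1))^-1.
have eta0 : 0 < eta by rewrite invr_gt0 mulr_gt0// ltr_wpDl.
pose X' := X + eta *: 1%:M.
have [c3 c30 b3] := qf_bound (X' *m B *m B^T *m X').
(* Weight in Young's inequality for the term with Y C: the part with [Y] costs at most |v|^2 / 8,
   and g |C v|^2 is left to - C^T C. *)
pose g := 8 * (c2 + 1).
have g0 : 0 < g by rewrite mulr_gt0// ltr_wpDl.
(* e g <= 1 lets - C^T C absorb e g |C v|^2, and 16 e (c3 + 1) <= 1 keeps the quadratic term below e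
   |v|^2 / 16. *)
pose e := (g + 16 * (c3 + 1))^-1.
have e0 : 0 < e by rewrite invr_gt0 addr_gt0// mulr_gt0// ltr_wpDl.
have eg : e * g <= 1.
  by rewrite mulrC ler_pdivrMr ?mul1r ?lerDl ?mulr_ge0 ?addr_ge0// addr_gt0// mulr_gt0// ltr_wpDl.
have e3 : e * (16 * (c3 + 1)) <= 1.
  by rewrite mulrC ler_pdivrMr ?mul1r ?lerDr ?(ltW g0)// addr_gt0// mulr_gt0// ltr_wpDl.
have XT' : X'^T = X' by rewrite /X' linearD /= XT linearZ /= trmx1.
pose Z := e *: X'.
have pZ : posdefmx Z.
  split; first by rewrite /Z linearZ /= XT'.
  move=> v v0; rewrite -/(qf Z v) /Z qfZ /X' qfD qfZ qf1 mulr_gt0// ltr_wpDl//.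
  by rewrite mulr_gt0// sqnorm2_gt0.
exists (invmx Z); split; first exact: posdef_inv.
rewrite invmxK; split.
  rewrite linearN /=; congr (- _).
  rewrite linearD /= linearB /= -/(lyap Z) lyap_tr; last by case: pZ.
  rewrite !trmx_mul !trmxK; case: pZ => -> _.
  by rewrite !mulmxA.
move=> v v0; rewrite -/(qf _ v) -/(lyap Z) qfN oppr_gt0 qfD qfB qf_gram.
have -> : Z *m B *m B^T *m Z = e ^+ 2 *: (X' *m B *m B^T *m X').
  by rewrite /Z -!scalemxAr -!scalemxAl scalerA expr2.
rewrite {1}/Z lyapZ !qfZ {1}/X' lyapD lyapZ (qfD (lyap X)) (qfZ eta).
have := H v; rewrite (qfD (_ + _)) (qfD (1%:M + lyap X)) (qfD 1%:M) qfT qf1 => Hv.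
have := b1 v; rewrite ler_norml => /andP[_ {}b1].
have := b2 v; rewrite ler_norml => /andP[_ {}b2].
have := b3 v; rewrite ler_norml => /andP[_ {}b3].
have yt : qf (Y *m Y^T) v = sqnorm2 (Y^T *m v) by rewrite -{1}[Y]trmxK qf_gram.
rewrite yt in b2.
have YC : - (2 * qf (Y *m C) v) <= g^-1 * sqnorm2 (Y^T *m v) + g * sqnorm2 (C *m v).
  have -> : qf (Y *m C) v = \sum_i (Y^T *m v) i 0 * (C *m v) i 0.
    rewrite /qf mulmxA -mulmxA mxE; apply: eq_bigr => i _; congr (_ * _).
    by rewrite -[v^T *m Y]trmxK mxE trmx_mul trmxK.
  rewrite /sqnorm2 !mulr_sumr -sumrN -big_split /=; apply: ler_sum => i _.
  set y := (Y^T *m v) i 0; set z := (C *m v) i 0.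
  have : 0 <= g^-1 * (y + g * z) ^+ 2 by rewrite mulr_ge0 ?sqr_ge0// invr_ge0 ltW.
  have -> : g^-1 * (y + g * z) ^+ 2 = g^-1 * y ^+ 2 + 2 * y * z * (g^-1 * g) + g * z ^+ 2 * (g^-1 * g) by ring.
  by rewrite mulVf ?gt_eqF//; lra.
have s0 := sqnorm2_gt0 v0; have cv0 := sqnorm2_ge0 (C *m v).
set s := sqnorm2 v in Hv b1 b2 b3 s0 *.
have k1 : eta * qf (lyap 1%:M) v <= 4^-1 * s.
  apply: (@le_trans _ _ (eta * ((c1 + 1) * s))).
    rewrite ler_pM2l//; apply: (le_trans b1); rewrite ler_wpM2r ?ltW// ltrDl//.
  rewrite mulrA ler_pM2r// /eta invfM -mulrA mulVf ?mulr1// gt_eqF// ltr_wpDl//.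
have k2 : g^-1 * sqnorm2 (Y^T *m v) <= 8^-1 * s.
  apply: (@le_trans _ _ (g^-1 * ((c2 + 1) * s))).
    rewrite ler_pM2l ?invr_gt0//; apply: (le_trans b2); rewrite ler_wpM2r ?ltW// ltrDl//.
  rewrite mulrA ler_pM2r// /g invfM -mulrA mulVf ?mulr1// gt_eqF// ltr_wpDl//.
have k3 : e ^+ 2 * qf (X' *m B *m B^T *m X') v <= e * (16^-1 * s).
  rewrite expr2 -mulrA ler_pM2l//; apply: (@le_trans _ _ (e * ((c3 + 1) * s))).
    rewrite ler_pM2l//; apply: (le_trans b3); rewrite ler_wpM2r ?ltW// ltrDl//.
  by rewrite mulrA ler_pM2r//; lra.
have k4 : e * (g * sqnorm2 (C *m v)) <= sqnorm2 (C *m v).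
  by rewrite mulrA ler_piMl.
(* Of the margin 1/2 in the hypothesis, 1/8 goes to [Y] and 1/4 to eta; the remaining 1/8 beats the
   1/16 of the quadratic term. *)
have k5 : e * (qf (lyap X) v + eta * qf (lyap 1%:M) v) <= e * (- (8^-1 * s) + g * sqnorm2 (C *m v)).
  by rewrite ler_pM2l//; lra.
have k6 : 0 < e * s by rewrite mulr_gt0.
move: k5 k3; rewrite !mulrDr => k5 k3; lra.
Qed.
End riccati.
End quadratic.

(** * Stabilizability implies the Riccati inequality *)

Section necessity.
Context (R : realType) d (T : measurableType d) (P : probability T R).
Context (F : R -> set (set T)) (q : nat) (K : 'M[R]_q) (W : R -> T -> 'cV[R]_q).
Hypothesis hF : right_continuous_complete_filtration P F.
Hypothesis hW : wiener_process P F K W.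
Local Notation leb := (@lebesgue_measure R).
Local Notation nu := (nu P).

Section sqint.
Variables (D : set R) (n : nat) (v : R -> T -> 'cV[R]_n).
Hypothesis mD : measurable D.
Hypothesis mv : forall i, measurable_fun (D `*` [set: T]) (fun z : R * T => v z.1 z.2 i 0).

Definition enorm (z : R * T) : R := sqnorm2 (v z.1 z.2) * \1_D z.1.

Lemma enorm_ge0 z : 0 <= enorm z.
Proof. by rewrite /enorm mulr_ge0// sqnorm2_ge0. Qed.

Lemma enormE z : enorm z = \sum_i ((fun z : R * T => v z.1 z.2 i 0) \_ (D `*` [set: T])) z ^+ 2.
Proof.
rewrite /enorm /sqnorm2 mulr_suml; apply: eq_bigr => i _; rewrite patchE indicE.
have -> : (z \in D `*` [set: T]) = (z.1 \in D).
  by apply/idP/idP; rewrite !inE => //= -[].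
by case: (_ \in _); rewrite ?mulr1// mulr0 expr0n.
Qed.

Lemma measurable_patch i :
  measurable_fun [set: R * T] ((fun z : R * T => v z.1 z.2 i 0) \_ (D `*` [set: T])).
Proof.
by apply/(measurable_restrictT _ _).1; [exact: measurableX|exact: mv].
Qed.

Lemma measurable_enorm : measurable_fun [set: R * T] enorm.
Proof.
have -> : enorm = \sum_i (fun z => ((fun z : R * T => v z.1 z.2 i 0) \_ (D `*` [set: T])) z ^+ 2).
  by apply/funext => z; rewrite enormE fct_sumE.
elim/big_ind: _ => [|f g mf mg|i _]; first exact: measurable_cst.
  exact: measurable_funD.
by apply: measurable_funX; exact: measurable_patch.
Qed.

Lemma enorm_iterated :
  (\int[nu]_z (enorm z)%:E = \int[P]_w \int[leb]_(s in D) (sqnorm2 (v s w))%:E)%E.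
Proof.
rewrite fubini_tonelli2.
- apply: eq_integral => w _; rewrite /fubini_G [RHS]integral_mkcond; apply: eq_integral => s _ /=.
  by rewrite /enorm patchE indicE /=; case: (_ \in _); rewrite ?mulr1 ?mulr0.
- by apply/measurable_EFinP; exact: measurable_enorm.
- by move=> z; rewrite lee_fin enorm_ge0.
Qed.

Hypothesis sv : square_integrable_on P F D v.

Lemma L1_enorm : L1fun nu enorm.
Proof.
apply/L1fun_ltoo; [exact: measurable_enorm|exact: enorm_ge0|].
by rewrite enorm_iterated; exact: (sqint_finite sv).
Qed.

Lemma sqi_tcut_comp t i : `[0, t]%classic `<=` D ->
  sqi nu (tcut t (fun s w => v s w i 0)).
Proof.
move=> tD; have E z : tcut t (fun s w => v s w i 0) z =
    ((fun z : R * T => v z.1 z.2 i 0) \_ (D `*` [set: T])) z * \1_(`[0, t] : set R) z.1.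
  rewrite /tcut patchE indicE; case: (boolP (z.1 \in _)) => zt; rewrite ?mulr0// !mulr1.
  rewrite ifT// inE; split=> //; apply: tD; move: zt; by rewrite inE.
have m1 : measurable_fun [set: R * T] (fun z : R * T => (\1_(`[0, t] : set R) z.1 : R)).
  by apply: measurableT_comp => //; exact: measurable_indic.
have mt : measurable_fun [set: R * T] (tcut t (fun s w => v s w i 0)).
  by apply: eq_measurable_fun (measurable_funM (measurable_patch i) m1) => z _; rewrite E.
split=> //; apply: L1fun_le L1_enorm; first exact: measurable_funM.
move=> z; rewrite /= (ger0_norm (enorm_ge0 z)) ger0_norm -?expr2 ?sqr_ge0// E exprMn enormE.
apply: (@le_trans _ _ (((fun z : R * T => v z.1 z.2 i 0) \_ (D `*` [set: T])) z ^+ 2)).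
  by rewrite ler_piMr ?sqr_ge0// indicE; case: (_ \in _); rewrite ?expr1n// expr0n.
by rewrite (bigD1 i)//= lerDl; apply: sumr_ge0 => j _; exact: sqr_ge0.
Qed.
End sqint.

Lemma square_integrable_le (D D' : set R) k l (c : R) (v : R -> T -> 'cV[R]_k) (v' : R -> T -> 'cV[R]_l) :
  measurable D -> measurable D' -> square_integrable_on P F D v ->
  (forall t, D' t -> forall i, measurable_at F t (fun w => v' t w i 0)) ->
  (forall i, measurable_fun (D' `*` [set: T]) (fun z : R * T => v' z.1 z.2 i 0)) ->
  (forall z, enorm D' v' z <= c * enorm D v z) -> square_integrable_on P F D' v'.
Proof.
move=> mD mD' sv av' mv' le; split=> //.
rewrite -enorm_iterated// L1fun_ltoo; [|exact: measurable_enorm|exact: enorm_ge0].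
apply: L1fun_le (L1funZ c (L1_enorm mD (sqint_measurable sv) sv)); first exact: measurable_enorm.
move=> z; rewrite ger0_norm ?enorm_ge0//; apply: le_trans (ler_norm _).
exact: le.
Qed.

Lemma square_integrable_sub (D D' : set R) k (v : R -> T -> 'cV[R]_k) :
  measurable D -> measurable D' -> D' `<=` D ->
  square_integrable_on P F D v -> square_integrable_on P F D' v.
Proof.
move=> mD mD' DD' sv; apply: (square_integrable_le (c := 1) mD mD' sv).
- by move=> t /DD'; exact: (sqint_adapted sv).
- move=> i; apply: measurable_funS (sqint_measurable sv i); first exact: measurableX.
  by move=> z [/DD' ? ?].
- move=> z; rewrite mul1r /enorm ler_wpM2l ?sqnorm2_ge0// !indicE ler_nat.
  by case: (boolP (z.1 \in D')) => // /set_mem/DD' /mem_set ->.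
Qed.

Lemma L2_mulmx k l (M : 'M[R]_(l, k)) (v : R -> T -> 'cV[R]_k) :
  L2 P F v -> L2 P F (fun s w => M *m v s w).
Proof.
move=> sv; have [c c0 Hc] := qf_bound (M^T *m M).
have mD : measurable (`[0, +oo[ : set R) by [].
have E i s w : (M *m v s w) i 0 = (\sum_j M i j *: (fun w => v s w j 0)) w.
  by rewrite mxE fct_sumE.
apply: (square_integrable_le (c := c) mD mD sv).
- move=> t; rewrite /= in_itv/= andbT => t0 i; rewrite (funext (E i t)).
  apply/(measurable_atP hF _ t0).
  elim/big_ind: _ => [|f g mf mg|j _]; first exact: measurable_cst.
    exact: measurable_funD.
  apply: measurable_funM => //; apply/(measurable_atP hF _ t0).
  by apply: (sqint_adapted sv); rewrite /= in_itv/= t0.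
- move=> i; rewrite (_ : (fun z => _) = \sum_j M i j *: (fun z : R * T => v z.1 z.2 j 0)).
    elim/big_ind: _ => [|f g mf mg|j _]; first exact: measurable_cst.
      exact: measurable_funD.
    by apply: measurable_funM => //; exact: (sqint_measurable sv).
  by apply/funext => z; rewrite fct_sumE mxE.
- move=> z; rewrite /enorm mulrA ler_wpM2r// -qf_gram.
  by apply: le_trans (Hc _); exact: ler_norm.
Qed.

(** Otherwise Tonelli bounds the integral of |x|^2 from below by e times the infinite length of [0,
    oo[. *)
Lemma small_energy n (x : R -> T -> 'cV[R]_n) (e : R) : 0 < e -> L2 P F x ->
  exists2 t, 0 <= t & (\int[P]_w (sqnorm2 (x t w))%:E <= e%:E)%E.
Proof.
move=> e0 sx; apply: contrapT => H.
have mD : measurable (`[0, +oo[ : set R) by [].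
have big t : 0 <= t -> (e%:E <= \int[P]_w (sqnorm2 (x t w))%:E)%E.
  by move=> t0; rewrite leNgt; apply/negP => /ltW lt; apply: H; exists t.
have mx := sqint_measurable sx.
have := (L1fun_ltoo nu (measurable_enorm mD mx) (enorm_ge0 _ _)).2 (L1_enorm mD mx sx).
apply/negP; rewrite -leNgt fubini_tonelli1; last 2 first.
- by apply/measurable_EFinP; exact: measurable_enorm.
- by move=> z; rewrite lee_fin enorm_ge0.
apply: (@le_trans _ _ (\int[leb]_s (e * \1_(`[0, +oo[ : set R) s)%:E)%E).
  under eq_integral do rewrite EFinM.
  rewrite ge0_integralZl_EFin//; last 2 first.
  - by apply/measurable_EFinP; exact: measurable_indic.
  - exact: ltW.
  have Eoo : leb (`[0%R, +oo[ : set R) = +oo%E by rewrite lebesgue_measure_itv/= ltry addye.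
  by rewrite integral_indic//= setIT Eoo gt0_muley.
apply: ge0_le_integral => //.
- by move=> s _; rewrite lee_fin mulr_ge0// ltW.
- apply/measurable_EFinP; apply: measurable_funM => //; exact: measurable_indic.
- apply: (@measurable_fun_fubini_tonelli_F _ _ _ _ _ P (EFin \o enorm `[0, +oo[ x)).
    by apply/measurable_EFinP; exact: measurable_enorm.
  by move=> z; rewrite lee_fin enorm_ge0.
- move=> s _; rewrite /fubini_F /enorm /= indicE; case: (boolP (s \in _)).
    rewrite inE/= in_itv/= andbT => s0; rewrite mulr1; apply: (le_trans (big _ s0)).
    by under [leRHS]eq_integral do rewrite mulr1.
  by rewrite mulr0 => _; apply: integral_ge0 => w _; rewrite lee_fin mulr0.
Qed.

Lemma tcut_lin t n (c : 'I_n -> R) (v : 'I_n -> R -> T -> R) :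
  tcut t (fun s w => \sum_i c i * v i s w) = \sum_i c i *: tcut t (v i).
Proof.
apply/funext => z; rewrite fct_sumE /tcut mulr_suml; apply: eq_bigr => i _.
by rewrite fun_ringE mulrA.
Qed.

Lemma tcutD t (v v' : R -> T -> R) :
  tcut t (fun s w => v s w + v' s w) = tcut t v + tcut t v'.
Proof. by apply/funext => z; rewrite !fun_ringE /tcut mulrDl. Qed.

Section moments.
Variables (n p : nat) (A : 'M[R]_n) (N : 'I_q -> 'M[R]_n) (C : 'M[R]_(p, n)).
Variables (x0 : 'cV[R]_n) (u : R -> T -> 'cV[R]_p) (x : R -> T -> 'cV[R]_n).
Hypothesis sol : is_solution P F W A^T C^T (fun i => (N i)^T) x0 u x.
Hypothesis su : L2 P F u.
Variable t : R.
Hypothesis t0 : 0 <= t.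

Let xc a s w := x s w a 0.
Let uc a s w := u s w a 0.
Let f a := fun s w => (A^T *m x s w + C^T *m u s w) a 0.
Let g a := fun i s w => ((N i)^T *m x s w) a 0.

Let sx a : sqi nu (tcut t (xc a)).
Proof. by have sx := sol.1 t t0; exact: (sqi_tcut_comp _ (sqint_measurable sx)). Qed.

Let suc a : sqi nu (tcut t (uc a)).
Proof.
apply: (sqi_tcut_comp (D := `[0, +oo[) _ (sqint_measurable su)) => //.
by move=> s; rewrite /= !in_itv/= andbT => /andP[].
Qed.

Let fE a : f a = fun s w => \sum_b A b a * xc b s w + \sum_e C e a * uc e s w.
Proof.
apply/funext => s; apply/funext => w; rewrite /f !mxE.
by congr (_ + _); apply: eq_bigr => b _; rewrite mxE.
Qed.

Let gE a i : g a i = fun s w => \sum_b N i b a * xc b s w.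
Proof.
by apply/funext => s; apply/funext => w; rewrite /g !mxE; apply: eq_bigr => b _; rewrite mxE.
Qed.

Let tfE a : tcut t (f a) = \sum_b A b a *: tcut t (xc b) + \sum_e C e a *: tcut t (uc e).
Proof. by rewrite fE tcutD !tcut_lin. Qed.

Let sA a : sqi nu (\sum_b A b a *: tcut t (xc b)).
Proof. by apply: sqi_sum => b _; exact: sqiZ. Qed.

Let sC a : sqi nu (\sum_e C e a *: tcut t (uc e)).
Proof. by apply: sqi_sum => b _; exact: sqiZ. Qed.

Lemma solution_ito_process a : ito_process P F W t (x0 a 0) (f a) (g a) (xc a).
Proof.
split=> //.
- by rewrite tfE; exact: sqiD.
- by move=> i; rewrite gE tcut_lin; apply: sqi_sum => b _; exact: sqiZ.
- move=> s /andP[s0 st]; rewrite fE.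
  have sumM k (c : 'I_k -> R) (v : 'I_k -> T -> R) : (forall b, measurable_at F s (v b)) ->
      measurable_at F s (\sum_b c b *: v b).
    move=> mv; elim/big_ind: _ => [|X Y mX mY|b _]; first exact: (measurable_at_cst hF).
      exact: (measurable_atD hF).
    exact: (measurable_atM hF s0 (measurable_at_cst hF (c b) s0) (mv b)).
  rewrite (_ : (fun w => _) = \sum_b A b a *: xc b s + \sum_e C e a *: uc e s).
    apply: (measurable_atD hF) => //; apply: sumM => b.
      by apply: (sqint_adapted (sol.1 t t0)); rewrite /= in_itv/= s0.
    by apply: (sqint_adapted su); rewrite /= in_itv/= s0.
  by apply/funext => w; rewrite fun_ringE !fct_sumE.
- move=> s /andP[s0 st]; apply: (measurable_at_meas hF s0).
  by apply: (sqint_adapted (sol.1 t t0)); rewrite /= in_itv/= s0.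
- move=> s /andP[s0 st]; have [J [iJ xE]] := sol.2 s s0.
  exists (fun i w => J i w a 0); split; first by move=> i; exact: iJ.
  apply: filterS xE => w; rewrite /xc => ->; rewrite !mxE summxE; congr (_ + _ + _).
Qed.

Definition moment_x : 'M[R]_n := \matrix_(a, b) ip nu (tcut t (xc a)) (tcut t (xc b)).
Definition moment_xu : 'M[R]_(n, p) := \matrix_(a, e) ip nu (tcut t (xc a)) (tcut t (uc e)).
Definition moment_end : 'M[R]_n := \matrix_(a, b) ip P (xc a t) (xc b t).

(** [product_rule] for each pair of coordinates; the entries of the transposed coefficients assemble
    into the matrix products of [lyap]. *)
Lemma moment_equation :
  moment_end = x0 *m x0^T + lyap K A N moment_x + moment_xu *m C + (moment_xu *m C)^T.
Proof.
apply/matrixP => a b; rewrite mxE (product_rule hF hW t0 (solution_ito_process a) (solution_ito_process b)).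
have e1 : ip nu (tcut t (xc a)) (tcut t (f b)) = (moment_x *m A) a b + (moment_xu *m C) a b.
  rewrite tfE ipDr// !ip_sumr//; try by move=> *; exact: sqiZ.
  rewrite !mxE; congr (_ + _); apply: eq_bigr => c _; rewrite ipZr// mxE mulrC//.
have e2 : ip nu (tcut t (f a)) (tcut t (xc b)) = (A^T *m moment_x) a b + (moment_xu *m C) b a.
  rewrite tfE ipDl// !ip_suml//; try by move=> *; exact: sqiZ.
  rewrite !mxE; congr (_ + _); apply: eq_bigr => c _; rewrite ipZl// !mxE//.
  by rewrite ipC mulrC.
have e3 i j : ip nu (tcut t (g a i)) (tcut t (g b j)) = ((N i)^T *m moment_x *m N j) a b.
  rewrite !gE !tcut_lin ip_sumr; last 2 first.
  - by move=> *; exact: sqiZ.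
  - by apply: sqi_sum => *; exact: sqiZ.
  rewrite mxE; apply: eq_bigr => c _; rewrite ipZr//; last by apply: sqi_sum => *; exact: sqiZ.
  rewrite ip_suml//; last by move=> *; exact: sqiZ.
  rewrite mulrC mxE; congr (_ * _); apply: eq_bigr => e _; rewrite ipZl// !mxE//.
rewrite e1 e2 /lyap.
have addE (M M' : 'M[R]_n) : (M + M') a b = M a b + M' a b by rewrite mxE.
have -> : \sum_i \sum_j K i j * ip nu (tcut t (g a i)) (tcut t (g b j)) =
    (\sum_i \sum_j K i j *: ((N i)^T *m moment_x *m N j)) a b.
  rewrite summxE; apply: eq_bigr => i _; rewrite summxE; apply: eq_bigr => j _.
  by rewrite mxE e3.
rewrite !addE.
have -> : (x0 *m x0^T) a b = x0 a 0 * x0 b 0 by rewrite mxE big_ord1 mxE.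
have -> : ((moment_xu *m C)^T) a b = (moment_xu *m C) b a by rewrite mxE.
ring.
Qed.

Lemma moment_x_sym : moment_x^T = moment_x.
Proof. by apply/matrixP => a b; rewrite !mxE ipC. Qed.

Lemma moment_x_ge0 v : 0 <= qf moment_x v.
Proof.
have -> : qf moment_x v = ip nu (\sum_a v a 0 *: tcut t (xc a)) (\sum_a v a 0 *: tcut t (xc a)).
  rewrite qfE ip_suml; last 2 first.
  - by move=> *; exact: sqiZ.
  - by apply: sqi_sum => *; exact: sqiZ.
  apply: eq_bigr => a _; rewrite ip_sumr; last 2 first.
  - by move=> *; exact: sqiZ.
  - exact: sqiZ.
  by apply: eq_bigr => b _; rewrite mxE ipZl ?ipZr//; [ring|exact: sqiZ].
exact: ip_ge0.
Qed.

Lemma moment_end_le v (e : R) : (\int[P]_w (sqnorm2 (x t w))%:E <= e%:E)%E ->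
  qf moment_end v <= e * sqnorm2 v.
Proof.
move=> He; have tt : 0 <= t <= t by rewrite t0 lexx.
have sxt a : sqi P (xc a t) by have [] := sqi_ito_process hF hW t0 (solution_ito_process a) tt.
have Se : \sum_a ip P (xc a t) (xc a t) <= e.
  rewrite -lee_fin -sumEFin; apply: le_trans He.
  under eq_bigr do rewrite ip_normE//.
  rewrite -ge0_integral_sum//.
  - by rewrite le_eqVlt; apply/orP; left; apply/eqP; apply: eq_integral => w _; rewrite sumEFin.
  - by move=> a; apply/measurable_EFinP/measurable_funX/sqi_meas.
  - by move=> a w _; rewrite lee_fin sqr_ge0.
apply: (@le_trans _ _ ((\sum_a ip P (xc a t) (xc a t)) * sqnorm2 v)); last first.
  by rewrite ler_wpM2r// sqnorm2_ge0.
(* 2 v_a v_b x_a x_b <= v_b^2 x_a^2 + v_a^2 x_b^2, summed over a, b *)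
rewrite qfE /sqnorm2.
set S := _ * _; have -> : S = \sum_a \sum_b 2^-1 * (v b 0 ^+ 2 * ip P (xc a t) (xc a t) + v a 0 ^+ 2 * ip P (xc b t) (xc b t)).
  have e1 : S = \sum_a \sum_b v b 0 ^+ 2 * ip P (xc a t) (xc a t).
    rewrite /S mulr_suml; apply: eq_bigr => a _; rewrite mulr_sumr; apply: eq_bigr => b _.
    by rewrite mulrC.
  have e2 : S = \sum_a \sum_b v a 0 ^+ 2 * ip P (xc b t) (xc b t).
    by rewrite e1 exchange_big.
  have -> : S = 2^-1 * S + 2^-1 * S by lra.
  rewrite {1}e1 e2 !mulr_sumr -big_split /=; apply: eq_bigr => a _.
  by rewrite !mulr_sumr -big_split /=; apply: eq_bigr => b _; rewrite mulrDr.
apply: ler_sum => a _; apply: ler_sum => b _; rewrite mxE.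
have s1 : sqi P (v b 0 *: xc a t) by exact: sqiZ.
have s2 : sqi P (v a 0 *: xc b t) by exact: sqiZ.
have := ip_AM ltr01 s1 s2; rewrite invr1 !ipZl// !ipZr//; lra.
Qed.
End moments.

Lemma stabilizable_riccati n m p (A : 'M[R]_n) (N : 'I_q -> 'M[R]_n) (B : 'M[R]_(n, m))
    (C : 'M[R]_(p, n)) : stabilizable P F W A^T C^T (fun i => (N i)^T) ->
  exists Q : 'M[R]_n, posdefmx Q /\
     negdefmx (A^T *m invmx Q + invmx Q *m A
       + \sum_(i < q) \sum_(j < q) K i j *: ((N i)^T *m invmx Q *m N j)
       - C^T *m C
       + invmx Q *m B *m B^T *m invmx Q).
Proof.
(* The n end moments, each at most e |v|^2, must add up to at most |v|^2 / 2; n + 1 in place of n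
   avoids a division by zero when n = 0. *)
move=> stab; pose e : R := (2 * n.+1%:R)^-1.
have e0 : 0 < e by rewrite invr_gt0 mulr_gt0// ltr0n.
have /choice[ux H] : forall k : 'I_n, exists ux : (R -> T -> 'cV[R]_p) * (R -> T -> 'cV[R]_n) * R,
   [/\ is_solution P F W A^T C^T (fun i => (N i)^T) (delta_mx k 0) ux.1.1 ux.1.2,
       L2 P F ux.1.1, 0 <= ux.2 &
       (\int[P]_w (sqnorm2 (ux.1.2 ux.2 w))%:E <= e%:E)%E].
  move=> k; have [u [su [x [sol sx]]]] := stab (delta_mx k 0).
  have [t t0 te] := small_energy e0 sx.
  by exists (u, x, t).
pose X k := moment_x (ux k).1.2 (ux k).2.
pose Y k := moment_xu (ux k).1.1 (ux k).1.2 (ux k).2.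
apply: (@riccati_of_moment _ _ _ _ _ _ _ _ _ _ (covariance_sym hW) (\sum_k X k) (\sum_k Y k)).
- by rewrite linear_sum; apply: eq_bigr => k _; exact: moment_x_sym.
- move=> v; rewrite qf_sum; apply: sumr_ge0 => k _; have [sol su t0 te] := H k.
  exact: (moment_x_ge0 sol t0).
move=> v.
(* Summing the moment equations, each over its own horizon, turns the starts e_k e_k^T into the
   identity. *)
have -> : 1%:M + lyap K A N (\sum_k X k) + (\sum_k Y k) *m C + ((\sum_k Y k) *m C)^T =
    \sum_k moment_end (ux k).1.2 (ux k).2.
  under [RHS]eq_bigr => k _ do [have [sol su t0 te] := H k; rewrite (moment_equation sol su t0)].
  rewrite !big_split /= mulmx_suml linear_sum /=; congr (_ + _ + _ + _).
    by rewrite mx1_sum_delta; apply: eq_bigr => k _; rewrite trmx_delta mul_delta_mx.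
  by rewrite (big_morph (lyap K A N) (lyapD K A N) (lyap0 K A N)) -!big_split.
rewrite qf_sum; apply: (@le_trans _ _ (\sum_(k < n) e * sqnorm2 v)).
  by apply: ler_sum => k _; have [sol su t0 te] := H k; exact: (moment_end_le sol su t0).
rewrite sumr_const card_ord -[_ *+ n]mulr_natl mulrA ler_wpM2r ?sqnorm2_ge0//.
rewrite /e invfM mulrCA ler_piMr// ler_pdivrMr ?ltr0n// mul1r ler_nat//.
Qed.
End necessity.

(** * Mean square stability of the Euler scheme *)

Section euler_scheme.
Context (R : realType) d (T : measurableType d) (P : probability T R).
Context (F : R -> set (set T)) (q : nat) (K : 'M[R]_q) (W : R -> T -> 'cV[R]_q).
Hypothesis hF : right_continuous_complete_filtration P F.
Hypothesis hW : wiener_process P F K W.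
Variables (n : nat) (A : 'M[R]_n) (N : 'I_q -> 'M[R]_n) (x0 : 'cV[R]_n).
Local Notation dW := (dW W).
Local Notation ad := (ad P F).
Implicit Types (y e : 'I_n -> T -> R) (M : 'M[R]_n).

(* The action of [M^T]: the dynamics have coefficients A^T and N_i^T. *)
Definition lin M y : 'I_n -> T -> R := fun a => \sum_b M b a *: y b.

(** The state is frozen at [y] while the interval is free: half steps and an unfinished last step
    are increments of the same kind. *)
Definition euler_incr (t r : R) y : 'I_n -> T -> R :=
  fun a => (r - t) *: lin A y a + \sum_i (lin (N i) y a \* dW i t r).

Fixpoint euler_scheme (h : R) (k : nat) : 'I_n -> T -> R :=
  if k is k'.+1 then
    fun a => euler_scheme h k' a + euler_incr (k'%:R * h) (k'.+1%:R * h) (euler_scheme h k') a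
  else fun a => fun=> x0 a 0.

Lemma lin_ad t M y a : 0 <= t -> (forall b, ad t (y b)) -> ad t (lin M y a).
Proof. by move=> t0 ay; apply: (ad_sum hF) => // b _; exact: (adZ hF). Qed.

Lemma lin_sqi M y a : (forall b, sqi P (y b)) -> sqi P (lin M y a).
Proof. by move=> sy; apply: sqi_sum => b _; exact: sqiZ. Qed.

Lemma noise_ad t r (xi : 'I_q -> T -> R) : 0 <= t -> t <= r -> (forall i, ad t (xi i)) ->
  ad r (\sum_i (xi i \* dW i t r)).
Proof.
move=> t0 tr axi; apply: (ad_sum hF) => [|i _]; first exact: le_trans tr.
exact: (ad_mul_dW hF hW).
Qed.

Lemma gstep_ad t r y a : 0 <= t -> t <= r -> (forall b, ad t (y b)) -> ad r (euler_incr t r y a).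
Proof.
move=> t0 tr ay; have r0 := le_trans t0 tr; apply: (adD hF) => //.
  by apply: (adZ hF) => //; apply: (ad_le hF t0 tr); exact: lin_ad.
by apply: noise_ad => // i; exact: lin_ad.
Qed.

Lemma euler_ad h k a : 0 <= h -> ad (k%:R * h) (euler_scheme h k a).
Proof.
move=> h0; elim: k a => [|k IH] a /=; first by rewrite mul0r; exact: (ad_cst hF).
have kh0 : 0 <= k%:R * h by rewrite mulr_ge0.
have le : k%:R * h <= k.+1%:R * h by rewrite ler_wpM2r// ler_nat.
apply: (adD hF); first by rewrite mulr_ge0.
  exact: (ad_le hF) (IH a).
exact: gstep_ad.
Qed.

(** What is measurable at [t] is orthogonal to the fresh noise, so no mixed term appears and the
    noise contributes only order r - t. *)
Lemma one_step t r (Y Y' : T -> R) (xi eta : 'I_q -> T -> R) : 0 <= t -> t <= r ->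
  ad t Y -> ad t Y' -> (forall i, ad t (xi i)) -> (forall i, ad t (eta i)) ->
  ip P (Y + \sum_i (xi i \* dW i t r)) (Y' + \sum_i (eta i \* dW i t r)) =
    ip P Y Y' + (r - t) * \sum_i \sum_j K i j * ip P (xi i) (eta j).
Proof.
move=> t0 tr aY aY' axi aeta.
have sY := ad_sqi aY; have sY' := ad_sqi aY'.
have sx i : sqi P (xi i \* dW i t r) by apply: ad_sqi; exact: (ad_mul_dW hF hW).
have se i : sqi P (eta i \* dW i t r) by apply: ad_sqi; exact: (ad_mul_dW hF hW).
have sX : sqi P (\sum_i (xi i \* dW i t r)) by exact: sqi_sum.
have sE : sqi P (\sum_i (eta i \* dW i t r)) by exact: sqi_sum.
rewrite (ipDl sY sX (sqiD sY' sE)) (ipDr sY' sE sY) (ipDr sY' sE sX).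
have -> : ip P Y (\sum_i (eta i \* dW i t r)) = 0.
  by rewrite ip_sumr// big1// => i _; exact: (ip_dW_future hF hW).
have -> : ip P (\sum_i (xi i \* dW i t r)) Y' = 0.
  by rewrite ip_suml// big1// => i _; rewrite ipC; exact: (ip_dW_future hF hW).
rewrite addr0 add0r; congr (_ + _); rewrite ip_suml// mulr_sumr; apply: eq_bigr => i _.
rewrite ip_sumr// mulr_sumr; apply: eq_bigr => j _.
by rewrite (ip_dW_same hF hW)//; ring.
Qed.

Definition mom y : 'M[R]_n := \matrix_(a, b) ip P (y a) (y b).
Definition mean_sqnorm y : R := \sum_a ip P (y a) (y a).

Lemma ip_lin M M' y a b : (forall b, sqi P (y b)) ->
  ip P (lin M y a) (lin M' y b) = (M^T *m mom y *m M') a b.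
Proof.
move=> sy; rewrite /lin ip_sumr; last 2 first.
- by move=> *; exact: sqiZ.
- exact: lin_sqi.
rewrite mxE; apply: eq_bigr => c _; rewrite ipZr//; last exact: lin_sqi.
rewrite ip_suml//; last by move=> *; exact: sqiZ.
by rewrite mulrC mxE; congr (_ * _); apply: eq_bigr => e _; rewrite ipZl// !mxE.
Qed.

Lemma lin1 y a : lin 1%:M y a = y a.
Proof.
rewrite /lin (bigD1 a)//= mxE eqxx scale1r big1 ?addr0// => b ba.
by rewrite mxE (negbTE ba) scale0r.
Qed.

(** An exact recursion, which departs from the moment equation only by the second order drift
    term. *)
Lemma mom_step t r y : 0 <= t -> t <= r -> (forall a, ad t (y a)) ->
  mom (fun a => y a + euler_incr t r y a) =
    mom y + (r - t) *: lyap K A N (mom y) + (r - t) ^+ 2 *: (A^T *m mom y *m A).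
Proof.
move=> t0 tr ay; have sy a := ad_sqi (ay a); set h := r - t.
have aL M a := lin_ad M a t0 ay; have sL M a := ad_sqi (aL M a).
apply/matrixP => a b; rewrite mxE /euler_incr -/h !addrA one_step//; last 2 first.
- by apply: (adD hF) => //; exact: (adZ hF).
- by apply: (adD hF) => //; exact: (adZ hF).
have shL c : sqi P (h *: lin A y c) by exact: sqiZ.
rewrite (ipDl (sy a) (shL a) (sqiD (sy b) (shL b))) (ipDr (sy b) (shL b) (sy a)) (ipDr (sy b) (shL b) (shL a)).
rewrite (ipZl _ (sL A a) (sy b)) (ipZr _ (sL A b) (sy a)) (ipZr _ (sL A b) (shL a)) (ipZl _ (sL A a) (sL A b)).
have -> : ip P (lin A y a) (y b) = (A^T *m mom y) a b.
  by rewrite -[y b]lin1 ip_lin// mulmx1.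
have -> : ip P (y a) (lin A y b) = (mom y *m A) a b.
  by rewrite -{1}[y a]lin1 ip_lin// trmx1 mul1mx.
have -> : ip P (lin A y a) (lin A y b) = (A^T *m mom y *m A) a b by rewrite ip_lin.
have -> : \sum_i \sum_j K i j * ip P (lin (N i) y a) (lin (N j) y b) =
    (\sum_i \sum_j K i j *: ((N i)^T *m mom y *m N j)) a b.
  rewrite summxE; apply: eq_bigr => i _; rewrite summxE; apply: eq_bigr => j _.
  by rewrite mxE ip_lin.
have -> : ip P (y a) (y b) = mom y a b by rewrite mxE.
have addE (M M' : 'M[R]_n) : (M + M') a b = M a b + M' a b by rewrite mxE.
have sclE c (M : 'M[R]_n) : (c *: M) a b = c * M a b by rewrite mxE.
rewrite -/h /lyap !(addE, sclE); ring.
Qed.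

Lemma nrm2_ge0 y : 0 <= mean_sqnorm y.
Proof. by apply: sumr_ge0 => a _; exact: ip_ge0. Qed.

Lemma ip_le_nrm2 y a : ip P (y a) (y a) <= mean_sqnorm y.
Proof. by rewrite /mean_sqnorm (bigD1 a)//= lerDl; apply: sumr_ge0 => b _; exact: ip_ge0. Qed.

Lemma mom_le_nrm2 y a b : (forall b, sqi P (y b)) -> `|mom y a b| <= mean_sqnorm y.
Proof.
move=> sy; rewrite mxE.
have := ip_AM ltr01 (sy a) (sy b); have := ip_AM ltr01 (sqiN (sy a)) (sy b).
rewrite !(ipNl, ipNr)//; last exact: sqiN.
rewrite invr1 opprK => h1 h2; have := ip_le_nrm2 y a; have := ip_le_nrm2 y b.
by rewrite ler_norml; move=> *; apply/andP; split; lra.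
Qed.

Lemma nrm2D y e : (forall b, sqi P (y b)) -> (forall b, sqi P (e b)) ->
  mean_sqnorm (fun a => y a + e a) <= 2 * mean_sqnorm y + 2 * mean_sqnorm e.
Proof.
move=> sy se; rewrite /mean_sqnorm !mulr_sumr -big_split /=; apply: ler_sum => a _.
exact: ip_normD.
Qed.

Lemma lin_bound M M' : exists2 c : R, 0 <= c & forall y, (forall b, sqi P (y b)) ->
  `|\sum_a ip P (lin M y a) (lin M' y a)| <= c * mean_sqnorm y.
Proof.
exists (\sum_a \sum_b \sum_c `|M b a| * `|M' c a|).
  by do 3 (apply: sumr_ge0 => ? _); rewrite mulr_ge0.
move=> y sy; rewrite mulr_suml; apply: (le_trans (ler_norm_sum _ _ _)).
apply: ler_sum => a _; rewrite ip_lin// mxE.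
have -> : \sum_j (M^T *m mom y) a j * M' j a = \sum_b \sum_c M b a * mom y b c * M' c a.
  rewrite exchange_big; apply: eq_bigr => c _; rewrite mxE mulr_suml.
  by apply: eq_bigr => b _; rewrite mxE.
rewrite mulr_suml; apply: (le_trans (ler_norm_sum _ _ _)); apply: ler_sum => b _.
rewrite mulr_suml; apply: (le_trans (ler_norm_sum _ _ _)); apply: ler_sum => c _.
by rewrite !normrM mulrAC ler_wpM2l// ?mulr_ge0// mom_le_nrm2.
Qed.

(** The increment may be driven by a state [e] other than [y], as happens for differences of
    schemes. The noise is orthogonal to [y], so Young's inequality is spent on the drift only; it
    leaves [y] with the factor 1 + (r - t) and [e] with a factor of order r - t, the form that a
    discrete Gronwall argument needs. *)
Lemma nrm2_gstep : exists2 c : R, 0 <= c & forall t r y e, 0 <= t -> t <= r -> r - t <= 1 ->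
  (forall a, ad t (y a)) -> (forall a, ad t (e a)) ->
  mean_sqnorm (fun a => y a + euler_incr t r e a) <= (1 + (r - t)) * mean_sqnorm y + (r - t) * c * mean_sqnorm e.
Proof.
have [cA cA0 HA] := lin_bound A A.
have /choice[cK HK] : forall i, exists c : 'I_q -> R, forall j, 0 <= c j /\ forall y,
   (forall b, sqi P (y b)) -> `|\sum_a ip P (lin (N i) y a) (lin (N j) y a)| <= c j * mean_sqnorm y.
  move=> i; have /choice[c Hc] : forall j, exists c : R, 0 <= c /\ forall y,
     (forall b, sqi P (y b)) -> `|\sum_a ip P (lin (N i) y a) (lin (N j) y a)| <= c * mean_sqnorm y.
    by move=> j; have [c c0 Hc] := lin_bound (N i) (N j); exists c.
  by exists c.
pose c := 2 * cA + \sum_i \sum_j `|K i j| * cK i j.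
exists c.
  apply: addr_ge0; first by rewrite mulr_ge0.
  apply: sumr_ge0 => i _; apply: sumr_ge0 => j _.
  by rewrite mulr_ge0//; case: (HK i j).
move=> t r y e t0 tr rt1 ay ae; set h := r - t; have h0 : 0 <= h by rewrite subr_ge0.
have sy a := ad_sqi (ay a); have se a := ad_sqi (ae a).
have aL M a := lin_ad M a t0 ae; have sL M a := ad_sqi (aL M a).
have E a : ip P (y a + euler_incr t r e a) (y a + euler_incr t r e a) =
    ip P (y a + h *: lin A e a) (y a + h *: lin A e a) +
    h * \sum_i \sum_j K i j * ip P (lin (N i) e a) (lin (N j) e a).
  rewrite /euler_incr -/h !addrA one_step//; last 2 first.
  - by apply: (adD hF) => //; exact: (adZ hF).
  - by apply: (adD hF) => //; exact: (adZ hF).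
rewrite /mean_sqnorm (eq_bigr _ (fun a _ => E a)) big_split /=.
have step1 : \sum_a ip P (y a + h *: lin A e a) (y a + h *: lin A e a) <=
    (1 + h) * mean_sqnorm y + h * (2 * cA) * mean_sqnorm e.
  apply: (@le_trans _ _ ((1 + h) * mean_sqnorm y + 2 * h * \sum_a ip P (lin A e a) (lin A e a))).
    rewrite /mean_sqnorm !mulr_sumr -big_split /=; apply: ler_sum => a _.
    have shL : sqi P (h *: lin A e a) by exact: sqiZ.
    rewrite (ipDl (sy a) shL (sqiD (sy a) shL)) (ipDr (sy a) shL (sy a)) (ipDr (sy a) shL shL).
    rewrite (ipC _ (h *: _) (y a)) (ipZr _ (sL A a) (sy a)) (ipZr _ (sL A a) shL) (ipZl _ (sL A a) (sL A a)).
    have := ip_AM ltr01 (sy a) (sL A a); rewrite invr1 => H.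
    have L0 := ip_ge0 P (lin A e a).
    have : h * (h * ip P (lin A e a) (lin A e a)) <= h * ip P (lin A e a) (lin A e a).
      by rewrite ler_wpM2l// ler_piMl.
    have : h * (2 * ip P (y a) (lin A e a)) <= h * (1 * ip P (y a) (y a) + 1 * ip P (lin A e a) (lin A e a)).
      by rewrite ler_wpM2l.
    lra.
  rewrite lerD2l -!mulrA [h * (2 * _)]mulrCA; do 2 (rewrite ler_wpM2l//).
  exact: (le_trans (ler_norm _) (HA e se)).
have step2 : h * (\sum_a \sum_i \sum_j K i j * ip P (lin (N i) e a) (lin (N j) e a)) <=
    h * ((\sum_i \sum_j `|K i j| * cK i j) * mean_sqnorm e).
  rewrite ler_wpM2l// exchange_big /= mulr_suml; apply: ler_sum => i _.
  rewrite exchange_big /= mulr_suml; apply: ler_sum => j _.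
  rewrite -mulr_sumr -mulrA; apply: (le_trans (ler_norm _)); rewrite normrM ler_wpM2l//.
  by have [_ H] := HK i j; exact: H.
rewrite -mulr_sumr -/(mean_sqnorm y) -/(mean_sqnorm e).
apply: (le_trans (lerD step1 step2)).
rewrite /c; lra.
Qed.

(* As K_ij = E W_i(1) W_j(1), the double sum is the mean of the form [S] at the
   random vector \sum_i W_i(1) u_i. *)
Lemma kron_psd (S : 'M[R]_n) (u : 'I_q -> 'cV[R]_n) : (forall v, 0 <= qf S v) ->
  0 <= \sum_i \sum_j K i j * ((u i)^T *m S *m u j) 0 0.
Proof.
move=> S0; pose U a : T -> R := \sum_i u i a 0 *: Wcoord W i 1.
have sW i : sqi P (Wcoord W i 1) by apply: ad_sqi; exact: (W_L2 hF hW).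
have sU a : sqi P (U a) by apply: sqi_sum => i _; exact: sqiZ.
have -> : \sum_i \sum_j K i j * ((u i)^T *m S *m u j) 0 0 = \sum_a \sum_b S a b * ip P (U a) (U b).
  have H1 i j : ((u i)^T *m S *m u j) 0 0 = \sum_a \sum_b S a b * (u i a 0 * u j b 0).
    rewrite mxE exchange_big; apply: eq_bigr => b _; rewrite mxE mulr_suml.
    by apply: eq_bigr => a _; rewrite mxE; ring.
  have H2 a b : ip P (U a) (U b) = \sum_i \sum_j K i j * (u i a 0 * u j b 0).
    rewrite ip_suml//; last by move=> *; exact: sqiZ.
    apply: eq_bigr => i _; rewrite ip_sumr//; [|by move=> *; exact: sqiZ|exact: sqiZ].
    apply: eq_bigr => j _; rewrite ipZl// ?ipZr// ?(W_cov hW)//; last exact: sqiZ.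
    by rewrite mulr1; ring.
  under eq_bigr => i _ do under eq_bigr => j _ do rewrite H1 mulr_sumr.
  under eq_bigr => i _ do rewrite exchange_big /=.
  rewrite exchange_big /=; apply: eq_bigr => a _.
  under eq_bigr => i _ do under eq_bigr => j _ do rewrite mulr_sumr.
  under eq_bigr => i _ do rewrite exchange_big /=.
  rewrite exchange_big /=; apply: eq_bigr => b _.
  rewrite H2 mulr_sumr; apply: eq_bigr => i _; rewrite mulr_sumr; apply: eq_bigr => j _.
  ring.
have -> : \sum_a \sum_b S a b * ip P (U a) (U b) =
    \int[P]_w (\sum_a \sum_b S a b *: (U a \* U b)) w.
  have L a b : L1fun P (S a b *: (U a \* U b)) by apply: L1funZ; exact: sqiM.
  rewrite Rint_sum; last by move=> a _; apply: L1fun_sum => b _; exact: L.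
  apply: eq_bigr => a _; rewrite Rint_sum; last by move=> b _; exact: L.
  by apply: eq_bigr => b _; rewrite /ip -RintegralZl//; exact: sqiM.
apply: Rintegral_ge0 => w _; have := S0 (\col_a U a w); rewrite qfE.
congr (0 <= _); rewrite fct_sumE; apply: eq_bigr => a _; rewrite fct_sumE; apply: eq_bigr => b _.
by rewrite !mxE.
Qed.

Section stable.
Variable Z : 'M[R]_n.
Hypothesis pZ : posdefmx Z.
Hypothesis nZ : posdefmx (- lyap K A N Z).

(* The map sending the second moment of an Euler step to the next one is
   positive; applied to [c *: Z - M] it propagates the bound [M <= c *: Z]. *)
Lemma euler_step_positive (h : R) (S : 'M[R]_n) v : 0 <= h -> (forall v, 0 <= qf S v) ->
  0 <= qf (S + h *: lyap K A N S + h ^+ 2 *: (A^T *m S *m A)) v.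
Proof.
move=> h0 S0.
have -> : S + h *: lyap K A N S + h ^+ 2 *: (A^T *m S *m A) =
   (1%:M + h *: A)^T *m S *m (1%:M + h *: A) +
   h *: \sum_i \sum_j K i j *: ((N i)^T *m S *m N j).
  rewrite /lyap [(1%:M + _)^T]linearD /= [(h *: A)^T]linearZ /= trmx1 !(mulmxDl, mulmxDr).
  rewrite !(mul1mx, mulmx1) -!scalemxAl -!scalemxAr.
  apply/matrixP => a b.
  have addE (M M' : 'M[R]_n) : (M + M') a b = M a b + M' a b by rewrite mxE.
  have sclE c (M : 'M[R]_n) : (c *: M) a b = c * M a b by rewrite mxE.
  rewrite !(addE, sclE); ring.
rewrite qfD qf_mul addr_ge0// qfZ mulr_ge0// qf_sum.
under eq_bigr => i _ do rewrite qf_sum.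
have := kron_psd (fun i => N i *m v) S0; congr (0 <= _).
apply: eq_bigr => i _; apply: eq_bigr => j _; rewrite qfZ; congr (_ * _).
by rewrite /qf trmx_mul !mulmxA.
Qed.

Lemma euler_stable : exists delta h0 C0 : R, [/\ 0 < delta, 0 < h0 <= 1, delta * h0 <= 1, 0 <= C0 &
  forall h k, 0 <= h -> h <= h0 -> mean_sqnorm (euler_scheme h k) <= C0 * (1 - delta * h) ^+ k].
Proof.
have [d1 d10 Hd1] := posdef_lower nZ.
have [d2 d20 Hd2] := posdef_lower pZ.
have [cZ cZ0 HcZ] := qf_bound Z.
have [cA cA0 HcA] := qf_bound (A^T *m Z *m A).
have [cx cx0 Hcx] := qf_bound (x0 *m x0^T).
(* The margin d1 of - [lyap] Z is halved: one half pays for delta Z, the other, through h <= d1 / (2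
   (cA + 1)), for the term of order h^2. The bound h <= 1 / delta keeps the contraction factor
   nonnegative. *)
pose delta := d1 / (2 * (cZ + 1)).
have cZ1 : 0 < 2 * (cZ + 1) by rewrite mulr_gt0// ltr_wpDl.
have delta0 : 0 < delta by rewrite divr_gt0.
pose h0 := Num.min 1 (Num.min delta^-1 (d1 / (2 * (cA + 1)))).
have cA1 : 0 < 2 * (cA + 1) by rewrite mulr_gt0// ltr_wpDl.
have h00 : 0 < h0 by rewrite !lt_min ltr01 invr_gt0 delta0 divr_gt0.
(* Makes the initial moment x0 x0^T at most c0 Z. *)
pose c0 := cx / d2.
have c00 : 0 <= c0 by rewrite divr_ge0// ltW.
exists delta, h0, (c0 * \sum_a Z a a).
have Zaa a : 0 <= Z a a.
  have := qf_ge0 (delta_mx a 0) pZ; rewrite /qf trmx_delta -rowE -colE !mxE//.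
split => //.
- by rewrite h00 ge_min lexx.
- by rewrite mulrC -ler_pdivlMr// mul1r !ge_min lexx orbT.
- by rewrite mulr_ge0// sumr_ge0.
move=> h k hge hle.
have h1 : h <= d1 / (2 * (cA + 1)) by apply: (le_trans hle); rewrite !ge_min lexx !orbT.
have dh1 : delta * h <= 1.
  by rewrite mulrC -ler_pdivlMr// mul1r (le_trans hle)// !ge_min lexx orbT.
pose rho := 1 - delta * h; have rho0 : 0 <= rho by rewrite subr_ge0.
have main v : qf (mom (euler_scheme h k)) v <= c0 * rho ^+ k * qf Z v.
  elim: k v => [|k IH] v.
    rewrite expr0 mulr1.
    have -> : mom (euler_scheme h 0) = x0 *m x0^T.
      apply/matrixP => a b; rewrite !mxE big_ord1 !mxE /= /ip.
      by rewrite (_ : (fun z => _) = cst (x0 a 0 * x0 b 0))// Rintegral_cst//= probability_setT mulr1.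
    apply: (le_trans (ler_norm _)); apply: (le_trans (Hcx v)).
    by rewrite /c0 -mulrA ler_wpM2l// mulrC ler_pdivlMr// mulrC.
  have kh : 0 <= k%:R * h by rewrite mulr_ge0.
  have le : k%:R * h <= k.+1%:R * h by rewrite ler_wpM2r// ler_nat.
  have ay a := euler_ad k a hge.
  have -> : mom (euler_scheme h k.+1) = mom (euler_scheme h k) + h *: lyap K A N (mom (euler_scheme h k)) +
      h ^+ 2 *: (A^T *m mom (euler_scheme h k) *m A).
    rewrite [euler_scheme h k.+1]/= mom_step//.
    by have -> : k.+1%:R * h - k%:R * h = h by rewrite -mulrBl -natrB// subSnn mul1r.
  set M := mom (euler_scheme h k) in IH *; set c := c0 * rho ^+ k in IH.
  have c_ge0 : 0 <= c by rewrite mulr_ge0// exprn_ge0.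
  have S0 w : 0 <= qf (c *: Z - M) w by rewrite qfB qfZ subr_ge0.
  have := euler_step_positive v hge S0.
  have -> : lyap K A N (c *: Z - M) = c *: lyap K A N Z - lyap K A N M.
    by rewrite lyapD lyapZ -scaleN1r lyapZ scaleN1r.
  rewrite mulmxBr mulmxBl -scalemxAr -scalemxAl.
  rewrite (qfD (c *: Z - M + _)) (qfD (c *: Z - M)) (qfD (M + _)) (qfD M).
  rewrite !(qfZ h) !(qfZ (h ^+ 2)) !qfB !(qfZ c) => H.
  have l1 := Hd1 v; rewrite qfN in l1.
  have l2 : qf (A^T *m Z *m A) v <= cA * sqnorm2 v by exact: le_trans (ler_norm _) (HcA v).
  have l3 : qf Z v <= cZ * sqnorm2 v by exact: le_trans (ler_norm _) (HcZ v).
  have s0 := sqnorm2_ge0 v.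
  have l4 : qf Z v + h * qf (lyap K A N Z) v + h ^+ 2 * qf (A^T *m Z *m A) v <= rho * qf Z v.
    have hA : h * qf (A^T *m Z *m A) v <= d1 / 2 * sqnorm2 v.
      apply: (@le_trans _ _ (h * (cA + 1) * sqnorm2 v)).
        rewrite -mulrA ler_wpM2l// (le_trans l2)// ler_wpM2r// lerDl//.
      rewrite ler_wpM2r//; move: h1; rewrite ler_pdivlMr// => h1; lra.
    have hZ : delta * qf Z v <= d1 / 2 * sqnorm2 v.
      apply: (@le_trans _ _ (delta * ((cZ + 1) * sqnorm2 v))).
        rewrite ler_pM2l// (le_trans l3)// ler_wpM2r// lerDl//.
      rewrite mulrA ler_wpM2r// /delta invfM -!mulrA mulVf ?mulr1// gt_eqF// ltr_wpDl//.
    have hh : h * (qf (lyap K A N Z) v + h * qf (A^T *m Z *m A) v + delta * qf Z v) <= 0.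
      by rewrite mulr_ge0_le0//; lra.
    rewrite /rho; lra.
  have l5 : c * (qf Z v + h * qf (lyap K A N Z) v + h ^+ 2 * qf (A^T *m Z *m A) v) <= c * (rho * qf Z v).
    by rewrite ler_wpM2l.
  have -> : c0 * rho ^+ k.+1 * qf Z v = c * (rho * qf Z v) by rewrite /c exprSr; ring.
  lra.
(* Basis vectors read off the diagonal entries, whence the trace of [Z] in the constant. *)
rewrite mulrAC mulr_sumr; apply: ler_sum => a _.
have := main (delta_mx a 0).
by rewrite /qf trmx_delta -!rowE -!colE !mxE.
Qed.
End stable.
End euler_scheme.

(** * Grid indices and their behaviour under halving of the step *)

Section pred_ceil.
Context (R : realType).

(* The largest [k < a]; the strict inequality matches the intervals
   ]node k, node k.+1] of [step_value]. *)
Definition pred_ceil (a : R) : nat := if a <= 0 then 0%N else `|Num.ceil a|%N.-1.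

Lemma pred_ceilP a : 0 < a -> (pred_ceil a)%:R < a <= (pred_ceil a).+1%:R.
Proof.
move=> a0; rewrite /pred_ceil leNgt a0 /=.
have c0 : (0 < Num.ceil a)%R by rewrite ceil_gt0.
have := ceil_itv a; case: (Num.ceil a) c0 => // -[//|m] _ /=.
by have -> : (m.+1%:Z - 1 = m%:Z)%R by lia.
Qed.

Lemma pred_ceil0 : pred_ceil 0 = 0%N. Proof. by rewrite /pred_ceil lexx. Qed.

Lemma pred_ceil_uniq a k : k%:R < a <= k.+1%:R -> pred_ceil a = k.
Proof.
move=> /andP[ka ak]; have a0 : 0 < a by apply: le_lt_trans ka.
have /andP[h1 h2] := pred_ceilP a0.
have : (pred_ceil a < k.+1)%N by rewrite -(ltr_nat R); exact: lt_le_trans ak.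
have : (k < (pred_ceil a).+1)%N by rewrite -(ltr_nat R); exact: lt_le_trans h2.
lia.
Qed.

(** The interval ]k, k + 1] doubles to ]2 k, 2 k + 2], whose unit pieces have indices 2 k and 2 k +
    1. This nests the dyadic grids: the coarse index of a time is half of its fine index. *)
Lemma pred_ceil_half a : 0 <= a -> pred_ceil a = (pred_ceil (2 * a))./2.
Proof.
rewrite le_eqVlt => /orP[/eqP<-|a0]; first by rewrite mulr0 pred_ceil0.
have /andP[h1 h2] := pred_ceilP a0; have a20 : 0 < 2 * a by rewrite mulr_gt0.
have /andP[h3 h4] := pred_ceilP a20.
have : (pred_ceil (2 * a) < 2 * (pred_ceil a).+1)%N.
  by rewrite -(ltr_nat R) natrM; apply: lt_le_trans h3 _; rewrite ler_pM2l.
have : (2 * pred_ceil a < (pred_ceil (2 * a)).+1)%N.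
  by rewrite -(ltr_nat R) natrM; apply: lt_le_trans h4; rewrite ltr_pM2l.
lia.
Qed.

Lemma pred_ceil_le a : 0 <= a -> (pred_ceil a)%:R <= a.
Proof.
by rewrite le_eqVlt => /orP[/eqP<-|/pred_ceilP/andP[/ltW]//]; rewrite pred_ceil0.
Qed.

Lemma pred_ceil_ge a : 0 <= a -> a <= (pred_ceil a).+1%:R.
Proof.
by rewrite le_eqVlt => /orP[/eqP<-|/pred_ceilP/andP[_]//]; rewrite pred_ceil0.
Qed.

Lemma measurable_pred_ceil (h : R) k : measurable [set s | pred_ceil (s / h) = k].
Proof.
have -> : [set s | pred_ceil (s / h) = k] = (fun s => s / h) @^-1` [set a | pred_ceil a = k] by [].
rewrite -[X in measurable X]setTI.
have m : measurable_fun [set: R] (fun s : R => s / h) by exact: measurable_funM.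
apply: m => //; case: k => [|k].
  have -> : [set a : R | pred_ceil a = 0%N] = `]-oo, 1]%classic.
    apply/seteqP; split=> a /=; rewrite in_itv/=.
      by move=> a0; have [a_le|a_gt] := leP a 0; [exact: le_trans ler01|have /andP[] := pred_ceilP a_gt; rewrite a0].
    move=> a1; have [a_le|a_gt] := leP a 0; first by rewrite /pred_ceil a_le.
    by apply: pred_ceil_uniq; rewrite a_gt a1.
  exact: measurable_itv.
have -> : [set a : R | pred_ceil a = k.+1] = `]k.+1%:R, k.+2%:R]%classic.
  apply/seteqP; split=> a /=; rewrite in_itv/=.
    move=> ak; have [a_le|a_gt] := leP a 0; first by move: ak; rewrite /pred_ceil a_le.
    by have := pred_ceilP a_gt; rewrite ak.
  exact: pred_ceil_uniq.
exact: measurable_itv.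
Qed.
End pred_ceil.

(** * Comparison of the schemes of steps h and h / 2 *)

Section coupling.
Context (R : realType) d (T : measurableType d) (P : probability T R).
Context (F : R -> set (set T)) (q : nat) (K : 'M[R]_q) (W : R -> T -> 'cV[R]_q).
Hypothesis hF : right_continuous_complete_filtration P F.
Hypothesis hW : wiener_process P F K W.
Variables (n : nat) (A : 'M[R]_n) (N : 'I_q -> 'M[R]_n) (x0 : 'cV[R]_n).
Local Notation ad := (ad P F).
Local Notation gstep := (euler_incr W A N).
Local Notation euler := (euler_scheme W A N x0).
Local Notation nrm2 := (mean_sqnorm P).
Implicit Types (y e : 'I_n -> T -> R).

(** With a frozen state, a full step is two half steps driven by the same state; this is how
    [coarse] meets the scheme of step h at even times. *)
Lemma gstep_split t r u y a : gstep t u y a = gstep t r y a + gstep r u y a.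
Proof.
rewrite /euler_incr addrACA -scalerDl; congr (_ *: _ + _); first by ring.
by rewrite -big_split /=; apply: eq_bigr => i _; rewrite -mul_funDr -dW_split.
Qed.

Lemma linB (M : 'M[R]_n) y e a : lin M (fun b => y b - e b) a = lin M y a - lin M e a.
Proof. by rewrite /lin -sumrB; apply: eq_bigr => b _; rewrite scalerBr. Qed.

Lemma gstepB t r y e a : gstep t r (fun b => y b - e b) a = gstep t r y a - gstep t r e a.
Proof.
rewrite /euler_incr linB scalerBr opprD addrACA; congr (_ + _).
rewrite -sumrB; apply: eq_bigr => i _; rewrite linB.
by apply/funext => w; rewrite !fun_ringE /= !fun_ringE mulrBl.
Qed.

Section fix_h.
Variable h : R.
Hypothesis hge : 0 <= h.
Let h' := h / 2.
Let h'ge : 0 <= h'. Proof. by rewrite divr_ge0. Qed.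
Let s k : R := k%:R * h'.

(* The scheme of step [h] observed on the grid of step [h / 2]. *)
Fixpoint coarse (k : nat) : 'I_n -> T -> R :=
  if k is k'.+1 then fun a => coarse k' a + gstep (s k') (s k'.+1) (euler h k'./2) a
  else fun a => fun=> x0 a 0.

Lemma s_ge0 k : 0 <= s k. Proof. by rewrite mulr_ge0. Qed.

Lemma s_le k l : (k <= l)%N -> s k <= s l.
Proof. by move=> kl; rewrite ler_wpM2r// ler_nat. Qed.

Lemma s_step k : s k.+1 - s k = h'.
Proof. by rewrite -mulrBl -natrB// subSnn mul1r. Qed.

Lemma s_double j : s j.*2 = j%:R * h.
Proof. by rewrite /s /h' -muln2 natrM; field. Qed.

Lemma half_euler_ad k a : ad (s k) (euler h k./2 a).
Proof.
apply: (ad_le hF _ _ (euler_ad hF hW A N x0 k./2 a hge)); first by rewrite mulr_ge0.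
by rewrite -s_double; apply: s_le; lia.
Qed.

Lemma coarse_ad k a : ad (s k) (coarse k a).
Proof.
elim: k a => [|k IH] a /=; first exact: (ad_cst hF _ (s_ge0 0)).
apply: (adD hF); first exact: s_ge0.
  by apply: (ad_le hF _ _ (IH a)); [exact: s_ge0|exact: s_le].
by apply: (gstep_ad hF hW); [exact: s_ge0|exact: s_le|move=> b; exact: half_euler_ad].
Qed.

Lemma coarse_double j : coarse j.*2 = euler h j.
Proof.
elim: j => [//|j IH]; rewrite doubleS; apply/funext => a /=.
rewrite IH -addrA uphalf_double half_double -gstep_split; congr (_ + gstep _ _ _ _).
- exact: s_double.
- by rewrite -doubleS s_double.
Qed.

(** At even times the difference vanishes; at odd times it is one half step, bounded by the
    increment estimate started from 0. *)
Lemma coarse_residual (c C0 : R) :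
  (forall t r y e, 0 <= t -> t <= r -> r - t <= 1 ->
    (forall a, ad t (y a)) -> (forall a, ad t (e a)) ->
    nrm2 (fun a => y a + gstep t r e a) <= (1 + (r - t)) * nrm2 y + (r - t) * c * nrm2 e) ->
  0 <= c -> h <= 1 -> (forall k, nrm2 (euler h k) <= C0) ->
  forall k, nrm2 (fun a => coarse k a - euler h k./2 a) <= h' * c * C0.
Proof.
move=> Hc c0 h1 HC k.
have C00 : 0 <= C0 by apply: le_trans (HC 0%N); exact: nrm2_ge0.
have h'1 : h' <= 1 by rewrite /h' ler_pdivrMr//; lra.
have [j [kE|kE]] : exists j, k = j.*2 \/ k = j.*2.+1 by exists k./2; lia.
  rewrite kE half_double coarse_double /mean_sqnorm big1 ?mulr_ge0//.
  by move=> a _; rewrite subrr ip0l.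
rewrite kE /= uphalf_double half_double coarse_double.
  have -> : (fun a => euler h j a + gstep (s j.*2) (s j.*2.+1) (euler h j) a - euler h j a) =
      (fun a => (fun _ : 'I_n => 0) a + gstep (s j.*2) (s j.*2.+1) (euler h j) a).
    by apply/funext => a; rewrite addrAC subrr.
  have := Hc (s j.*2) (s j.*2.+1) (fun=> 0) (euler h j).
  rewrite s_step => H; apply: (le_trans (H _ _ _ _ _)) => //.
  - exact: s_ge0.
  - exact: s_le.
  - by move=> a; exact: (ad_cst hF 0 (s_ge0 _)).
  - by move=> a; have := half_euler_ad j.*2 a; rewrite half_double.
  rewrite {1}/mean_sqnorm big1 ?mulr0 ?add0r; last by move=> a _; rewrite ip0l.
  by rewrite ler_wpM2l// mulr_ge0.
Qed.

(** Discrete Gronwall for D, the scheme of step h / 2 minus [coarse]. Its increments are driven by e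
    = D + r, where [coarse_residual] makes the lag [r] of order h in mean square, and so is the
    accumulated difference. *)
Lemma coupling_bound (c C0 : R) :
  (forall t r y e, 0 <= t -> t <= r -> r - t <= 1 ->
    (forall a, ad t (y a)) -> (forall a, ad t (e a)) ->
    nrm2 (fun a => y a + gstep t r e a) <= (1 + (r - t)) * nrm2 y + (r - t) * c * nrm2 e) ->
  0 <= c -> h <= 1 -> (forall k, nrm2 (euler h k) <= C0) ->
  forall t k, s k <= t -> nrm2 (fun a => euler h' k a - euler h k./2 a) <=
     (2 * c ^+ 2 * C0 * t * expR ((1 + 2 * c) * t) + c * C0) * h.
Proof.
move=> Hc c0 h1 HC.
have C00 : 0 <= C0 by apply: le_trans (HC 0%N); exact: nrm2_ge0.
have h'1 : h' <= 1 by rewrite /h' ler_pdivrMr//; lra.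
pose D k a := euler h' k a - coarse k a.
pose r k a := coarse k a - euler h k./2 a.
pose e k a := euler h' k a - euler h k./2 a.
have eE k : e k = (fun a => D k a + r k a) by apply/funext => a; rewrite /D /r addrA subrK.
have aD k a : ad (s k) (D k a).
  by apply: (adB hF); [exact: s_ge0|exact: (euler_ad hF hW)|exact: coarse_ad].
have ar k a : ad (s k) (r k a).
  by apply: (adB hF); [exact: s_ge0|exact: coarse_ad|exact: half_euler_ad].
have ae k a : ad (s k) (e k a).
  by apply: (adB hF); [exact: s_ge0|exact: (euler_ad hF hW)|exact: half_euler_ad].
have rB k : nrm2 (r k) <= h' * c * C0 by exact: coarse_residual.
have eB k : nrm2 (e k) <= 2 * nrm2 (D k) + 2 * (h' * c * C0).
  rewrite eE; apply: (le_trans (nrm2D _ _)).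
  - by move=> a; exact: ad_sqi (aD k a).
  - by move=> a; exact: ad_sqi (ar k a).
  by rewrite lerD2l ler_pM2l.
have DS k : D k.+1 = (fun a => D k a + gstep (s k) (s k.+1) (e k) a).
  apply/funext => a; rewrite /D /= /e gstepB opprD addrACA//.
(* |e|^2 <= 2 |D|^2 + 2 |r|^2 puts 2 c into the growth rate and 2 c^2 C0 h'^2 into the source. *)
have step k : nrm2 (D k.+1) <= (1 + (1 + 2 * c) * h') * nrm2 (D k) + h' * (h' * (2 * c ^+ 2 * C0)).
  rewrite DS; have := Hc (s k) (s k.+1) (D k) (e k); rewrite s_step => H.
  apply: (le_trans (H (s_ge0 k) (s_le (leqnSn k)) h'1 (aD k) (ae k))).
  have := eB k => HeB.
  have : h' * c * nrm2 (e k) <= h' * c * (2 * nrm2 (D k) + 2 * (h' * c * C0)).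
    by rewrite ler_wpM2l// mulr_ge0.
  rewrite expr2; lra.
pose B := 1 + 2 * c; have B0 : 0 <= B by rewrite addr_ge0// mulr_ge0.
pose B' := 2 * c ^+ 2 * C0; have B'0 : 0 <= B' by rewrite !mulr_ge0// sqr_ge0.
(* The source h'^2 B' in each of the s / h' steps adds up to h' B' s, amplified by at most exp(B
   s). *)
have DB k : nrm2 (D k) <= h' * B' * (s k * expR (B * s k)).
  elim: k => [|k IH].
    rewrite /mean_sqnorm big1 ?mulr_ge0 ?expR_ge0 ?s_ge0//.
    by move=> a _; rewrite /D /= subrr ip0l.
  apply: (le_trans (step k)); rewrite -/B -/B'.
  have sS : s k.+1 = s k + h' by rewrite -(s_step k); ring.
  have e1 : 1 + B * h' <= expR (B * h') by exact: expR_ge1Dx.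
  have eS : expR (B * s k.+1) = expR (B * s k) * expR (B * h') by rewrite sS mulrDr expRD.
  have e2 : 1 <= expR (B * s k.+1) by rewrite -expR0 ler_expR mulr_ge0// s_ge0.
  apply: (@le_trans _ _ (expR (B * h') * (h' * B' * (s k * expR (B * s k))) + h' * (h' * B') * expR (B * s k.+1))).
    apply: lerD.
      apply: ler_pM => //; first by rewrite addr_ge0// mulr_ge0.
      exact: nrm2_ge0.
    by rewrite ler_peMr// !mulr_ge0.
  by rewrite eS sS le_eqVlt; apply/orP; left; apply/eqP; ring.
move=> t k kt; have t0 : 0 <= t by apply: le_trans kt; exact: s_ge0.
apply: (le_trans (eB k)); rewrite -/B -/B'.
have : s k * expR (B * s k) <= t * expR (B * t).
  apply: ler_pM => //; first exact: s_ge0.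
  by rewrite ler_expR ler_wpM2l.
move=> H; have : h' * B' * (s k * expR (B * s k)) <= h' * B' * (t * expR (B * t)).
  by rewrite ler_wpM2l// mulr_ge0.
have hh : h = 2 * h' by rewrite /h'; field.
have := DB k; rewrite [in X in _ -> _ -> X]hh; lra.
Qed.
End fix_h.
End coupling.

(** * Convergence of the Euler scheme *)

Section cvg2_more.
Context d (T : measurableType d) (R : realType) (mu : {measure set T -> \bar R}).

Lemma cvg2D (X Y : nat -> T -> R) L L' :
  (forall m, sqi mu (X m)) -> (forall m, sqi mu (Y m)) -> sqi mu L -> sqi mu L' ->
  cvg2 mu X L -> cvg2 mu Y L' -> cvg2 mu (fun m => X m + Y m) (L + L').
Proof.
move=> sX sY sL sL' XL YL.
apply: (@cvg0_le _ _ (fun m => ip mu (X m - L) (X m - L) + ip mu (Y m - L') (Y m - L')) 2).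
  move=> m; rewrite ip_ge0/= mulrDr opprD addrACA.
  by apply: ip_normD; exact: sqiB.
by rewrite -[X in _ --> X](addr0 0); exact: cvgD.
Qed.

Lemma cvg2_cst L : cvg2 mu (fun=> L) L.
Proof. by rewrite /cvg2 subrr ip0l; exact: cvg_cst. Qed.

Lemma cvg2_sum q (X : 'I_q -> nat -> T -> R) L :
  (forall i m, sqi mu (X i m)) -> (forall i, sqi mu (L i)) ->
  (forall i, cvg2 mu (X i) (L i)) -> cvg2 mu (fun m => \sum_i X i m) (\sum_i L i).
Proof.
move=> sX sL XL.
suff H (r : seq 'I_q) : cvg2 mu (fun m => \sum_(i <- r) X i m) (\sum_(i <- r) L i) by exact: H.
elim: r => [|i r IH]; first by under eq_fun do rewrite big_nil; rewrite big_nil; exact: cvg2_cst.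
under eq_fun do rewrite big_cons.
by rewrite big_cons; apply: cvg2D => // *; exact: sqi_sum.
Qed.

Lemma cvg2_unique (X : nat -> T -> R) L L' : (forall m, sqi mu (X m)) -> sqi mu L -> sqi mu L' ->
  cvg2 mu X L -> cvg2 mu X L' -> {ae mu, forall z, L z = L' z}.
Proof.
move=> sX sL sL' XL XL'.
have : cvg2 mu (fun=> L) L'.
  apply: (cvg2_dist sL' (fun=> sL) sX _ XL').
  have E : (fun m => ip mu (L - X m) (L - X m)) = (fun m => ip mu (X m - L) (X m - L)).
    by apply/funext => m; rewrite -(opprB (X m)) ipNl ?ipNr ?opprK//; do ?apply: sqiN; exact: sqiB.
  by rewrite E.
rewrite /cvg2 => /(cvg_unique (@Rhausdorff R) (cvg_cst _)) H.
have sLL : sqi mu (L - L') by exact: sqiB.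
apply: filterS (ip_eq0 sLL H) => z /eqP.
by rewrite !fun_ringE subr_eq0 => /eqP.
Qed.

Lemma cvg2_rate (X : nat -> T -> R) L (C : R) :
  (forall m, ip mu (X m - L) (X m - L) <= C * 2^-1 ^+ m) -> cvg2 mu X L.
Proof.
move=> H; apply: (@cvg0_le _ _ (fun m => 2^-1 ^+ m) C); first by move=> m; rewrite ip_ge0 H.
by apply: cvg_expr; rewrite ger0_norm ?invr_ge0// invf_lt1// ltr1n.
Qed.

Lemma ip_sub_sym (X Y : T -> R) : sqi mu X -> sqi mu Y -> ip mu (X - Y) (X - Y) = ip mu (Y - X) (Y - X).
Proof. by move=> sX sY; rewrite -(opprB Y) ipNl ?ipNr ?opprK//; do ?apply: sqiN; exact: sqiB. Qed.
End cvg2_more.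

Section sections.
Context (R : realType) d (T : measurableType d) (P : probability T R).
Local Notation leb := (@lebesgue_measure R).
Local Notation nu := (nu P).

(** The bound is asked at positive times only: step processes on intervals open on the left vanish
    at time 0, where they may differ from what they approximate. That slice is a null set. *)
Lemma section_bound (h : R * T -> R) (t c : R) : measurable_fun [set: R * T] h ->
  0 <= t -> 0 <= c -> (forall s w, ~~ (0 <= s <= t) -> h (s, w) = 0) ->
  (forall s, 0 < s <= t -> (\int[P]_w ((h (s, w)) ^+ 2)%:E <= c%:E)%E) ->
  sqi nu h /\ ip nu h h <= t * c.
Proof.
move=> mh t0 c0 hout hc.
have m2 : measurable_fun [set: R * T] (fun z => ((h z) ^+ 2)%:E).
  by apply/measurable_EFinP; exact: measurable_funX.
have bnd : (\int[nu]_z ((h z) ^+ 2)%:E <= (t * c)%:E)%E.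
  rewrite fubini_tonelli1//; last by move=> z; rewrite lee_fin sqr_ge0.
  apply: (@le_trans _ _ (\int[leb]_s (c * \1_(`[0%R, t] : set R) s)%:E)%E); last first.
    under eq_integral do rewrite EFinM.
    rewrite ge0_integralZl_EFin//; last by apply/measurable_EFinP; exact: measurable_indic.
    rewrite integral_indic//= setIT lebesgue_measure_itv/= lte_fin.
    case: ltP => [_|_]; first by rewrite -EFinB -EFinM lee_fin subr0 mulrC.
    by rewrite mule0 lee_fin mulr_ge0.
  apply: ae_ge0_le_integral => //.
  - by move=> s _; apply: integral_ge0 => w _; rewrite lee_fin sqr_ge0.
  - apply: (@measurable_fun_fubini_tonelli_F _ _ _ _ _ P (fun z => ((h z) ^+ 2)%:E)) => //.
    by move=> z; rewrite lee_fin sqr_ge0.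
  - by move=> s _; rewrite lee_fin mulr_ge0.
  - by apply/measurable_EFinP; apply: measurable_funM => //; exact: measurable_indic.
  exists [set 0]; split => //; first exact: lebesgue_measure_set1.
  move=> s /= H; apply: contrapT => s0; apply: H => _.
  rewrite indicE mem_cc; case: (boolP (0 <= s <= t)) => st; last first.
    rewrite mulr0 /fubini_F (eq_integral (cst 0%E)) ?integral0// => w _.
    by rewrite hout// expr0n.
  rewrite mulr1; apply: hc; case/andP : st => s_ge0 ->; rewrite andbT lt_neqAle s_ge0 andbT.
  by apply/eqP => E; apply: s0.
have sh : sqi nu h by apply/sqiP => //; apply: le_lt_trans bnd _; rewrite ltry.
by split=> //; rewrite -lee_fin ip_normE.
Qed.

Lemma ip_indic_cc_oc (t a b : R) : 0 <= a -> a <= b -> b <= t ->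
  ip leb \1_(`[0, t] : set R) \1_(`]a, b] : set R) = b - a.
Proof.
move=> a0 ab bt; rewrite /ip /Rintegral.
have -> : (\int[leb]_z (\1_(`[0%R, t] : set R) z * \1_(`]a, b] : set R) z)%:E =
    \int[leb]_z (\1_(`]a, b] : set R) z)%:E)%E.
  apply: eq_integral => z _; rewrite !indicE mem_cc mem_oc -natrM mulnb.
  case: (boolP (a < z <= b)); last by rewrite andbF.
  by move=> /andP[az zb]; rewrite (le_trans zb bt) (le_trans a0 (ltW az)).
rewrite integral_indic//= setIT lebesgue_measure_itv/= lte_fin.
by case: ltP => [_|ba]; rewrite -?EFinB//=; apply/eqP; rewrite eq_sym subr_eq0 eq_le ab ba.
Qed.
End sections.

Section drift.
Context (R : realType) d (T : measurableType d) (P : probability T R).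
Context (F : R -> set (set T)).
Hypothesis hF : right_continuous_complete_filtration P F.
Local Notation leb := (@lebesgue_measure R).
Local Notation nu := (nu P).

(** A step sum against the clock in place of a Wiener coordinate, so that drift and noise of the
    scheme come from step processes of the same kind. *)
Definition time_stepint (S : @step_process R d T) : T -> R := step_integral (fun s w => s) S.

(** On each path the step sum is the integral of the step function over [0, t], so Cauchy-Schwarz
    applies to a single integral. *)
Lemma prim_step_dist t (f : R -> T -> R) (S : @step_process R d T) : 0 <= t ->
  sqi nu (tcut t f) -> adapted_step_process P F t S ->
  sqi P (time_stepint S) /\
  ip P (prim f t - time_stepint S) (prim f t - time_stepint S) <= t * ip nu (tcut t f - stepfun S) (tcut t f - stepfun S).
Proof.
move=> t0 sf aS; have tt : 0 <= t <= t by rewrite t0 lexx.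
have sS := sqi_stepfun hF aS; have sd := sqiB sf sS.
have sTI : sqi P (time_stepint S).
  have -> : time_stepint S = \sum_(k < steps S) (node S k.+1 - node S k) *: coef S k.
    by apply/funext => w; rewrite fct_sumE; apply: eq_bigr => k _; rewrite mulrC.
  by apply: sqi_sum => k _; apply: sqiZ; exact: ad_sqi (coef_ad hF aS (ltn_ord k)).
split=> //; have sp := sqi_prim t0 sf tt.
have [_ iE eE] := Rfubini2 (sqiM sd sd).
rewrite [X in _ <= t * X]eE -(RintegralZl _ measurableT iE) -lee_fin ip_normE; last exact: sqiB.
rewrite fineK; last first.
  by apply: integrable_fin_num => //; exact: (integrableZl measurableT t iE).
apply: ae_ge0_le_integral => //.
- by move=> w _; rewrite lee_fin sqr_ge0.
- by apply/measurable_EFinP/measurable_funX; exact: sqi_meas (sqiB sp sTI).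
- move=> w _; rewrite lee_fin mulr_ge0//; apply: Rintegral_ge0 => r _.
  by rewrite /= -expr2 sqr_ge0.
- by apply/measurable_EFinP; apply: measurable_funM => //; exact: L1fun_meas iE.
apply: filterS2 (sqi_slice sd) (sqi_slice sf) => w sw sfw _; rewrite lee_fin.
have soc (a b : R) := @sqi_indic_itv R a b.
have sterm k : sqi leb (coef S k w *: \1_(`]node S k, node S k.+1] : set R)) by exact: sqiZ.
have sSw : sqi leb (fun r => stepfun S (r, w)).
  rewrite (_ : (fun r => _) = \sum_(k < steps S) (coef S k w *: \1_(`]node S k, node S k.+1] : set R))).
    exact: sqi_sum.
  by apply/funext => r; rewrite fct_sumE.
have TIE : time_stepint S w = ip leb \1_(`[0, t] : set R) (fun r => stepfun S (r, w)).
  rewrite (_ : (fun r => _) = \sum_(k < steps S) (coef S k w *: \1_(`]node S k, node S k.+1] : set R))).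
    rewrite ip_sumr//; last exact: sqi_indic_cc.
    apply: eq_bigr => k _; rewrite ipZr//; last exact: sqi_indic_cc.
    rewrite ip_indic_cc_oc//.
    - by apply: (node_ge0 aS); exact: ltnW.
    - exact: (step_mono aS).
    - exact: (node_le_end aS).
  by apply/funext => r; rewrite fct_sumE.
rewrite !fun_ringE (@primE _ _ _ t)// TIE -ipBr//; last exact: sqi_indic_cc.
apply: le_trans (ip_CS (sqi_indic_cc 0 t) sw) _.
by rewrite ip_indic_cc.
Qed.
End drift.

(** * The limit of the dyadic schemes and its equation *)

Section limit.
Context (R : realType) d (T : measurableType d) (P : probability T R).
Context (F : R -> set (set T)) (q : nat) (K : 'M[R]_q) (W : R -> T -> 'cV[R]_q).
Hypothesis hF : right_continuous_complete_filtration P F.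
Hypothesis hW : wiener_process P F K W.
Variables (n : nat) (A : 'M[R]_n) (N : 'I_q -> 'M[R]_n) (x0 : 'cV[R]_n).
Local Notation leb := (@lebesgue_measure R).
Local Notation nu := (nu P).
Local Notation ad := (ad P F).
Local Notation gstep := (euler_incr W A N).
Local Notation euler := (euler_scheme W A N x0).
Local Notation nrm2 := (mean_sqnorm P).

Variables (delta h0 C0 c : R).
Hypothesis delta0 : 0 < delta.
Hypothesis h00 : 0 < h0.
Hypothesis h01 : h0 <= 1.
Hypothesis dh0 : delta * h0 <= 1.
Hypothesis C00 : 0 <= C0.
Hypothesis stable : forall h k, 0 <= h -> h <= h0 -> nrm2 (euler h k) <= C0 * (1 - delta * h) ^+ k.
Hypothesis c0 : 0 <= c.
Hypothesis gstep_c : forall t r (y e : 'I_n -> T -> R), 0 <= t -> t <= r -> r - t <= 1 ->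
    (forall a, ad t (y a)) -> (forall a, ad t (e a)) ->
    nrm2 (fun a => y a + gstep t r e a) <= (1 + (r - t)) * nrm2 y + (r - t) * c * nrm2 e.

Definition mesh (m : nat) : R := h0 * 2^-1 ^+ m.

Lemma mesh_gt0 m : 0 < mesh m.
Proof. by rewrite mulr_gt0// exprn_gt0// invr_gt0. Qed.

Lemma mesh_ge0 m : 0 <= mesh m. Proof. exact/ltW/mesh_gt0. Qed.

Lemma mesh_le m : mesh m <= h0.
Proof. by rewrite ler_piMr ?(ltW h00)// exprn_ile1// ?invr_ge0// invf_le1// ler1n. Qed.

Lemma meshS m : mesh m.+1 = mesh m / 2.
Proof. by rewrite /mesh exprSr mulrA. Qed.

Definition gridix m (t : R) := pred_ceil (t / mesh m).
(** The state at the last node strictly before [t], and the initial value at 0; it depends on the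
    past only and is constant on the cells of the step processes. *)
Definition euler_at m t : 'I_n -> T -> R := euler (mesh m) (gridix m t).

Lemma gridix_le m t : 0 <= t -> (gridix m t)%:R * mesh m <= t.
Proof. by move=> t0; rewrite -ler_pdivlMr ?mesh_gt0// pred_ceil_le// divr_ge0// mesh_ge0. Qed.

Lemma gridix_ge m t : 0 <= t -> t <= (gridix m t).+1%:R * mesh m.
Proof. by move=> t0; rewrite -ler_pdivrMr ?mesh_gt0// pred_ceil_ge// divr_ge0// mesh_ge0. Qed.

Lemma gridix_half m t : 0 <= t -> gridix m t = (gridix m.+1 t)./2.
Proof.
move=> t0; rewrite /gridix meshS pred_ceil_half; last by rewrite divr_ge0// mesh_ge0.
by congr ((pred_ceil _)./2); field; rewrite gt_eqF// mesh_gt0.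
Qed.

Lemma euler_at_ad m t a : 0 <= t -> ad t (euler_at m t a).
Proof.
move=> t0; have := euler_ad hF hW A N x0 (gridix m t) a (mesh_ge0 m).
by apply: (ad_le hF); [rewrite mulr_ge0// mesh_ge0|exact: gridix_le].
Qed.

Lemma euler_nrm2 m k : nrm2 (euler (mesh m) k) <= C0.
Proof.
apply: (le_trans (stable k (mesh_ge0 m) (mesh_le m))).
have dh : delta * mesh m <= 1 by apply: le_trans dh0; rewrite ler_pM2l// mesh_le.
rewrite ler_piMr// exprn_ile1//; first by rewrite subr_ge0.
by rewrite gerBl mulr_ge0 ?mesh_ge0// ltW.
Qed.

(** 1 - delta h <= exp(- delta h), and the node in use is at least t - h; as delta h <= 1, the
    factor e pays for the missing h. *)
Lemma euler_at_decay m t : 0 <= t -> nrm2 (euler_at m t) <= C0 * expR 1 * expR (- delta * t).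
Proof.
move=> t0; apply: (le_trans (stable _ (mesh_ge0 m) (mesh_le m))).
rewrite -mulrA ler_wpM2l// -expRD.
have dh : delta * mesh m <= 1 by apply: le_trans dh0; rewrite ler_pM2l// mesh_le.
apply: (@le_trans _ _ (expR (- (delta * mesh m)) ^+ gridix m t)).
  by apply: lerXn2r; rewrite ?nnegrE ?expR_ge0 ?subr_ge0//; exact: expR_ge1Dx.
rewrite -expRM_natl ler_expR.
have := gridix_ge m t0; rewrite -natr1 mulrDl mul1r => H.
have : delta * t <= delta * ((gridix m t)%:R * mesh m + mesh m) by rewrite ler_pM2l.
lra.
Qed.

(** The bound of [coupling_bound] at the largest step h0; m halvings supply the factor 2^-m. *)
Definition rate t : R := (2 * c ^+ 2 * C0 * t * expR ((1 + 2 * c) * t) + c * C0) * h0.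

Lemma rate_ge0 t : 0 <= t -> 0 <= rate t.
Proof.
move=> t0; apply: mulr_ge0; last exact: ltW.
by rewrite addr_ge0 ?mulr_ge0 ?expR_ge0 ?sqr_ge0.
Qed.

Lemma euler_at_diff m s t : 0 <= s -> s <= t ->
  nrm2 (fun a => euler_at m.+1 s a - euler_at m s a) <= rate t * 2^-1 ^+ m.
Proof.
move=> s0 st; rewrite /euler_at [gridix m s]gridix_half// meshS.
have h1 : mesh m <= 1 by exact: le_trans (mesh_le m) h01.
have := @coupling_bound _ _ _ _ _ _ _ _ hF hW _ A N x0 _ (mesh_ge0 m) c C0 gstep_c c0 h1 (euler_nrm2 m) t (gridix m.+1 s).
rewrite -meshS => H; apply: (le_trans (H _)).
  by apply: le_trans st; exact: gridix_le.
by rewrite /rate /mesh mulrA.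
Qed.

(** The scheme is constant in time on each cell, so preimages are countable unions of rectangles. *)
Lemma measurable_euler_at m a : measurable_fun [set: R * T] (fun z : R * T => euler_at m z.1 a z.2).
Proof.
move=> _ B mB; rewrite setTI.
have -> : (fun z : R * T => euler_at m z.1 a z.2) @^-1` B =
    \bigcup_k ([set s | gridix m s = k] `*` (euler (mesh m) k a @^-1` B)).
  apply/seteqP; split=> -[s w] /=; first by move=> H; exists (gridix m s).
  by move=> [k _ [/= <-]].
apply: bigcupT_measurable => k; apply: measurableX; first exact: measurable_pred_ceil.
have := sqi_meas (ad_sqi (euler_ad hF hW A N x0 k a (mesh_ge0 m))).
by move=> /(_ measurableT B mB); rewrite setTI.
Qed.

(** Defined at every (t, w), so that adaptedness and joint measurability pass from the schemes
    through [rlim]; that it is a true limit is known almost surely at each time. *)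
Definition sde_limit (a : 'I_n) (t : R) : T -> R := fun w => rlim (fun m => euler_at m t a w).

Lemma euler_at_rapid m s t a : 0 <= s -> s <= t ->
  ip P (euler_at m.+1 s a - euler_at m s a) (euler_at m.+1 s a - euler_at m s a) <= rate t * 2^-1 ^+ m.
Proof.
move=> s0 st; apply: le_trans (euler_at_diff m s0 st).
exact: (ip_le_nrm2 P (fun a => euler_at m.+1 s a - euler_at m s a)).
Qed.

Lemma euler_at_limit s t a : 0 <= s -> s <= t ->
  [/\ sqi P (sde_limit a s), {ae P, forall w, (fun m => euler_at m s a w) @ \oo --> sde_limit a s w} &
    forall m, ip P (sde_limit a s - euler_at m s a) (sde_limit a s - euler_at m s a) <= 12 * rate t * 2^-1 ^+ m].
Proof.
move=> s0 st.
apply: (@rapid_limit _ _ _ P (fun m => euler_at m s a) (rate t)) => m.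
  exact: ad_sqi (euler_at_ad m a s0).
exact: euler_at_rapid.
Qed.

Lemma sde_limit_ad s a : 0 <= s -> ad s (sde_limit a s).
Proof.
move=> s0; split; last by have [] := euler_at_limit a s0 (lexx s).
apply/(measurable_atP hF _ s0).
apply: (@measurable_rlim _ _ (g_sigma_algebraType (F s)) (fun m => euler_at m s a)) => m.
by apply/(measurable_atP hF _ s0); case: (euler_at_ad m a s0).
Qed.

Lemma measurable_sde_limit a : measurable_fun [set: R * T] (fun z : R * T => sde_limit a z.1 z.2).
Proof.
apply: (@measurable_rlim _ _ _ (fun m (z : R * T) => euler_at m z.1 a z.2)) => m.
exact: measurable_euler_at.
Qed.

Lemma sde_limit_cvg2 s a : 0 <= s -> cvg2 P (fun m => euler_at m s a) (sde_limit a s).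
Proof.
move=> s0; have [sX _ H] := euler_at_limit a s0 (lexx s).
apply: (@cvg2_rate _ _ _ _ _ _ (12 * rate s)) => m.
by rewrite ip_sub_sym//; exact: ad_sqi (euler_at_ad m a s0).
Qed.

Lemma sde_limit_decay s a : 0 <= s -> ip P (sde_limit a s) (sde_limit a s) <= C0 * expR 1 * expR (- delta * s).
Proof.
move=> s0; have [sX _ _] := euler_at_limit a s0 (lexx s).
have sxm m : sqi P (euler_at m s a) := ad_sqi (euler_at_ad m a s0).
have cv := ip_cvg sX sX sxm sxm (sde_limit_cvg2 a s0) (sde_limit_cvg2 a s0).
rewrite -(cvg_lim _ cv)//; apply: limr_le; first by apply/cvg_ex; exists (ip P (sde_limit a s) (sde_limit a s)).
apply: nearW => m; apply: le_trans (euler_at_decay m s0).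
exact: (ip_le_nrm2 P (euler_at m s)).
Qed.

(** The option type lists [A] as [None] and [N j] as [Some j], to get one constant for all
    coefficients. *)
Lemma lin_norm_bound : exists2 cl : R, 0 <= cl & forall (i : option 'I_q) y a, (forall b, sqi P (y b)) ->
  ip P (lin (if i is Some j then N j else A) y a) (lin (if i is Some j then N j else A) y a) <= cl * nrm2 y.
Proof.
have /choice[cl Hcl] : forall i : option 'I_q, exists cl : R, 0 <= cl /\ forall y : 'I_n -> T -> R, (forall b, sqi P (y b)) ->
   `|\sum_a ip P (lin (if i is Some j then N j else A) y a) (lin (if i is Some j then N j else A) y a)| <= cl * nrm2 y.
  move=> i; have [cl h1 h2] := lin_bound P (if i is Some j then N j else A) (if i is Some j then N j else A).
  by exists cl.
exists (\sum_i cl i); first by apply: sumr_ge0 => i _; case: (Hcl i).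
move=> i y a sy; have [cl0 H] := Hcl i.
apply: (@le_trans _ _ (cl i * nrm2 y)); last first.
  rewrite ler_wpM2r ?nrm2_ge0// (bigD1 i)//= lerDl; apply: sumr_ge0 => j _.
  by case: (Hcl j).
apply: le_trans (H y sy); apply: le_trans (ler_norm _).
exact: (ip_le_nrm2 P (lin (if i is Some j then N j else A) y)).
Qed.

Section ito.
Variable M : 'M[R]_n.
Variable cl : R.
Hypothesis cl0 : 0 <= cl.
Hypothesis Hcl : forall y a, (forall b, sqi P (y b)) ->
  ip P (lin M y a) (lin M y a) <= cl * nrm2 y.

(** One step more than the grid index, with nodes capped at [t]: the last node is then [t] itself,
    even when the last step is unfinished. *)
Definition euler_steps (t : R) (m : nat) (a : 'I_n) : @step_process R d T :=
  StepProcess (gridix m t).+1 (fun k => Num.min (k%:R * mesh m) t)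
    (fun k => lin M (euler (mesh m) k) a).

Lemma node_small t m k : 0 <= t -> (k < (gridix m t).+1)%N -> k%:R * mesh m <= t.
Proof.
move=> t0 kg; apply: le_trans (gridix_le m t0).
by rewrite ler_wpM2r ?mesh_ge0// ler_nat.
Qed.

Lemma euler_steps_adapted t m a : 0 <= t -> adapted_step_process P F t (euler_steps t m a).
Proof.
move=> t0; have cad k : (k < (gridix m t).+1)%N -> ad (Num.min (k%:R * mesh m) t) (lin M (euler (mesh m) k) a).
  move=> kg; rewrite min_l; last exact: node_small.
  apply: (lin_ad hF) => [|b]; first by rewrite mulr_ge0// mesh_ge0.
  by apply: (euler_ad hF hW); exact: mesh_ge0.
split=> /=.
- by rewrite mul0r min_l.
- by rewrite min_r//; exact: gridix_ge.
- by move=> k kg; rewrite le_min2// ler_wpM2r ?mesh_ge0// ler_nat.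
- by move=> k /cad[].
- by move=> k /cad[_ sk]; apply/sqiP => //; exact: sqi_meas sk.
Qed.

Lemma euler_steps_value t m a s w : 0 < s <= t -> step_value (euler_steps t m a) s w = lin M (euler_at m s) a w.
Proof.
move=> /andP[s0 st]; have hp := mesh_gt0 m.
have sh : 0 < s / mesh m by rewrite divr_gt0.
have /andP[g1 g2] := pred_ceilP sh.
have gle : (gridix m s <= gridix m t)%N.
  have t0 : 0 < t by exact: lt_le_trans st.
  have th : 0 < t / mesh m by rewrite divr_gt0.
  have /andP[_ g4] := pred_ceilP th.
  rewrite -ltnS -(ltr_nat R); apply: lt_le_trans g4; apply: (lt_le_trans g1).
  by rewrite ler_pM2r// invr_gt0.
have glt : (gridix m s < (gridix m t).+1)%N by [].
rewrite /step_value /= (bigD1 (Ordinal glt))//= indicE mem_oc.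
have -> : (Num.min ((gridix m s)%:R * mesh m) t < s <= Num.min ((gridix m s).+1%:R * mesh m) t).
  rewrite gt_min le_min st andbT -ltr_pdivlMr// g1 /= -ler_pdivrMr//.
rewrite mulr1 big1 ?addr0// => k /eqP kne; rewrite indicE mem_oc.
case: (boolP (_ < _ <= _)); last by rewrite mulr0.
rewrite gt_min le_min => /andP[/orP[k1|k1] /andP[k2 _]]; last by rewrite ltNge st in k1.
exfalso; apply: kne; apply: val_inj => /=; apply/esym/pred_ceil_uniq.
by rewrite ltr_pdivlMr// k1 /= ler_pdivrMr.
Qed.

Definition lin_limit (a : 'I_n) (s : R) : T -> R := lin M (fun b => sde_limit b s) a.

Lemma lin_limit_sqi a s : 0 <= s -> sqi P (lin_limit a s).
Proof. by move=> s0; apply: lin_sqi => b; exact: ad_sqi (sde_limit_ad b s0). Qed.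

Lemma lin_funE (y : 'I_n -> T -> R) a w : lin M y a w = \sum_b M b a * y b w.
Proof. by rewrite /lin fct_sumE. Qed.

Lemma measurable_lin_limit a : measurable_fun [set: R * T] (fun z : R * T => lin_limit a z.1 z.2).
Proof.
rewrite (_ : (fun z => _) = \sum_b M b a *: (fun z : R * T => sde_limit b z.1 z.2)).
  elim/big_ind: _ => [|f g mf mg|b _]; first exact: measurable_cst.
    exact: measurable_funD.
  by apply: measurable_funM => //; exact: measurable_sde_limit.
by apply/funext => z; rewrite fct_sumE /lin_limit lin_funE.
Qed.

Lemma measurable_tcut_lin_limit t a : measurable_fun [set: R * T] (tcut t (fun s => lin_limit a s)).
Proof.
apply: measurable_funM; first exact: measurable_lin_limit.
by apply: measurableT_comp => //; exact: measurable_indic.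
Qed.

Lemma lin_limit_dist t s m a : 0 <= s -> s <= t ->
  ip P (lin_limit a s - lin M (euler_at m s) a) (lin_limit a s - lin M (euler_at m s) a) <= cl * (n%:R * (12 * rate t * 2^-1 ^+ m)).
Proof.
move=> s0 st; rewrite /lin_limit -linB; apply: (le_trans (Hcl _ _)).
  by move=> b; apply: sqiB; [exact: ad_sqi (sde_limit_ad b s0)|exact: ad_sqi (euler_at_ad m b s0)].
rewrite ler_wpM2l// /mean_sqnorm; apply: (@le_trans _ _ (\sum_(a < n) (12 * rate t * 2^-1 ^+ m))).
  by apply: ler_sum => b _; have [_ _ H] := euler_at_limit b s0 st.
by rewrite sumr_const card_ord [n%:R * _]mulr_natl.
Qed.

Lemma sqi_tcut_lin_limit t a : 0 <= t -> sqi nu (tcut t (fun s => lin_limit a s)).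
Proof.
move=> t0; pose B := cl * (n%:R * (C0 * expR 1)).
have [] // := @section_bound _ _ _ P (tcut t (fun s => lin_limit a s)) t B.
- exact: measurable_tcut_lin_limit.
- by rewrite !mulr_ge0// expR_ge0.
- by move=> s w st; rewrite cut_out.
move=> s /andP[s0 st]; have s0' := ltW s0.
have -> : (\int[P]_w ((tcut t (fun s => lin_limit a s) (s, w)) ^+ 2)%:E = \int[P]_w ((lin_limit a s w) ^+ 2)%:E)%E.
  by apply: eq_integral => w _; rewrite /tcut /= indicE mem_cc s0' st mulr1.
rewrite -ip_normE ?lee_fin; last exact: lin_limit_sqi.
apply: (le_trans (Hcl _ _)); first by move=> b; exact: ad_sqi (sde_limit_ad b s0').
rewrite ler_wpM2l//; apply: (@le_trans _ _ (\sum_(a < n) (C0 * expR 1))).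
  apply: ler_sum => b _; apply: (le_trans (sde_limit_decay b s0')).
  rewrite ler_piMr ?mulr_ge0 ?expR_ge0// -expR0 ler_expR mulNr oppr_le0 mulr_ge0// ltW//.
by rewrite sumr_const card_ord [n%:R * _]mulr_natl.
Qed.

Lemma euler_steps_cvg t a : 0 <= t -> cvg2 nu (fun m => stepfun (euler_steps t m a)) (tcut t (fun s => lin_limit a s)).
Proof.
move=> t0; pose B m := cl * (n%:R * (12 * rate t * 2^-1 ^+ m)).
apply: (@cvg2_rate _ _ _ _ _ _ (t * (cl * (n%:R * (12 * rate t))))) => m.
have aS := euler_steps_adapted m a t0; have sS := sqi_stepfun hF aS; have sl := sqi_tcut_lin_limit a t0.
rewrite (ip_sub_sym sS sl).
have -> : t * (cl * (n%:R * (12 * rate t))) * 2^-1 ^+ m = t * B m by rewrite /B; ring.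
have [] // := @section_bound _ _ _ P (tcut t (fun s => lin_limit a s) - stepfun (euler_steps t m a)) t (B m).
- exact: sqi_meas (sqiB sl sS).
- have r0 := rate_ge0 t0; have p0 : 0 <= 2^-1 ^+ m :> R by rewrite exprn_ge0// invr_ge0.
  by rewrite /B mulr_ge0// mulr_ge0// mulr_ge0// mulr_ge0.
- by move=> s w st; rewrite !fun_ringE cut_out// (stepfun_out aS)// subr0.
move=> s /andP[s0 st]; have s0' := ltW s0.
have -> : (\int[P]_w (((tcut t (fun s => lin_limit a s) - stepfun (euler_steps t m a)) (s, w)) ^+ 2)%:E =
    \int[P]_w (((lin_limit a s - lin M (euler_at m s) a) w) ^+ 2)%:E)%E.
  apply: eq_integral => w _; rewrite !fun_ringE /stepfun /= euler_steps_value ?s0//.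
  by rewrite /tcut /= indicE mem_cc s0' st mulr1.
rewrite -ip_normE ?lee_fin; first exact: lin_limit_dist.
by apply: sqiB; [exact: lin_limit_sqi|apply: lin_sqi => b; exact: ad_sqi (euler_at_ad m b s0')].
Qed.

(** The isometry carries the geometric rate from integrands to step integrals, so [rapid_limit]
    applies to these as well. *)
Lemma euler_steps_rapid i t m a : 0 <= t ->
  ip P (stepint W i (euler_steps t m.+1 a) - stepint W i (euler_steps t m a)) (stepint W i (euler_steps t m.+1 a) - stepint W i (euler_steps t m a)) <=
  (K i i * (t * (cl * rate t))) * 2^-1 ^+ m.
Proof.
move=> t0; have aS := euler_steps_adapted m a t0; have aS' := euler_steps_adapted m.+1 a t0.
rewrite (step_isometry_dist hF hW i aS' aS).
have Kii : 0 <= K i i.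
  by have := W_cov hW i i ler01; rewrite mulr1 => <-; exact: ip_ge0.
rewrite -mulrA ler_wpM2l//.
have sS := sqi_stepfun hF aS; have sS' := sqi_stepfun hF aS'.
rewrite -mulrA.
have [] // := @section_bound _ _ _ P (stepfun (euler_steps t m.+1 a) - stepfun (euler_steps t m a)) t (cl * rate t * 2^-1 ^+ m).
- exact: sqi_meas (sqiB sS' sS).
- have r0 := rate_ge0 t0; have p0 : 0 <= 2^-1 ^+ m :> R by rewrite exprn_ge0// invr_ge0.
  by rewrite mulr_ge0// mulr_ge0.
- by move=> s w st; rewrite !fun_ringE (stepfun_out aS)// (stepfun_out aS')// subr0.
move=> s /andP[s0 st]; have s0' := ltW s0.
have -> : (\int[P]_w (((stepfun (euler_steps t m.+1 a) - stepfun (euler_steps t m a)) (s, w)) ^+ 2)%:E =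
    \int[P]_w (((lin M (fun b => euler_at m.+1 s b - euler_at m s b) a) w) ^+ 2)%:E)%E.
  apply: eq_integral => w _; rewrite linB !fun_ringE /stepfun /= !euler_steps_value ?s0//.
have sb b : sqi P (euler_at m.+1 s b - euler_at m s b).
  by apply: sqiB; exact: ad_sqi (euler_at_ad _ b s0').
rewrite -ip_normE ?lee_fin; last exact: lin_sqi.
by apply: (le_trans (Hcl _ sb)); rewrite -mulrA ler_wpM2l//; exact: euler_at_diff.
Qed.

Definition ito_limit i t a : T -> R := fun w => rlim (fun m => stepint W i (euler_steps t m a) w).

Lemma ito_limit_cvg2 i t a : 0 <= t -> sqi P (ito_limit i t a) /\ cvg2 P (fun m => stepint W i (euler_steps t m a)) (ito_limit i t a).
Proof.
move=> t0; have sSI m := sqi_stepint hF hW (euler_steps_adapted m a t0) i.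
have [sJ _ H] := @rapid_limit _ _ _ P (fun m => stepint W i (euler_steps t m a)) _ sSI (fun m => euler_steps_rapid i m a t0).
split=> //; apply: (@cvg2_rate _ _ _ _ _ _ (12 * (K i i * (t * (cl * rate t))))) => m.
by rewrite ip_sub_sym//; exact: H.
Qed.

Lemma is_ito_ito_limit i t a : 0 <= t ->
  is_ito_integral P F (fun s w => W s w i 0) (fun s => lin_limit a s) t (ito_limit i t a).
Proof.
move=> t0; have [sJ JS] := ito_limit_cvg2 i a t0.
have aS m := euler_steps_adapted m a t0.
have sSI m := sqi_stepint hF hW (aS m) i; have sS m := sqi_stepfun hF (aS m).
have sl := sqi_tcut_lin_limit a t0.
split; first exact: sqi_meas sJ.
exists (fun m => euler_steps t m a); split=> //.
- rewrite (_ : (fun m => _) = (fun m => \int[nu]_z ((tcut t (fun s => lin_limit a s) - stepfun (euler_steps t m a)) z ^+ 2)%:E)%E).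
    apply: (@cvge_sq _ _ _ nu (fun m => tcut t (fun s => lin_limit a s) - stepfun (euler_steps t m a)) (fun m => sqiB sl (sS m))).2.
    have := euler_steps_cvg a t0; rewrite /cvg2; under eq_fun do rewrite ip_sub_sym//.
    by [].
  apply/funext => m; rewrite (@iterated_sq _ _ _ _ t).
  + apply: eq_integral => w _; apply: eq_integral => s; rewrite inE/= in_itv/= => st.
    by rewrite (cut_sub_step _ _ (aS m)).
  + exact: (sqi_meas (sqiB sl (sS m))).
  + by move=> s w st; rewrite !fun_ringE cut_out// (stepfun_out (aS m))// subr0.
- apply: (@cvge_sq _ _ _ P (fun m => ito_limit i t a - stepint W i (euler_steps t m a)) (fun m => sqiB sJ (sSI m))).2.
  have := JS; rewrite /cvg2; under eq_fun do rewrite ip_sub_sym//.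
  by [].
Qed.
End ito.

Lemma euler_sum (h : R) k a :
  euler h k a = (fun=> x0 a 0) + \sum_(l < k) gstep (l%:R * h) (l.+1%:R * h) (euler h l) a.
Proof.
elim: k => [|k IH]; first by rewrite big_ord0 addr0.
by rewrite big_ord_recr addrA -IH.
Qed.

(** The scheme solves the integrated equation exactly, with step sums for integrals. The extra
    increment is the step unfinished at [t], since [euler_at] stops at the node before. *)
Lemma euler_steps_sum m t a : 0 <= t ->
  (fun=> x0 a 0) + time_stepint (euler_steps A t m a) + \sum_i stepint W i (euler_steps (N i) t m a) =
  euler_at m t a + gstep ((gridix m t)%:R * mesh m) t (euler_at m t) a.
Proof.
move=> t0; pose nd k := Num.min (k%:R * mesh m) t.
have TIE : time_stepint (euler_steps A t m a) = \sum_(k < (gridix m t).+1) (nd k.+1 - nd k) *: lin A (euler (mesh m) k) a.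
  by apply/funext => w; rewrite fct_sumE; apply: eq_bigr => k _; rewrite mulrC.
have E : time_stepint (euler_steps A t m a) + \sum_i stepint W i (euler_steps (N i) t m a) =
    \sum_(k < (gridix m t).+1) gstep (nd k) (nd k.+1) (euler (mesh m) k) a.
  have SE i : stepint W i (euler_steps (N i) t m a) = \sum_(k < (gridix m t).+1) lin (N i) (euler (mesh m) k) a \* dW W i (nd k) (nd k.+1).
    by rewrite stepintE.
  by rewrite TIE (eq_bigr _ (fun i _ => SE i)) exchange_big -big_split.
have nodeE k : (k <= gridix m t)%N -> nd k = k%:R * mesh m.
  move=> kg; rewrite /nd min_l//; apply: (node_small t0 (k := k)).
  by rewrite ltnS.
rewrite -addrA E big_ord_recr /= addrA; congr (_ + _).
  rewrite /euler_at euler_sum; congr (_ + _); apply: eq_bigr => k _.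
  by rewrite !nodeE// ltnW.
by rewrite nodeE// /nd min_r//; exact: gridix_ge.
Qed.

(** [gstep_c] started from 0 bounds the mean square of the unfinished step by the order of the
    mesh. *)
Lemma gstep_tail t a : 0 <= t ->
  (forall m, sqi P (gstep ((gridix m t)%:R * mesh m) t (euler_at m t) a)) /\
  cvg2 P (fun m => gstep ((gridix m t)%:R * mesh m) t (euler_at m t) a) 0.
Proof.
move=> t0; have g0 m : 0 <= (gridix m t)%:R * mesh m by rewrite mulr_ge0// mesh_ge0.
have gl m := gridix_le m t0.
have axm m b : ad ((gridix m t)%:R * mesh m) (euler_at m t b).
  exact: (euler_ad hF hW A N x0 (gridix m t) b (mesh_ge0 m)).
have sg m : sqi P (gstep ((gridix m t)%:R * mesh m) t (euler_at m t) a).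
  by apply: ad_sqi; exact: (gstep_ad hF hW).
split=> //; apply: (@cvg2_rate _ _ _ _ _ _ (h0 * c * C0)) => m; rewrite subr0.
have lenh : t - (gridix m t)%:R * mesh m <= mesh m.
  by have := gridix_ge m t0; rewrite -natr1 mulrDl mul1r; lra.
have len1 : t - (gridix m t)%:R * mesh m <= 1.
  by apply: (le_trans lenh); apply: le_trans h01; exact: mesh_le.
have := gstep_c (g0 m) (gl m) len1 (y := fun=> 0) (fun=> ad_cst hF 0 (g0 m)) (axm m).
rewrite {2}/mean_sqnorm big1 ?mulr0 ?add0r; last by move=> b _; rewrite ip0l.
move=> H; apply: (@le_trans _ _ (nrm2 (fun b => (fun _ : 'I_n => 0) b + gstep ((gridix m t)%:R * mesh m) t (euler_at m t) b))).
  have := ip_le_nrm2 P (fun b => (fun _ : 'I_n => 0) b + gstep ((gridix m t)%:R * mesh m) t (euler_at m t) b) a.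
  by rewrite /= add0r.
apply: (le_trans H); have E := euler_nrm2 m (gridix m t).
apply: (@le_trans _ _ (mesh m * c * C0)); last by rewrite /mesh le_eqVlt; apply/orP; left; apply/eqP; ring.
apply: ler_pM => //; first by rewrite mulr_ge0// subr_ge0.
  exact: nrm2_ge0.
by rewrite ler_wpM2r.
Qed.

(** Both sides of [euler_steps_sum] converge in mean square, and such limits agree almost
    everywhere. *)
Lemma sde_limit_equation t a : 0 <= t ->
  {ae P, forall w, sde_limit a t w = x0 a 0 + prim (fun s => lin_limit A a s) t w +
     \sum_i ito_limit (N i) i t a w}.
Proof.
move=> t0; have tt : 0 <= t <= t by rewrite t0 lexx.
have [cl cl0 Hcl] := lin_norm_bound.
have HA := Hcl None; have HN i := Hcl (Some i).
have sxm m : sqi P (euler_at m t a) := ad_sqi (euler_at_ad m a t0).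
have aSA m := euler_steps_adapted A m a t0.
have sl := sqi_tcut_lin_limit cl0 HA a t0.
have sp := sqi_prim t0 sl tt.
have sTI m : sqi P (time_stepint (euler_steps A t m a)) by have [] := prim_step_dist hF t0 sl (aSA m).
have cTI : cvg2 P (fun m => time_stepint (euler_steps A t m a)) (prim (fun s => lin_limit A a s) t).
  apply: (@cvg0_le _ _ (fun m => ip nu (stepfun (euler_steps A t m a) - tcut t (fun s => lin_limit A a s))
      (stepfun (euler_steps A t m a) - tcut t (fun s => lin_limit A a s))) t); last first.
    exact: (euler_steps_cvg cl0 HA a t0).
  move=> m; rewrite ip_ge0/= ip_sub_sym// [X in t * X]ip_sub_sym//.
    by have [] := prim_step_dist hF t0 sl (aSA m).
  exact: (sqi_stepfun hF (aSA m)).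
have sSI m i : sqi P (stepint W i (euler_steps (N i) t m a)).
  exact: (sqi_stepint hF hW (euler_steps_adapted (N i) m a t0) i).
have JL i := ito_limit_cvg2 cl0 (HN i) i a t0.
have sJ i : sqi P (ito_limit (N i) i t a) by case: (JL i).
have cJ i : cvg2 P (fun m => stepint W i (euler_steps (N i) t m a)) (ito_limit (N i) i t a) by case: (JL i).
have cS : cvg2 P (fun m => \sum_i stepint W i (euler_steps (N i) t m a)) (\sum_i ito_limit (N i) i t a).
  exact: cvg2_sum.
have [sg cg] := gstep_tail a t0.
have sX : sqi P (sde_limit a t) := ad_sqi (sde_limit_ad a t0).
have cX := sde_limit_cvg2 a t0.
have cL := cvg2D sxm sg sX (sqi0 P) cX cg.
have sc := sqi_cst P (x0 a 0).
have s1 m : sqi P ((fun=> x0 a 0) + time_stepint (euler_steps A t m a)) by exact: sqiD.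
have s2 m : sqi P (\sum_i stepint W i (euler_steps (N i) t m a)) by exact: sqi_sum.
have sp1 : sqi P ((fun=> x0 a 0) + prim (fun s => lin_limit A a s) t) by exact: sqiD.
have sJs : sqi P (\sum_i ito_limit (N i) i t a) by exact: sqi_sum.
have cR := cvg2D s1 s2 sp1 sJs (cvg2D (fun=> sc) sTI sc sp (cvg2_cst P (fun=> x0 a 0)) cTI) cS.
have EE : (fun m => (fun=> x0 a 0) + time_stepint (euler_steps A t m a) + \sum_i stepint W i (euler_steps (N i) t m a)) =
   (fun m => euler_at m t a + gstep ((gridix m t)%:R * mesh m) t (euler_at m t) a).
  by apply/funext => m; exact: euler_steps_sum.
rewrite EE in cR.
have := cvg2_unique (fun m => sqiD (sxm m) (sg m)) (sqiD sX (sqi0 P)) (sqiD sp1 sJs) cL cR.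
by apply: filterS => w; rewrite !fun_ringE fct_sumE addr0.
Qed.

Definition sde_solution (t : R) (w : T) : 'cV[R]_n := \col_a sde_limit a t w.

Lemma mul_sde_solutionE (M : 'M[R]_n) t w a : (M^T *m sde_solution t w) a 0 = lin_limit M a t w.
Proof.
by rewrite mxE /lin_limit lin_funE; apply: eq_bigr => b _; rewrite !mxE.
Qed.

Lemma sde_solution_L2 : L2 P F sde_solution.
Proof.
have mX a : measurable_fun [set: R * T] (fun z : R * T => sde_solution z.1 z.2 a 0).
  rewrite (_ : (fun z => _) = (fun z : R * T => sde_limit a z.1 z.2)).
    exact: (measurable_sde_limit a).
  by apply/funext => z; rewrite mxE.
split.
- move=> t; rewrite /= in_itv/= andbT => t0 a.
  rewrite (_ : (fun w => _) = sde_limit a t); last by apply/funext => w; rewrite mxE.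
  by have [] := sde_limit_ad a t0.
- by move=> a; apply: measurable_funTS; exact: mX.
rewrite -enorm_iterated//; last by move=> a; apply: measurable_funTS; exact: mX.
have mH : measurable_fun [set: R * T] (EFin \o enorm `[0, +oo[ sde_solution).
  by apply/measurable_EFinP; apply: measurable_enorm => // a; apply: measurable_funTS; exact: mX.
have H0 z : (0 <= (EFin \o enorm `[0%R, +oo[%classic sde_solution) z)%E by rewrite lee_fin enorm_ge0.
rewrite fubini_tonelli1//.
(* The decay is compared with the exponential density of parameter delta, whose integral is 1; hence
   the division by delta. *)
pose C1 := n%:R * (C0 * expR 1) / delta.
have C10 : 0 <= C1 by rewrite !mulr_ge0// ?expR_ge0// invr_ge0 ltW.
apply: (@le_lt_trans _ _ (\int[leb]_s (C1%:E * (exponential_pdf delta s)%:E))%E); last first.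
  rewrite ge0_integralZl_EFin//.
  - by rewrite integral_exponential_pdf// mule1 ltry.
  - by move=> s _; rewrite lee_fin exponential_pdf_ge0// ltW.
  - by apply/measurable_EFinP; exact: measurable_exponential_pdf.
apply: ge0_le_integral => //.
- by move=> s _; rewrite /fubini_F; apply: integral_ge0 => w _; exact: H0.
- exact: (@measurable_fun_fubini_tonelli_F _ _ _ _ _ P (EFin \o enorm `[0, +oo[ sde_solution)).
- by apply: measurable_funeM; apply/measurable_EFinP; exact: measurable_exponential_pdf.
move=> s _; rewrite /fubini_F /enorm /=; case: (ltP s 0) => s0.
  rewrite (eq_integral (cst 0%E)) ?integral0 ?mule_ge0 ?lee_fin ?exponential_pdf_ge0// ?ltW//.
  by move=> w _; rewrite indicE memNset ?mulr0//= in_itv/= andbT leNgt s0.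
rewrite exponential_pdfE// -EFinM.
have sX a : sqi P (sde_limit a s) := ad_sqi (sde_limit_ad a s0).
rewrite (eq_integral (fun w => \sum_a ((sde_limit a s w) ^+ 2)%:E)%E); last first.
  move=> w _; rewrite indicE mem_set/= ?mulr1; last by rewrite in_itv/= s0.
  by rewrite sumEFin; congr EFin; apply: eq_bigr => a _; rewrite mxE.
rewrite ge0_integral_sum//; last 2 first.
- by move=> a; apply/measurable_EFinP/measurable_funX; exact: sqi_meas (sX a).
- by move=> a w _; rewrite lee_fin sqr_ge0.
under eq_bigr do rewrite -ip_normE//.
rewrite sumEFin lee_fin.
apply: (@le_trans _ _ (\sum_(a < n) (C0 * expR 1 * expR (- delta * s)))).
  by apply: ler_sum => a _; exact: (sde_limit_decay).
rewrite sumr_const card_ord -[_ *+ n]mulr_natl /C1 le_eqVlt; apply/orP; left; apply/eqP.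
by field; rewrite gt_eqF.
Qed.
End limit.

(** * The Riccati inequality implies stabilizability *)

Section sufficiency.
Context (R : realType) d (T : measurableType d) (P : probability T R).
Context (F : R -> set (set T)) (q : nat) (K : 'M[R]_q) (W : R -> T -> 'cV[R]_q).
Hypothesis hF : right_continuous_complete_filtration P F.
Hypothesis hW : wiener_process P F K W.

Lemma mean_square_stable n (A : 'M[R]_n) (N : 'I_q -> 'M[R]_n) (Z : 'M[R]_n) (x0 : 'cV[R]_n) :
  posdefmx Z -> posdefmx (- lyap K A N Z) ->
  exists x : R -> T -> 'cV[R]_n, L2 P F x /\
  forall t, 0 <= t -> exists J : 'I_q -> T -> 'cV[R]_n,
    (forall i r, is_ito_integral P F (fun s w => W s w i 0)
       (fun s w => ((N i)^T *m x s w) r 0) t (fun w => J i w r 0)) /\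
    {ae P, forall w, x t w = x0
       + \col_r (\int[lebesgue_measure]_(s in `[0, t]) (A^T *m x s w) r 0)
       + \sum_(i < q) J i w}.
Proof.
move=> pZ nZ.
have [delta [h0 [C0 [delta0 /andP[h00 h01] dh0 C00 stable]]]] := euler_stable hF hW x0 pZ nZ.
have [c c0 gstep_c] := nrm2_gstep hF hW A N.
have [cl cl0 Hcl] := lin_norm_bound P A N.
exists (sde_solution W A N x0 h0).
split; first exact: (sde_solution_L2 hF hW delta0 h00 h01 dh0 C00 stable c0 gstep_c).
move=> t t0; exists (fun i w => \col_r ito_limit W A N x0 h0 (N i) i t r w); split.
  move=> i r.
  have -> : (fun w => (\col_r ito_limit W A N x0 h0 (N i) i t r w) r 0) = ito_limit W A N x0 h0 (N i) i t r.
    by apply/funext => w; rewrite mxE.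
  have -> : (fun s w => ((N i)^T *m sde_solution W A N x0 h0 s w) r 0) = (fun s => lin_limit W A N x0 h0 (N i) r s).
    by apply/funext => s; apply/funext => w; rewrite mul_sde_solutionE.
  exact: (is_ito_ito_limit hF hW delta0 h00 h01 dh0 C00 stable c0 gstep_c cl0 (Hcl (Some i))).
have XE a := sde_limit_equation hF hW delta0 h00 h01 dh0 C00 stable c0 gstep_c a t0.
apply: filterS (filter_forall _ XE) => w Ew; apply/colP => a.
rewrite !mxE summxE Ew; congr (_ + _ + _); last by apply: eq_bigr => i _; rewrite mxE.
by rewrite /prim; apply: eq_Rintegral => s _; rewrite mul_sde_solutionE.
Qed.

(* The closed loop of the feedback u = - (C Q x) / 2. *)
Lemma riccati_closed_loop n m p (A : 'M[R]_n) (N : 'I_q -> 'M[R]_n) (B : 'M[R]_(n, m))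
    (C : 'M[R]_(p, n)) (Q : 'M[R]_n) : posdefmx Q ->
  negdefmx (A^T *m invmx Q + invmx Q *m A
       + \sum_(i < q) \sum_(j < q) K i j *: ((N i)^T *m invmx Q *m N j)
       - C^T *m C
       + invmx Q *m B *m B^T *m invmx Q) ->
  posdefmx (- lyap K (A - 2^-1 *: (Q *m C^T *m C)) N (invmx Q)).
Proof.
move=> pQ [_ neg]; have [QT _] := pQ; have uQ := posdef_unit pQ.
have [ZT _] := posdef_inv pQ; set Z := invmx Q in neg ZT *.
have QZ : Q *m Z = 1%:M by rewrite mulmxV.
have ZQ : Z *m Q = 1%:M by rewrite mulVmx.
(* Each of the two drift terms pairs the gain Q C^T C / 2 with Q^-1 and leaves - C^T C / 2. *)
have lE : lyap K (A - 2^-1 *: (Q *m C^T *m C)) N Z = lyap K A N Z - C^T *m C.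
  have E1 : (2^-1 *: (Q *m C^T *m C))^T *m Z = 2^-1 *: (C^T *m C).
    by rewrite linearZ /= !trmx_mul trmxK QT -scalemxAl -!mulmxA QZ mulmx1.
  have E2 : Z *m (2^-1 *: (Q *m C^T *m C)) = 2^-1 *: (C^T *m C).
    by rewrite -scalemxAr !mulmxA ZQ mul1mx.
  have half : C^T *m C = 2^-1 *: (C^T *m C) + 2^-1 *: (C^T *m C).
    by rewrite -scalerDl (_ : 2^-1 + 2^-1 = 1 :> R) ?scale1r//; lra.
  rewrite /lyap linearB mulmxBl mulmxBr E1 E2 {3}half.
  by rewrite addrACA -opprD -[LHS]addrA [- _ + _]addrC addrA.
split; first by rewrite lE linearN linearB /= (lyap_tr A N (covariance_sym hW))// trmx_mul trmxK.
move=> v v0; have := neg v v0.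
rewrite -/(qf _ v) -[X in _ -> 0 < X]/(qf _ v) !qfN lE qfB /lyap.
(* As a Gram matrix this term is nonnegative, so dropping it preserves the strict inequality. *)
have -> : Z *m B *m B^T *m Z = (B^T *m Z)^T *m (B^T *m Z).
  by rewrite trmx_mul trmxK ZT !mulmxA.
rewrite qfD qfB (qf_gram (B^T *m Z)); have := sqnorm2_ge0 (B^T *m Z *m v); lra.
Qed.

Lemma riccati_stabilizable n m p (A : 'M[R]_n) (N : 'I_q -> 'M[R]_n) (B : 'M[R]_(n, m))
    (C : 'M[R]_(p, n)) (Q : 'M[R]_n) : posdefmx Q ->
  negdefmx (A^T *m invmx Q + invmx Q *m A
       + \sum_(i < q) \sum_(j < q) K i j *: ((N i)^T *m invmx Q *m N j)
       - C^T *m C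
       + invmx Q *m B *m B^T *m invmx Q) ->
  stabilizable P F W A^T C^T (fun i => (N i)^T).
Proof.
move=> pQ neg x0.
have [x [xL2 xeq]] := mean_square_stable x0 (posdef_inv pQ) (riccati_closed_loop pQ neg).
exists (fun s w => (- (2^-1 *: (C *m Q))) *m x s w); split; first exact: L2_mulmx.
exists x; split; last exact: xL2.
split=> t t0.
  apply: square_integrable_sub xL2 => // s.
  by rewrite /= !in_itv/= andbT => /andP[].
have [J [ito eq]] := xeq t t0; exists J; split; first exact: ito.
apply: filterS eq => w ->; congr (_ + _ + _).
(* As [Q] is symmetric, the transposed closed loop matrix is A^T - C^T C Q / 2, which acts on x as
   A^T x + C^T u. *)
apply/colP => a; rewrite !mxE; apply: eq_Rintegral => s _; congr (fun_of_matrix _ a 0).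
have [QT _] := pQ.
rewrite linearB /= linearZ /= !trmx_mul trmxK QT mulmxBl; congr (_ + _).
by rewrite mulNmx mulmxN -!scalemxAl -scalemxAr !mulmxA.
Qed.
End sufficiency.

Theorem lemma3p2 (R : realType) (d : measure_display) (T : measurableType d)
    (Pr : probability T R) (F : R -> set (set T)) (q n m p : nat)
    (K : 'M[R]_q) (W : R -> T -> 'cV[R]_q)
    (A : 'M[R]_n) (N : 'I_q -> 'M[R]_n) (B : 'M[R]_(n, m)) (C : 'M[R]_(p, n))
    (hF : right_continuous_complete_filtration Pr F)
    (hW : wiener_process Pr F K W) :
  (exists P : 'M[R]_n, posdefmx P /\
     negdefmx (A^T *m invmx P + invmx P *m A
       + \sum_(i < q) \sum_(j < q) K i j *: ((N i)^T *m invmx P *m N j)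
       - C^T *m C
       + invmx P *m B *m B^T *m invmx P)) <->
  stabilizable Pr F W A^T C^T (fun i => (N i)^T).
Proof.
split; last exact: stabilizable_riccati.
by move=> [P [pP neg]]; exact: (riccati_stabilizable hF hW pP neg).
Qed.
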